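(* Let $\ell$ be a prime and let $\sigma=\nu_1\times\nu_2\rtimes\rho$ be an irreducible unramified principal series representation of $G(\mathbf{Q}_\ell)$, with central character $\omega_\sigma=\nu_1\nu_2\rho^2$, and let $\varphi_0\in\sigma$ be a non-zero $G(\mathbf{Z}_\ell)$-invariant vector. Let $k_1,k_2\ge 0$ be integers and $\tau_1,\tau_2$ finite-order unramified characters of $\mathbf{Q}_\ell^\times$; put $\psi_1=\psi_2=|\cdot|^{-1/2}$ and $\chi_i=|\cdot|^{1/2+k_i}\tau_i$, and assume $\chi_1\chi_2\psi_1\psi_2\omega_\sigma=1$. If $k_1=0$ or $k_2=0$, assume moreover that $\sigma$ is essentially tempered (a twist of a tempered representation by a character). Let $\mathfrak{z}$ be any $H(\mathbf{Q}_\ell)$-invariant bilinear form $I_H(\underline{\chi},\underline{\psi})\otimes\sigma\to\mathbf{C}$. Then for every integer $t\ge1$, \[\mathfrak{z}\left(F_{\underline{\phi}_t},\varphi_0\right)=\frac{1}{\ell^{2t-2}(\ell+1)^2}\left(1-\tfrac{\ell^{k_1}}{\tau_1(\ell)}\right)\left(1-\tfrac{\ell^{k_2}}{\tau_2(\ell)}\right)\mathfrak{z}\left(F_{\underline{\phi}_0},\varphi_0\right),\] and \[\mathfrak{z}\left(F_{\underline{\phi}_1},U(\ell)\varphi_0\right)=\frac{\ell}{(\ell+1)^2}\left[\left(1-\tfrac{\ell^{k_1}}{\tau_1(\ell)}\right)\left(1-\tfrac{\ell^{k_2}}{\tau_2(\ell)}\right)-L(\sigma,-\tfrac12)^{-1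}\right]\mathfrak{z}\left(F_{\underline{\phi}_0},\varphi_0\right).\]
   Context: $G=\mathrm{GSp}_4$: $G(R)=\{(g,\mu)\in\mathrm{GL}_4(R)\times R^\times: g^tJg=\mu J\}$ with $J=\begin{pmatrix}0&0&0&1\\0&0&1&0\\0&-1&0&0\\-1&0&0&0\end{pmatrix}$. $H=\mathrm{GL}_2\times_{\mathrm{GL}_1}\mathrm{GL}_2$ (pairs of matrices with equal determinant), embedded in $G$ by $\iota\left(\begin{pmatrix}a&b\\c&d\end{pmatrix},\begin{pmatrix}a'&b'\\c'&d'\end{pmatrix}\right)=\begin{pmatrix}a&0&0&b\\0&a'&b'&0\\0&c'&d'&0\\c&0&0&d\end{pmatrix}$; $H(\mathbf{Q}_\ell)$ acts on $\sigma$ through $\iota$. All representations are smooth on complex vector spaces. $|\cdot|$ is normalised with $|\ell|=\ell^{-1}$; $dx$, $d^\times x$ are Haar measures giving $\mathbf{Z}_\ell$, $\mathbf{Z}_\ell^\times$ volume 1; $e_\ell$ is the additive character with $e_\ell(\ell^{-n})=\exp(2\pi i/\ell^n)$. For a character $\chi$ of $\mathbf{Q}_\ell^\times$, $L(\chi,s)=(1-\chi(\ell)\ell^{-s})^{-1}$ if $\chi$ is unramified and $1$ otherwise. Principal series of $G$: for smooth characters $\nu_1,\nu_2,\rho$ with $|\cdot|^{\pm1}\notin\{\nu_1,\nu_2,\nu_1\nu_2,\nu_1/\nu_2\}$, $\nu_1\times\nu_2\rtimes\rho$ is the space of $f:G(\mathbf{Q}_\ell)\to\mathbf{C}$ with $f(bg)=|x^2y|\,|z|^{-3/2}\nu_1(x)\nu_2(y)\rho(z)f(g)$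 for all upper triangular $b\in G(\mathbf{Q}_\ell)$ with diagonal $(x,y,zy^{-1},zx^{-1})$, with $G$ acting by right translation; it is unramified when $\nu_1,\nu_2,\rho$ are unramified. Its spin $L$-factor is $L(\sigma,s)=L(\rho,s)L(\rho\nu_1,s)L(\rho\nu_2,s)L(\rho\nu_1\nu_2,s)$. The operator $U(\ell)$ is $U(\ell)\varphi=\sum_{u,v,w\in\mathbf{Z}/\ell}\begin{pmatrix}\ell&0&u&v\\0&\ell&w&u\\0&0&1&0\\0&0&0&1\end{pmatrix}\varphi$. Induced representations: for characters $\chi,\psi$ of $\mathbf{Q}_\ell^\times$, $I(\chi,\psi)$ is the space of smooth $f:\mathrm{GL}_2(\mathbf{Q}_\ell)\to\mathbf{C}$ with $f\left(\begin{pmatrix}a&b\\0&d\end{pmatrix}g\right)=\chi(a)\psi(d)|a/d|^{1/2}f(g)$. For pairs $\underline\chi=(\chi_1,\chi_2)$, $\underline\psi=(\psi_1,\psi_2)$, $I_H(\underline\chi,\underline\psi)$ is the space of restrictions to $H(\mathbf{Q}_\ell)$ of functions in $I(\chi_1,\psi_1)\otimes I(\chi_2,\psi_2)$, with $H$ acting by right translation. Siegel sections: for a Schwartz function $\phi$ on $\mathbf{Q}_\ell^2$ (row vectors), the integral $f(g,s)=\frac{\chi(\det g)|\det g|^{s+1/2}}{L(\chi/\psi,2s+1)}\int_{\mathbf{Q}_\ell^\times}\phi((0,x)g)(\chi/\psi)(x)|x|^{2s+1}d^\times x$ converges for $\mathrm{Re}(s)\gg0$ and extends to a Laurent polynomial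 in $\ell^{s}$; its value at $s=0$ defines $f_{\phi,\chi,\psi}\in I(\chi,\psi)$. The Fourier transform is $\hat\phi(x,y)=\iint e_\ell(xv-yu)\phi(u,v)\,du\,dv$. For $\underline\phi=\phi_1\otimes\phi_2$ set $F_{\underline\phi}$ to be the restriction to $H(\mathbf{Q}_\ell)$ of $f_{\hat\phi_1,\chi_1,\psi_1}\otimes f_{\hat\phi_2,\chi_2,\psi_2}$, an element of $I_H(\underline\chi,\underline\psi)$. Let $\phi_0=\mathrm{ch}(\mathbf{Z}_\ell\times\mathbf{Z}_\ell)$, $\phi_t=\mathrm{ch}(\ell^t\mathbf{Z}_\ell\times\mathbf{Z}_\ell^\times)$ for $t\ge1$, and $\underline\phi_t=\phi_t\otimes\phi_t$. *)

(* Defs.v *)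
From HB Require Import structures.
From mathcomp Require Import all_boot all_order all_algebra.
From mathcomp Require Import all_classical all_reals all_analysis.
From mathcomp.real_closed Require Import complex.

Set Implicit Arguments.
Unset Strict Implicit.
Unset Printing Implicit Defensive.
Import Order.TTheory GRing.Theory Num.Theory.
Local Open Scope classical_set_scope.
Local Open Scope complex_scope.
Local Open Scope ring_scope.

(* The field of l-adic numbers, characterised up to unique isomorphism as the *)
(* completion of the rationals: a complete field for an ultrametric absolute  *)
(* value with |l| = 1/l, in which the rationals are dense.  The absolute      *)
(* value cannot be the norm of a normedZmodType, whose axioms force           *)
(* |x *+ n| = |x| *+ n.                                                       *)
HB.mixin Record isPadicField (l : nat) (R : realType) F
    of GRing.Field F & Topological F := {
  pabs : F -> R ;
  pabs_ge0 : forall x : F, 0 <= pabs x ;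
  pabs_eq0 : forall x : F, (pabs x == 0) = (x == 0) ;
  pabsM : forall x y : F, pabs (x * y) = pabs x * pabs y ;
  pabsD : forall x y : F, pabs (x + y) <= Num.max (pabs x) (pabs y) ;
  pabs_prime : pabs l%:R = l%:R^-1 ;
  nbhs_pabs : forall (x : F) (A : set F),
    nbhs x A <-> exists2 r : R, 0 < r & [set y : F | pabs (y - x) < r] `<=` A ;
  dense_ratr : dense (range (fun q : rat => ratr q : F)) ;
  pabs_complete : forall u : nat -> F,
    (forall r : R, 0 < r -> \forall n \near \oo, forall m, (n <= m)%N ->
       pabs (u m - u n) < r) ->
    exists x : F, u n @[n --> \oo] --> x
}.

#[short(type="padicType")]
HB.structure Definition PadicField (l : nat) (R : realType) :=
  {F of isPadicField l R F & GRing.Field F & Topological F}.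

#[non_forgetful_inheritance]
HB.instance Definition _ (l : nat) (R : realType) (F : padicType l R) :=
  isPointed.Build (PadicField.sort F) 0.

Section Complex.
Context {R : realType}.

Definition cis (t : R) : R[i] := cos t +i* sin t.

(* a ^ s for a real a > 0 and a complex s *)
Definition cpow (a : R) (s : R[i]) : R[i] :=
  (a `^ complex.Re s)%:C * cis (complex.Im s * ln a).

Context {d : measure_display} {T : measurableType d}.

Definition cintegrable (mu : {measure set T -> \bar R}) (D : set T)
    (f : T -> R[i]) : Prop :=
  mu.-integrable D (fun x => (complex.Re (f x))%:E) /\
  mu.-integrable D (fun x => (complex.Im (f x))%:E).

Definition cintegral (mu : {measure set T -> \bar R}) (D : set T)
    (f : T -> R[i]) : R[i] :=
  Rintegral mu D (fun x => complex.Re (f x)) +i*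
  Rintegral mu D (fun x => complex.Im (f x)).

End Complex.

Section Characters.
Context {l : nat} {R : realType} {F : padicType l R}.

(* Characters of F^* are represented by functions on F; the value at 0 is     *)
(* irrelevant.                                                                *)
Definition is_char (chi : F -> R[i]) : Prop :=
  [/\ chi 1 = 1,
      forall x y, x != 0 -> y != 0 -> chi (x * y) = chi x * chi y
    & \forall u \near (1 : F), chi u = 1].

Definition eq_char (chi psi : F -> R[i]) : Prop :=
  forall x, x != 0 -> chi x = psi x.

Definition unramified (chi : F -> R[i]) : Prop :=
  forall u, pabs u = 1 -> chi u = 1.

Definition finite_order (chi : F -> R[i]) : Prop :=
  exists2 n : nat, (0 < n)%N & forall x, x != 0 -> chi x ^+ n = 1.

Definition abschar (r : R) (x : F) : R[i] := (pabs x `^ r)%:C.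

(* As 0^-1 = 0, the inverse (Lchar chi s)^-1 is 1 - chi(l) l^-s also where    *)
(* the L-factor has a pole; the same holds for Lspin.                         *)
Definition Lchar (chi : F -> R[i]) (s : R[i]) : R[i] :=
  if `[< unramified chi >] then (1 - chi l%:R * cpow l%:R (- s))^-1 else 1.

Definition Lspin (nu1 nu2 rho : F -> R[i]) (s : R[i]) : R[i] :=
  Lchar rho s * Lchar (fun x => rho x * nu1 x) s *
  Lchar (fun x => rho x * nu2 x) s * Lchar (fun x => rho x * nu1 x * nu2 x) s.

Definition is_std_addchar (e : F -> R[i]) : Prop :=
  [/\ forall x y, e (x + y) = e x * e y,
      \forall x \near (0 : F), e x = 1
    & forall n : nat, e (l%:R ^- n) = cis (2 * pi / l%:R ^+ n)].

End Characters.

Section Groups.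
Context {l : nat} {R : realType} {F : padicType l R}.

Definition mx_of (n : nat) (s : seq (seq F)) : 'M[F]_n :=
  \matrix_(i, j) nth 0 (nth [::] s i) j.

Definition rv2 (x y : F) : 'rV[F]_2 := \row_(j < 2) nth 0 [:: x; y] j.

Definition Jmx : 'M[F]_4 := mx_of 4
  [:: [:: 0;  0; 0; 1];
      [:: 0;  0; 1; 0];
      [:: 0; -1; 0; 0];
      [:: -1; 0; 0; 0]].

(* The multiplier mu of (g, mu) in GSp4 is determined by g, being the entry   *)
(* (0, 3) of mu *: J; elements of GSp4 are represented by g alone.            *)
Definition sim (g : 'M[F]_4) : F := (g^T *m Jmx *m g) 0 3.

Definition GSp4 (g : 'M[F]_4) : bool :=
  [&& g \in unitmx, sim g != 0 & g^T *m Jmx *m g == sim g *: Jmx].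

Definition GSp4Z (g : 'M[F]_4) : bool :=
  [&& GSp4 g, [forall i, forall j, pabs (g i j) <= 1], pabs (\det g) == 1
    & pabs (sim g) == 1].

Definition GL2 (g : 'M[F]_2) : bool := g \in unitmx.

Definition Hgrp (h : 'M[F]_2 * 'M[F]_2) : bool :=
  [&& GL2 h.1, GL2 h.2 & \det h.1 == \det h.2].

Definition iota_H (h : 'M[F]_2 * 'M[F]_2) : 'M[F]_4 := mx_of 4
  [:: [:: h.1 0 0; 0;       0;       h.1 0 1];
      [:: 0;       h.2 0 0; h.2 0 1; 0      ];
      [:: 0;       h.2 1 0; h.2 1 1; 0      ];
      [:: h.1 1 0; 0;       0;       h.1 1 1]].

Definition rtrans n (h : 'M[F]_n) (f : 'M[F]_n -> R[i]) : 'M[F]_n -> R[i] :=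
  fun g => f (g *m h).

Definition rtransH (h : 'M[F]_2 * 'M[F]_2) (f : 'M[F]_2 * 'M[F]_2 -> R[i]) :
    'M[F]_2 * 'M[F]_2 -> R[i] :=
  fun g => f (g.1 *m h.1, g.2 *m h.2).

(* A function on a group of matrices is represented by its extension by zero  *)
(* to all matrices.                                                           *)
Definition zero_off T (G : pred T) (f : T -> R[i]) : Prop :=
  forall g, ~~ G g -> f g = 0.

(* invariance under right translation by an open subgroup of G                *)
Definition smooth_fun n (G : pred 'M[F]_n) (f : 'M[F]_n -> R[i]) : Prop :=
  \forall h \near (1%:M : 'M[F]_n), G h -> rtrans h f = f.

Definition principal_series (nu1 nu2 rho : F -> R[i]) : set ('M[F]_4 -> R[i]) :=
  [set f | [/\ zero_off GSp4 f, smooth_fun GSp4 f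
    & forall (b g : 'M[F]_4) (x y z : F), GSp4 b -> GSp4 g ->
        (forall i j : 'I_4, (j < i)%N -> b i j = 0) ->
        b 0 0 = x -> b 1 1 = y -> b 2 2 = z / y -> b 3 3 = z / x ->
        f (b *m g) = abschar 1 (x ^+ 2 * y) * abschar (- (3 / 2)) z *
                     nu1 x * nu2 y * rho z * f g]].

Definition principal_series_cond (nu1 nu2 rho : F -> R[i]) : Prop :=
  [/\ is_char nu1, is_char nu2, is_char rho
    & forall r : R, r = 1 \/ r = -1 ->
        [/\ ~ eq_char nu1 (abschar r), ~ eq_char nu2 (abschar r),
            ~ eq_char (fun x => nu1 x * nu2 x) (abschar r)
          & ~ eq_char (fun x => nu1 x / nu2 x) (abschar r)]].

Definition Umx (u v w : F) : 'M[F]_4 := mx_of 4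
  [:: [:: l%:R; 0; u; v];
      [:: 0; l%:R; w; u];
      [:: 0; 0;    1; 0];
      [:: 0; 0;    0; 1]].

Definition Uop (f : 'M[F]_4 -> R[i]) : 'M[F]_4 -> R[i] :=
  fun g => \sum_(u < l) \sum_(v < l) \sum_(w < l)
    rtrans (Umx u%:R v%:R w%:R) f g.

Definition indGL2 (chi psi : F -> R[i]) : set ('M[F]_2 -> R[i]) :=
  [set f | [/\ zero_off GL2 f, smooth_fun GL2 f
    & forall (a b d : F) (g : 'M[F]_2), a != 0 -> d != 0 -> GL2 g ->
        f (mx_of 2 [:: [:: a; b]; [:: 0; d]] *m g) =
        chi a * psi d * abschar 2^-1 (a / d) * f g]].

Definition restrH (f : 'M[F]_2 * 'M[F]_2 -> R[i]) :
    'M[F]_2 * 'M[F]_2 -> R[i] :=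
  fun h => if Hgrp h then f h else 0.

Definition indH (chi1 chi2 psi1 psi2 : F -> R[i]) :
    set ('M[F]_2 * 'M[F]_2 -> R[i]) :=
  [set f | exists n (f1 f2 : 'I_n -> 'M[F]_2 -> R[i]),
    [/\ forall i, indGL2 chi1 psi1 (f1 i), forall i, indGL2 chi2 psi2 (f2 i)
      & f = restrH (fun h => \sum_(i < n) f1 i h.1 * f2 i h.2)]].

Definition invariant_bilinear (I : set ('M[F]_2 * 'M[F]_2 -> R[i]))
    (S : set ('M[F]_4 -> R[i]))
    (z : ('M[F]_2 * 'M[F]_2 -> R[i]) -> ('M[F]_4 -> R[i]) -> R[i]) : Prop :=
  [/\ forall a f1 f2 v, I f1 -> I f2 -> S v ->
        z (fun h => a * f1 h + f2 h) v = a * z f1 v + z f2 v,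
      forall a f v1 v2, I f -> S v1 -> S v2 ->
        z f (fun g => a * v1 g + v2 g) = a * z f v1 + z f v2
    & forall h f v, Hgrp h -> I f -> S v ->
        z (rtransH h f) (rtrans (iota_H h) v) = z f v].

End Groups.

(* Representations of GSp4(F): a subspace V of E and, for g in GSp4(F), an    *)
(* operator act g preserving V.                                               *)
Section Representations.
Context {l : nat} {R : realType} {F : padicType l R}.
Context {E : lmodType R[i]}.
Implicit Types (V W : set E) (act : 'M[F]_4 -> E -> E).

Definition is_subspace V : Prop :=
  V 0 /\ forall (a : R[i]) u v, V u -> V v -> V (a *: u + v).

Definition irreducible_rep V act : Prop :=
  V <> [set 0] /\
  forall W, is_subspace W -> W `<=` V ->
    (forall g v, GSp4 g -> W v -> W (act g v)) -> W = [set 0] \/ W = V.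

Definition smooth_dual V act : set (E -> R[i]) :=
  [set lam |
    (forall a u v, V u -> V v -> lam (a *: u + v) = a * lam u + lam v) /\
    \forall h \near (1%:M : 'M[F]_4), GSp4 h ->
      forall v, V v -> lam (act h v) = lam v].

(* The Borel sigma-algebra of the quotient of GSp4(F) by its centre Z is      *)
(* identified with the sigma-algebra generated by the Z-stable open subsets   *)
(* of GSp4(F).                                                                *)
Definition PGSp4_open : set (set 'M[F]_4) :=
  [set A | (exists2 U : set 'M[F]_4, open U & A = U `&` [set g | GSp4 g]) /\
           forall (z : F) g, z != 0 -> A g -> A (z *: g)].

Definition PGSp4_borel := g_sigma_algebraType PGSp4_open.

Definition is_haar_PGSp4 (m : {measure set PGSp4_borel -> \bar R}) : Prop :=
  [/\ m [set g : 'M[F]_4 | ~~ GSp4 g] = 0%E,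
      m [set g : 'M[F]_4 | exists z k, [/\ z != 0, GSp4Z k & g = z *: k]]
        = 1%E
    & forall (g : 'M[F]_4) (A : set PGSp4_borel), GSp4 g -> measurable A ->
        m ((fun x : 'M[F]_4 => g *m x) @` A) = m A].

(* irreducible, with unitary central character and matrix coefficients in     *)
(* L^(2+eps) modulo the centre for every eps > 0                              *)
Definition tempered V act : Prop :=
  [/\ irreducible_rep V act,
      forall z : F, z != 0 -> exists w : R[i],
        `|w| = 1 /\ forall v, V v -> act z%:M v = w *: v
    & exists2 m : {measure set PGSp4_borel -> \bar R}, is_haar_PGSp4 m &
        forall v lam (eps : R), V v -> smooth_dual V act lam -> 0 < eps ->
          (\int[m]_(g in [set g : 'M[F]_4 | GSp4 g])
             (complex.Re `|lam (act g v)| `^ (2 + eps))%:E < +oo)%E].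

Definition twist (eta : F -> R[i]) act : 'M[F]_4 -> E -> E :=
  fun g v => eta (sim g) *: act g v.

Definition essentially_tempered V act : Prop :=
  exists2 eta : F -> R[i], is_char eta & tempered V (twist eta act).

End Representations.

Section Siegel.
Context {l : nat} {R : realType} {F : padicType l R}.

Definition padic_borel := g_sigma_algebraType (@open F).

Definition is_haar_add (mu : {measure set padic_borel -> \bar R}) : Prop :=
  mu [set x : F | pabs x <= 1] = 1%E /\
  forall (a : F) (A : set padic_borel), measurable A ->
    mu ((fun x : F => a + x) @` A) = mu A.

(* Haar measure of F^*, extended by zero to F                                 *)
Definition is_haar_mul (nu : {measure set padic_borel -> \bar R}) : Prop :=
  [/\ nu [set (0 : F)] = 0%E, nu [set x : F | pabs x = 1] = 1%E
    & forall (a : F) (A : set padic_borel), a != 0 -> measurable A ->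
        nu ((fun x : F => a * x) @` A) = nu A].

Definition fourier (mu : {measure set padic_borel -> \bar R}) (e : F -> R[i])
    (phi : 'rV[F]_2 -> R[i]) : 'rV[F]_2 -> R[i] :=
  fun w => cintegral mu setT (fun u : F => cintegral mu setT (fun v : F =>
    e (w 0 0 * v - w 0 1 * u) * phi (rv2 u v))).

Definition zeta_integrand (phi : 'rV[F]_2 -> R[i]) (chi psi : F -> R[i])
    (g : 'M[F]_2) (s : R[i]) (x : F) : R[i] :=
  phi (rv2 0 x *m g) * (chi x / psi x) * cpow (pabs x) (2 * s + 1).

Definition siegel_at (nu : {measure set padic_borel -> \bar R})
    (phi : 'rV[F]_2 -> R[i]) (chi psi : F -> R[i])
    (g : 'M[F]_2) (s : R[i]) : R[i] :=
  chi (\det g) * cpow (pabs (\det g)) (s + 2^-1) /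
  Lchar (fun x : F => chi x / psi x) (2 * s + 1) *
  cintegral nu [set x : F | x != 0] (zeta_integrand phi chi psi g s).

(* c is the value at s = 0 of the Laurent polynomial in l^s (written          *)
(* P(l^s) / l^(ms)) that agrees with siegel_at for Re s large.                *)
Definition siegel_value (nu : {measure set padic_borel -> \bar R})
    (phi : 'rV[F]_2 -> R[i]) (chi psi : F -> R[i])
    (g : 'M[F]_2) (c : R[i]) : Prop :=
  exists (P : {poly R[i]}) (m : nat) (s0 : R),
    (forall s : R[i], s0 < complex.Re s ->
       cintegrable nu [set x : F | x != 0] (zeta_integrand phi chi psi g s) /\
       siegel_at nu phi chi psi g s =
         P.[cpow l%:R s] / cpow l%:R s ^+ m) /\
    c = P.[1].

Definition siegel (nu : {measure set padic_borel -> \bar R})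
    (phi : 'rV[F]_2 -> R[i]) (chi psi : F -> R[i]) : 'M[F]_2 -> R[i] :=
  fun g => if GL2 g then xget 0 [set c | siegel_value nu phi chi psi g c]
           else 0.

Definition Fsec (mu nu : {measure set padic_borel -> \bar R}) (e : F -> R[i])
    (chi1 chi2 psi1 psi2 : F -> R[i]) (phi1 phi2 : 'rV[F]_2 -> R[i]) :
    'M[F]_2 * 'M[F]_2 -> R[i] :=
  restrH (fun h => siegel nu (fourier mu e phi1) chi1 psi1 h.1 *
                   siegel nu (fourier mu e phi2) chi2 psi2 h.2).

Definition phi0 (w : 'rV[F]_2) : R[i] :=
  ((pabs (w 0 0) <= 1) && (pabs (w 0 1) <= 1))%:R.

Definition phit (t : nat) (w : 'rV[F]_2) : R[i] :=
  ((pabs (w 0 0) <= l%:R ^- t) && (pabs (w 0 1) == 1))%:R.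

End Siegel.

Arguments padic_borel {l R} F.

(* Main.v *)
(* Write B(p, p'; g) = z (p (x) p', g v0).  It is invariant under              *)
(* (p, p', g) -> (h1 p, h2 p', iota (h1, h2) g k) for (h1, h2) in H and k in    *)
(* K = GSp4(Z_l).  The Siegel sections attached to phi_0 and phi_t are the      *)
(* spherical section f of I(chi, psi) and a multiple of e_t - e_(t-1), where    *)
(* e_n is the translate of f by diag (1, l^n).  The Hecke relation of GL2,      *)
(* applied in each variable separately, expresses B(e_n, e_m; 1) through        *)
(* B(f, f; 1); this gives the first formula.  For the second one, the summands  *)
(* of U(l) v0 fall into two orbits under H(Z_l), those of diag (l, l, 1, 1) and *)
(* of its translate by a unipotent element.  The stabiliser of the latter       *)
(* contains the pairs (h, w h w), w the permutation matrix, so that at this     *)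
(* point the GL2 relations reduce B(e_i, e_j) to B(f, f) and to one further     *)
(* unknown.  Both are found from the Hecke operators T(l) and T_1(l^2) of GSp4, *)
(* of which v0 is an eigenvector: sorting their right cosets by H(Z_l)-orbits   *)
(* gives two linear equations, and the condition on the central character turns *)
(* their solution into the stated formula.                                      *)
From HB Require Import structures.
Require Import Defs.
From mathcomp Require Import all_boot all_order all_algebra.
From mathcomp Require Import all_classical all_reals all_analysis.
From mathcomp.real_closed Require Import complex.
From mathcomp Require Import measurable_realfun ring lra zify.

Set Implicit Arguments.
Unset Strict Implicit.
Unset Printing Implicit Defensive.
Import Order.TTheory GRing.Theory Num.Theory.
Local Open Scope classical_set_scope.
Local Open Scope complex_scope.
Local Open Scope ring_scope.

(** * The ring of l-adic integers *)

Section PadicField.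
Context {l : nat} {R : realType} {F : padicType l R}.
Implicit Types x y u : F.

Lemma pabs0 : pabs (0 : F) = 0.
Proof. by apply/eqP; rewrite pabs_eq0. Qed.

Lemma pabs_gt0 x : (0 < pabs x) = (x != 0).
Proof. by rewrite lt_neqAle pabs_ge0 andbT eq_sym pabs_eq0. Qed.

Lemma pabs1 : pabs (1 : F) = 1.
Proof.
have h : pabs (1 : F) != 0 by rewrite pabs_eq0 oner_eq0.
by apply: (mulfI h); rewrite -pabsM !mulr1.
Qed.

Lemma pabsN1 : pabs (-1 : F) = 1.
Proof.
apply/eqP; rewrite -(@eqrXn2 _ 2) ?pabs_ge0 ?ler01 //.
by rewrite expr2 -pabsM mulrNN mulr1 pabs1 expr1n.
Qed.

Lemma pabsN x : pabs (- x) = pabs x.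
Proof. by rewrite -mulN1r pabsM pabsN1 mul1r. Qed.

Lemma pabs_sub x y : pabs (x - y) = pabs (y - x).
Proof. by rewrite -pabsN opprB. Qed.

Lemma pabsV x : pabs x^-1 = (pabs x)^-1.
Proof.
have [->|x0] := eqVneq x 0; first by rewrite invr0 pabs0 invr0.
have h : pabs x != 0 by rewrite pabs_eq0.
by apply: (mulfI h); rewrite -pabsM !divff // pabs1.
Qed.

Lemma pabsX x n : pabs (x ^+ n) = pabs x ^+ n.
Proof. by elim: n => [|n IH]; rewrite ?expr0 ?pabs1 // !exprS pabsM IH. Qed.

Lemma pabsXz x (n : int) : pabs (x ^ n) = pabs x ^ n.
Proof.
by case: n => n; rewrite ?NegzE -?exprnN -?exprnP ?pabsV pabsX.
Qed.

Lemma pabs_addl x y : pabs y < pabs x -> pabs (x + y) = pabs x.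
Proof.
move=> yx; apply/eqP; rewrite eq_le; apply/andP; split.
  by rewrite (le_trans (pabsD _ _)) // ge_max lexx ltW.
have := pabsD (x + y) (- y); rewrite addrK pabsN le_max => /orP[//|].
by rewrite leNgt yx.
Qed.

Definition Zl : {pred F} := [pred x | pabs x <= 1].

Lemma ZlE x : (x \in Zl) = (pabs x <= 1). Proof. by []. Qed.

Fact Zl_subring_closed : subring_closed Zl.
Proof.
split=> [|x y|x y]; rewrite !ZlE.
- by rewrite pabs1.
- by move=> hx hy; rewrite (le_trans (pabsD _ _)) // ge_max hx pabsN.
- by move=> hx hy; rewrite pabsM mulr_ile1 ?pabs_ge0.
Qed.
HB.instance Definition _ := GRing.isSubringClosed.Build F Zl Zl_subring_closed.

Lemma pabs_le_div x y : y != 0 -> (pabs x <= pabs y) = (x / y \in Zl).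
Proof. by move=> y0; rewrite ZlE pabsM pabsV ler_pdivrMr ?pabs_gt0 // mul1r. Qed.

Lemma pabs_unit_neq0 x : pabs x = 1 -> x != 0.
Proof. by move=> h; rewrite -pabs_gt0 h. Qed.

Lemma unitZl x : pabs x = 1 -> x \in Zl /\ x^-1 \in Zl.
Proof. by move=> h; rewrite !ZlE pabsV h invr1 lexx. Qed.

Hypothesis hl : prime l.

Lemma lgt0 : 0 < l%:R :> R.
Proof. by rewrite ltr0n prime_gt0. Qed.

Lemma lge1 : 1 < l%:R :> R.
Proof. by rewrite ltr1n prime_gt1. Qed.

Lemma lF_neq0 : l%:R != 0 :> F.
Proof. by rewrite -pabs_gt0 pabs_prime invr_gt0 lgt0. Qed.

Lemma pabs_l_lt1 : pabs (l%:R : F) < 1.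
Proof. by rewrite pabs_prime invf_lt1 ?lge1 ?lgt0. Qed.

Lemma l_Zl : l%:R \in Zl.
Proof. exact: rpred_nat. Qed.

Lemma pabs_nat_coprime n : coprime n l -> pabs (n%:R : F) = 1.
Proof.
move=> co; apply/eqP; rewrite eq_le; apply/andP; split.
  by rewrite -ZlE rpred_nat.
have n0 : (0 < n)%N.
  by case: n co => //; rewrite /coprime gcd0n => /eqP h; move: hl; rewrite h.
have [a b e _] := egcdnP l n0.
have {}e : (a%:R * n%:R : F) = b%:R * l%:R + 1.
  by rewrite -!natrM e (eqP co) natrD.
have h : pabs (a%:R * n%:R : F) = 1.
  rewrite e addrC -[RHS]pabs1 pabs_addl // pabs1 pabsM.
  rewrite (le_lt_trans _ pabs_l_lt1) // ler_piMl ?pabs_ge0 //.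
  by rewrite -ZlE rpred_nat.
rewrite -h pabsM ler_piMl ?pabs_ge0 // -ZlE rpred_nat //.
Qed.

Lemma pabs_int_pow (z : int) : z != 0 ->
  exists n, pabs (z%:~R : F) = pabs (l%:R ^+ n : F).
Proof.
move=> z0; exists (logn l `|z|).
have -> : pabs (z%:~R : F) = pabs (`|z|%N%:R : F).
  by case: z {z0} => // n; rewrite NegzE mulrNz pabsN abszN.
have h0 : (0 < `|z|)%N by rewrite absz_gt0.
have [m co e] := pfactor_coprime hl h0.
by rewrite {1}e natrM natrX pabsM pabs_nat_coprime ?mul1r // coprime_sym.
Qed.

Lemma pabs_rat_pow (q : rat) : ratr q != 0 :> F ->
  exists n : int, pabs (ratr q : F) = pabs (l%:R ^ n : F).
Proof.
rewrite /ratr => h.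
have n0 : numq q != 0 by apply: contraNneq h => ->; rewrite mul0r.
have [a ha] := pabs_int_pow n0.
have [b hb] := pabs_int_pow (denq_neq0 q).
exists (a%:Z - b%:Z); rewrite pabsM pabsV ha hb expfzDr ?lF_neq0 //.
by rewrite pabsM -exprnN -!exprnP pabsV.
Qed.

Lemma rat_approx x (r : R) : 0 < r -> exists q : rat, pabs (ratr q - x) < r.
Proof.
move=> r0.
pose B := [set y : F | pabs (y - x) < r].
have oB : open B.
  rewrite openE => y /= yB; apply/nbhs_pabs; exists r => // z /= zy.
  rewrite /B /= -(subrKA y) (le_lt_trans (pabsD _ _)) // gt_max zy.
  exact: yB.
have nB : B !=set0 by exists x; rewrite /B /= subrr pabs0.
have [y [yB [q _ qy]]] := dense_ratr B nB oB.
by exists q; rewrite qy.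
Qed.

Lemma pabs_pow x : x != 0 -> exists n : int, pabs x = pabs (l%:R ^ n : F).
Proof.
rewrite -pabs_gt0 => x0; have [q hq] := rat_approx x x0.
have e : pabs (ratr q : F) = pabs x.
  by rewrite -[ratr q](subrK x) addrC pabs_addl.
rewrite -e; apply: pabs_rat_pow.
by rewrite -pabs_gt0 e.
Qed.

Lemma pabs_lXz (n : int) : pabs (l%:R ^ n : F) = l%:R ^ (- n).
Proof. by rewrite pabsXz pabs_prime exprz_inv. Qed.

Lemma pabs_lX (n : nat) : pabs (l%:R ^+ n : F) = l%:R ^- n.
Proof. by rewrite pabsX pabs_prime exprVn. Qed.

Lemma unit_decomp x : x != 0 ->
  exists (n : int) u, pabs u = 1 /\ x = l%:R ^ n * u.
Proof.
move=> x0; have [n hn] := pabs_pow x0; exists n, (x / l%:R ^ n); split.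
  by rewrite pabsM pabsV hn divff // pabs_eq0 expfz_neq0 // lF_neq0.
by rewrite mulrCA divff ?mulr1 // expfz_neq0 // lF_neq0.
Qed.

Lemma Zl_unit_decomp x : x != 0 -> x \in Zl ->
  exists (n : nat) u, pabs u = 1 /\ x = l%:R ^+ n * u.
Proof.
move=> /unit_decomp[n [u [hu ->]]]; rewrite ZlE pabsM hu mulr1 pabs_lXz.
case: n => n; first by move=> _; exists n, u; rewrite exprnP.
by rewrite NegzE opprK -exprnP leNgt exprn_egt1 // lge1.
Qed.

Lemma pabs_ltZ x y : y != 0 -> pabs x < pabs y -> x / (l%:R * y) \in Zl.
Proof.
move=> y0 xy; have [->|x0] := eqVneq x 0; first by rewrite mul0r rpred0.
have xy0 : x / y != 0 by rewrite mulf_neq0 // invr_neq0.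
have xyZ : x / y \in Zl by rewrite -pabs_le_div // ltW.
have [[|n] [u [hu e]]] := Zl_unit_decomp xy0 xyZ; last first.
  have -> : x / (l%:R * y) = l%:R ^+ n * u.
    by rewrite invfM mulrCA e exprS -mulrA mulKf ?lF_neq0.
  by rewrite rpredM ?rpredX ?l_Zl // ZlE hu.
have : pabs x / pabs y = 1 by rewrite -pabsV -pabsM e mul1r.
by move: xy; rewrite -[ltRHS]mul1r -ltr_pdivrMr ?pabs_gt0 // => + h; rewrite h ltxx.
Qed.

Lemma Zl_lt1 x : pabs x < 1 -> x / l%:R \in Zl.
Proof.
by rewrite -pabs1 => /(pabs_ltZ (oner_neq0 F)); rewrite mulr1.
Qed.

Lemma lX_neq0 n : l%:R ^+ n != 0 :> F.
Proof. by rewrite expf_neq0 // lF_neq0. Qed.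

Lemma residueX n x : x \in Zl ->
  exists2 u, (u < l ^ n)%N & (x - u%:R) / l%:R ^+ n \in Zl.
Proof.
move=> xZ.
have r0 : 0 < pabs (l%:R ^+ n : F) by rewrite pabs_gt0 lX_neq0.
have [q hq] := rat_approx x r0.
have qZ : ratr q \in Zl.
  rewrite -[ratr q](subrK x) rpredD // ZlE (le_trans (ltW hq)) //.
  by rewrite -ZlE rpredX ?l_Zl.
have co : coprime `|denq q| l.
  rewrite coprime_sym prime_coprime //; apply/negP => ld.
  have cn : coprime `|numq q| l.
    by apply: coprime_dvdr ld _; rewrite coprime_num_den.
  have pn : pabs ((numq q)%:~R : F) = 1.
    rewrite -(pabs_nat_coprime cn); case: (numq q) => // k.
    by rewrite NegzE mulrNz pabsN abszN.
  have pd : pabs ((denq q)%:~R : F) < 1.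
    rewrite -(absz_denq q) -[_%:~R]/(`|denq q|%:R).
    move: ld => /dvdnP[k ->]; rewrite natrM pabsM (le_lt_trans _ pabs_l_lt1) //.
    by rewrite ler_piMl ?pabs_ge0 // -ZlE rpred_nat.
  move: qZ; rewrite ZlE /ratr pabsM pabsV pn mul1r invf_cp1 ?leNgt ?pd //.
  rewrite pabs_gt0; apply/eqP => d0.
  have := denq_neq0 q => /pabs_int_pow[k]; rewrite d0 pabs0 => /esym/eqP.
  by rewrite pabs_eq0 (negbTE (lX_neq0 _)).
pose m := (l ^ n)%N.
have m0 : (0 < m)%N by rewrite expn_gt0 prime_gt0.
have cm : coprime `|denq q| m by rewrite coprimeXr.
have d0 : (0 < `|denq q|)%N by rewrite absz_gt0 denq_neq0.
have [b c e _] := egcdnP m d0.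
have e2 : (b%:Z * denq q - 1 = c%:Z * m%:Z)%R.
  rewrite -(absz_denq q) -!PoszM e (eqP cm); lia.
pose u := `|((numq q * b%:Z) %% m%:Z)%Z|%N.
have m0z : m%:Z != 0 by lia.
have uE : u%:Z = ((numq q * b%:Z) %% m%:Z)%Z by rewrite /u gez0_abs // modz_ge0.
exists u.
  by rewrite -ltz_nat uE ltz_pmod // ltz_nat.
have [k hk] : exists k : int, numq q * b%:Z - u%:Z = k * m%:Z.
  exists (numq q * b%:Z %/ m%:Z)%Z; rewrite uE {1}(divz_eq (numq q * b%:Z) m%:Z).
  by rewrite addrK.
have pd : pabs ((denq q)%:~R : F) = 1.
  by rewrite -(absz_denq q) -[_%:~R]/(`|denq q|%:R) pabs_nat_coprime.
have dF := pabs_unit_neq0 pd.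
have -> : x - u%:R = (x - ratr q) + (ratr q - u%:R) by rewrite subrKA.
rewrite mulrDl rpredD //.
  by rewrite -pabs_le_div ?lX_neq0 // pabs_sub ltW.
have -> : (ratr q - u%:R) / l%:R ^+ n =
    k%:~R - (numq q)%:~R * c%:~R / (denq q)%:~R :> F.
  have mF : m%:~R = l%:R ^+ n :> F by rewrite -natrX.
  have h1 : (numq q)%:~R * b%:~R - u%:R = k%:~R * l%:R ^+ n :> F.
    by have := congr1 (fun z : int => z%:~R : F) hk; rewrite intrB !intrM mF.
  have h2 : b%:~R * (denq q)%:~R - 1 = c%:~R * l%:R ^+ n :> F.
    by have := congr1 (fun z : int => z%:~R : F) e2; rewrite intrB !intrM mF.
  have lx := lX_neq0 n.
  apply: (mulIf lx); rewrite divfK // mulrBl -h1 mulrAC -[_ * c%:~R * _]mulrA -h2.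
  by rewrite /ratr; field.
rewrite rpredB ?rpred_int // -mulrA rpredM ?rpred_int // rpredM ?rpred_int //.
by case: (unitZl pd).
Qed.

Lemma residue x : x \in Zl ->
  exists2 u, (u < l)%N & (x - u%:R) / l%:R \in Zl.
Proof. by move=> /(residueX 1)[u]; rewrite expn1 expr1 => ? ?; exists u. Qed.

Lemma nat_residue_inj (n u v : nat) : (u < l ^ n)%N -> (v < l ^ n)%N ->
  (u%:R - v%:R : F) / l%:R ^+ n \in Zl -> u = v.
Proof.
wlog uv : u v / (v <= u)%N.
  move=> W hu hv h; case: (leqP v u) => [|/ltnW] uv; first exact: W.
  by apply/esym/W => //; rewrite -rpredN -mulNr opprB.
move=> hu hv; rewrite -natrB // -pabs_le_div ?lX_neq0 // => h.
apply/eqP; rewrite eqn_leq uv andbT leqNgt; apply/negP => vu.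
have d0 : (0 < u - v)%N by rewrite subn_gt0.
have [m co e] := pfactor_coprime hl d0.
move: h; rewrite e natrM natrX pabsM pabs_nat_coprime ?mul1r 1?coprime_sym //.
rewrite !pabs_lX lef_pV2 ?posrE ?exprn_gt0 ?lgt0 // ler_eXn2l ?lge1 // => nk.
have : (l ^ n <= u - v)%N.
  rewrite e (leq_trans (leq_pexp2l (prime_gt0 hl) nk)) // leq_pmull //.
  by move: d0; rewrite e muln_gt0 => /andP[].
by rewrite leqNgt (leq_ltn_trans (leq_subr _ _) hu).
Qed.

Lemma pabs_nat_unit (u : nat) : (0 < u < l)%N -> pabs (u%:R : F) = 1.
Proof.
move=> /andP[u0 ul]; apply: pabs_nat_coprime.
by rewrite coprime_sym prime_coprime // gtnNdvd.
Qed.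

End PadicField.
Arguments Zl {l R F}.

Ltac ij2 := move=> -[[|[|?]] ?] [[|[|?]] ?] //.
Ltac ij4 := move=> -[[|[|[|[|?]]]] ?] [[|[|[|[|?]]]] ?] //.

(** * Symplectic similitudes and cosets of GSp4(Z_l) *)

Section Symplectic.
Context {l : nat} {R : realType} {F : padicType l R}.
Implicit Types (g h k : 'M[F]_4) (m n : F).

Definition integral_mx (p q : nat) (g : 'M[F]_(p, q)) := forall i j, g i j \in Zl.

Lemma integral_mulmx (p q r : nat) (g : 'M[F]_(p, q)) (h : 'M[F]_(q, r)) :
  integral_mx g -> integral_mx h -> integral_mx (g *m h).
Proof. by move=> hg hh i j; rewrite mxE rpred_sum // => a _; rewrite rpredM. Qed.

Lemma Jmx_sqr : Jmx *m Jmx = -1%:M :> 'M[F]_4.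
Proof.
by apply/matrixP; ij4; rewrite ?mxE ?big_ord_recl ?big_ord0 ?mxE /= ?mxE /= -?val_eqE /=; ring.
Qed.

Lemma Jmx_integral : integral_mx (Jmx : 'M[F]_4).
Proof.
ij4; rewrite !mxE /=;
  by rewrite ?rpredN ?rpred0 ?rpred1.
Qed.

Definition sp g m := g^T *m Jmx *m g = m *: Jmx.

Lemma sp_mul g h m n : sp g m -> sp h n -> sp (g *m h) (m * n).
Proof.
rewrite /sp trmx_mul => hg hh.
have -> : h^T *m g^T *m Jmx *m (g *m h) = h^T *m (g^T *m Jmx *m g) *m h.
  by rewrite !mulmxA.
by rewrite hg -scalemxAr -scalemxAl hh scalerA.
Qed.

Lemma sp1 : sp 1%:M 1.
Proof. by rewrite /sp trmx1 mul1mx mulmx1 scale1r. Qed.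

Definition sp_inv g m : 'M[F]_4 := m^-1 *: (- Jmx *m g^T *m Jmx).

Lemma sp_invl g m : m != 0 -> sp g m -> sp_inv g m *m g = 1%:M.
Proof.
move=> m0 hg; rewrite /sp_inv -scalemxAl -!mulmxA.
have -> : g^T *m (Jmx *m g) = m *: Jmx by rewrite mulmxA hg.
by rewrite mulNmx -scalemxAr Jmx_sqr -scalerN opprK scalerA mulVf // scale1r.
Qed.

Lemma sp_invr g m : m != 0 -> sp g m -> g *m sp_inv g m = 1%:M.
Proof. by move=> m0 hg; apply: mulmx1C; apply: sp_invl. Qed.

Lemma sp_sim g m : sp g m -> sim g = m.
Proof. by rewrite /sp /sim => ->; rewrite !mxE /= mulr1. Qed.

Lemma GSp4P g : reflect (exists2 m, m != 0 & sp g m) (GSp4 g).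
Proof.
apply: (iffP idP) => [/and3P[_ h0 /eqP h]|[m m0 hg]]; first by exists (sim g).
have [gu _] := mulmx1_unit (sp_invr m0 hg).
by rewrite /GSp4 (sp_sim hg) m0 gu; apply/eqP; rewrite hg.
Qed.

Lemma sp_invP g m : m != 0 -> sp g m -> sp (sp_inv g m) m^-1.
Proof.
move=> m0 hg.
have e : sp_inv g m = invmx g.
  have [gu _] := mulmx1_unit (sp_invr m0 hg).
  by rewrite -[LHS]mulmx1 -(mulmxV gu) mulmxA sp_invl // mul1mx.
have [gu _] := mulmx1_unit (sp_invr m0 hg).
rewrite /sp e.
have ginv : (invmx g)^T *m g^T = 1%:M by rewrite -trmx_mul mulmxV // trmx1.
have e2 : (invmx g)^T *m (g^T *m Jmx *m g) *m invmx g = Jmx.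
  by rewrite !mulmxA ginv mul1mx -mulmxA mulmxV // mulmx1.
rewrite hg -scalemxAr -scalemxAl in e2.
by rewrite -[in RHS]e2 scalerA mulVf // scale1r.
Qed.

Definition Kg k := integral_mx k /\ exists2 m, pabs m = 1 & sp k m.

Lemma KgZ k : Kg k -> GSp4Z k.
Proof.
move=> [ki [m hm hk]]; have m0 := pabs_unit_neq0 hm.
apply/and4P; split.
- by apply/GSp4P; exists m.
- by apply/forallP => i; apply/forallP => j; apply: ki.
- have := congr1 determinant hk; rewrite !det_mulmx det_tr detZ.
  have J0 : \det (Jmx : 'M[F]_4) != 0.
    apply/negP => /eqP h; have := congr1 determinant Jmx_sqr.
    rewrite det_mulmx h mul0r -scaleN1r detZ det1 mulr1 => /esym/eqP.
    by rewrite expf_eq0 oppr_eq0 oner_eq0.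
  move=> /(congr1 (fun x => pabs x)) /=; rewrite !pabsM !hm !mul1r => h.
  rewrite -(@eqrXn2 _ 2) ?pabs_ge0 ?ler01 // expr1n expr2.
  have J1 : pabs (\det (Jmx : 'M[F]_4)) != 0 by rewrite pabs_eq0.
  by apply/eqP; apply: (mulfI J1); rewrite mulr1 -{2}h; ring.
- by rewrite (sp_sim hk) hm.
Qed.

Lemma Kg1 : Kg 1%:M.
Proof.
split; last by exists 1; [exact: pabs1|exact: sp1].
by move=> i j; rewrite mxE rpred_nat.
Qed.

Lemma KgM g h : Kg g -> Kg h -> Kg (g *m h).
Proof.
move=> [gi [m hm hg]] [hi [n hn hh]]; split; first exact: integral_mulmx.
by exists (m * n); [rewrite pabsM hm hn mulr1|exact: sp_mul].
Qed.

Lemma KgV k : Kg k -> exists2 k', Kg k' & k *m k' = 1%:M /\ k' *m k = 1%:M.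
Proof.
move=> [ki [m hm hk]]; have m0 := pabs_unit_neq0 hm.
exists (sp_inv k m); last by split; [exact: sp_invr|exact: sp_invl].
split; last by exists m^-1; [rewrite pabsV hm invr1|exact: sp_invP].
move=> i j; rewrite mxE rpredM //; first by case: (unitZl hm).
apply: integral_mulmx; last exact: Jmx_integral.
apply: integral_mulmx; last by move=> a b; rewrite mxE; apply: ki.
by move=> a b; rewrite mxE rpredN; apply: Jmx_integral.
Qed.

Definition pr g h (i j : 'I_4) :=
  g 0 i * h 3 j + g 1 i * h 2 j - g 2 i * h 1 j - g 3 i * h 0 j.

Lemma prE g h i j : (g^T *m Jmx *m h) i j = pr g h i j.
Proof.
rewrite /pr !mxE !big_ord_recl big_ord0 !mxE !big_ord_recl !big_ord0 !mxE /=.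
rewrite !mulr0 !addr0 !add0r !mulr1 !mulrN1.
have -> : lift ord0 ord0 = 1 :> 'I_4 by apply: val_inj.
have -> : lift ord0 (lift ord0 ord0) = 2 :> 'I_4 by apply: val_inj.
have -> : lift ord0 (lift ord0 (lift ord0 ord0)) = 3 :> 'I_4 by apply: val_inj.
by ring.
Qed.

Lemma sp_pr g m i j : sp g m -> pr g g i j = m * Jmx i j.
Proof. by rewrite -prE => ->; rewrite mxE. Qed.

Lemma spP g m : (forall i j, pr g g i j = m * Jmx i j) -> sp g m.
Proof. by move=> h; apply/matrixP => i j; rewrite prE h [RHS]mxE. Qed.

Lemma det2 (A : 'M[F]_2) : \det A = A 0 0 * A 1 1 - A 0 1 * A 1 0.
Proof.
rewrite (expand_det_row _ ord0) !big_ord_recl big_ord0 /cofactor !det_mx11 !mxE.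
have -> : lift ord0 ord0 = 1 :> 'I_2 by apply: val_inj.
have -> : lift 1 0 = 0 :> 'I_2 by apply: val_inj.
by rewrite /=; ring.
Qed.

Lemma iota_sp (h : 'M[F]_2 * 'M[F]_2) m :
  \det h.1 = m -> \det h.2 = m -> sp (iota_H h) m.
Proof.
rewrite !det2 => h1 h2; apply: spP.
ij4; rewrite /pr !mxE /=;
  first [ring | rewrite -h1; ring | rewrite -h2; ring].
Qed.

End Symplectic.

Section Iwasawa.
Context {l : nat} {R : realType} {F : padicType l R}.
Implicit Types (g h k : 'M[F]_4) (m n x y : F).

Lemma mulmx4E p q (g : 'M[F]_(p, 4)) (h : 'M[F]_(4, q)) i j :
  (g *m h) i j = g i 0 * h 0 j + g i 1 * h 1 j + g i 2 * h 2 j + g i 3 * h 3 j.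
Proof.
rewrite mxE !big_ord_recl big_ord0 addr0 !addrA.
have -> : lift ord0 ord0 = 1 :> 'I_4 by apply: val_inj.
have -> : lift ord0 (lift ord0 ord0) = 2 :> 'I_4 by apply: val_inj.
by have -> : lift ord0 (lift ord0 (lift ord0 ord0)) = 3 :> 'I_4 by apply: val_inj.
Qed.

Lemma mx4_eta g : g = mx_of 4
  [:: [:: g 0 0; g 0 1; g 0 2; g 0 3]; [:: g 1 0; g 1 1; g 1 2; g 1 3];
      [:: g 2 0; g 2 1; g 2 2; g 2 3]; [:: g 3 0; g 3 1; g 3 2; g 3 3]].
Proof.
apply/matrixP; ij4; rewrite mxE /=;
  by congr (g _ _); apply: val_inj.
Qed.

Lemma row_reduction x y : exists a b c d,
  [/\ [/\ a \in Zl, b \in Zl, c \in Zl & d \in Zl], a * d - b * c = 1 & x * a + y * c = 0].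
Proof.
case: (ltP (pabs y) (pabs x)) => xy.
  have x0 : x != 0 by rewrite -pabs_gt0 (le_lt_trans (pabs_ge0 _) xy).
  exists (- y / x), (-1), 1, 0; split; [|by ring|by field].
  by rewrite mulNr !rpredN -pabs_le_div ?rpred1 ?rpred0 ?ltW.
have [y0|y0] := eqVneq y 0.
  exists 1, 0, 0, 1; split; [|by ring|].
    by rewrite ?rpred0 ?rpred1.
  move: xy; rewrite y0 pabs0 mul0r addr0 mulr1 => h; apply/eqP.
  by rewrite -pabs_eq0 eq_le h pabs_ge0.
exists 1, 0, (- x / y), 1; split; [|by ring|by field].
by rewrite mulNr rpredN -pabs_le_div ?rpred1 ?rpred0.
Qed.

Definition outer_mx (a b c d : F) : 'M[F]_4 := mx_of 4
  [:: [:: a; 0; 0; b]; [:: 0; 1; 0; 0]; [:: 0; 0; 1; 0]; [:: c; 0; 0; d]].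

Definition inner_mx (a b c d : F) : 'M[F]_4 := mx_of 4
  [:: [:: 1; 0; 0; 0]; [:: 0; a; b; 0]; [:: 0; c; d; 0]; [:: 0; 0; 0; 1]].

Definition levi_mx (a b c d : F) : 'M[F]_4 := mx_of 4
  [:: [:: a; - b; 0; 0]; [:: - c; d; 0; 0]; [:: 0; 0; a; b]; [:: 0; 0; c; d]].

Definition diag4 (a b c d : F) : 'M[F]_4 := mx_of 4
  [:: [:: a; 0; 0; 0]; [:: 0; b; 0; 0]; [:: 0; 0; c; 0]; [:: 0; 0; 0; d]].

Lemma outer_Kg a b c d : a \in Zl -> b \in Zl -> c \in Zl -> d \in Zl ->
  a * d - b * c = 1 -> Kg (outer_mx a b c d).
Proof.
move=> ha hb hc hd e; split.
  ij4; rewrite mxE /= ?rpred0 ?rpred1 //.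
exists 1; [exact: pabs1|apply: spP].
ij4; rewrite /pr !mxE /= ?mul1r;
  first [ring | rewrite -e; ring].
Qed.

Lemma inner_Kg a b c d : a \in Zl -> b \in Zl -> c \in Zl -> d \in Zl ->
  a * d - b * c = 1 -> Kg (inner_mx a b c d).
Proof.
move=> ha hb hc hd e; split.
  ij4; rewrite mxE /= ?rpred0 ?rpred1 //.
exists 1; [exact: pabs1|apply: spP].
ij4; rewrite /pr !mxE /= ?mul1r;
  first [ring | rewrite -e; ring].
Qed.

Lemma levi_Kg a b c d : a \in Zl -> b \in Zl -> c \in Zl -> d \in Zl ->
  a * d - b * c = 1 -> Kg (levi_mx a b c d).
Proof.
move=> ha hb hc hd e; split.
  by ij4; rewrite mxE /= ?rpredN ?rpred0.
exists 1; [exact: pabs1|apply: spP].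
ij4; rewrite /pr !mxE /= ?mul1r;
  first [ring | rewrite -e; ring].
Qed.

Lemma diag4_Kg a b c d m : a * d = m -> b * c = m ->
  pabs a = 1 -> pabs b = 1 -> pabs c = 1 -> pabs d = 1 -> Kg (diag4 a b c d).
Proof.
move=> e1 e2 ha hb hc hd; split.
  ij4; rewrite mxE /= ?rpred0 //;
  by rewrite ZlE ?ha ?hb ?hc ?hd.
exists m; [by rewrite -e1 pabsM ha hd mulr1|apply: spP].
ij4; rewrite /pr !mxE /=;
  first [ring | rewrite -e1; ring | rewrite -e2; ring].
Qed.

Definition upper g := forall i j : 'I_4, (j < i)%N -> g i j = 0.

Lemma iwasawa g m : m != 0 -> sp g m -> exists2 k, Kg k & upper (g *m k).
Proof.
pose Q g := exists2 k, Kg k & upper (g *m k).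
have QK h k : Kg k -> Q (h *m k) -> Q h.
  by move=> hk [k' hk' u]; exists (k *m k'); [exact: KgM|rewrite mulmxA].
move=> m0 hg; rewrite -/(Q g).
have {m m0 hg} : exists2 m, m != 0 & sp g m by exists m.
have spK h k : (exists2 m, m != 0 & sp h m) -> Kg k -> exists2 n, n != 0 & sp (h *m k) n.
  move=> [m m0 hh] [_ [n hn hk]]; exists (m * n); last exact: sp_mul.
  by rewrite mulf_neq0 // pabs_unit_neq0.
have [a [b [c [d [[ha hb hc hd] e r]]]]] := row_reduction (g 3 0) (g 3 3).
have hk := outer_Kg ha hb hc hd e.
move=> /spK/(_ hk); move: (QK g _ hk).
have : (g *m outer_mx a b c d) 3 0 = 0.
  by rewrite mulmx4E !mxE /= -[RHS]r; ring.
move: (g *m _) => {r hk a b c d ha hb hc hd e} g1 z0 G.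
have [a [b [c [d [[ha hb hc hd] e r]]]]] := row_reduction (g1 3 1) (g1 3 2).
have hk := inner_Kg ha hb hc hd e.
move=> /spK/(_ hk) h; apply: G; move: h; move: (QK g1 _ hk).
have : (g1 *m inner_mx a b c d) 3 0 = 0.
  by rewrite mulmx4E !mxE /= z0; ring.
have : (g1 *m inner_mx a b c d) 3 1 = 0.
  by rewrite mulmx4E !mxE /= -[RHS]r; ring.
move: (g1 *m _) => {z0 r hk a b c d ha hb hc hd e} g2 z1 z0 G1.
have [a [b [c [d [[ha hb hc hd] e r]]]]] := row_reduction (g2 3 2) (g2 3 3).
have hk := levi_Kg ha hb hc hd e.
move=> /spK/(_ hk) h; apply: G1; move: h; move: (QK g2 _ hk).
have : (g2 *m levi_mx a b c d) 3 0 = 0.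
  by rewrite mulmx4E !mxE /= z0 z1; ring.
have : (g2 *m levi_mx a b c d) 3 1 = 0.
  by rewrite mulmx4E !mxE /= z0 z1; ring.
have : (g2 *m levi_mx a b c d) 3 2 = 0.
  by rewrite mulmx4E !mxE /= z0 z1 -[RHS]r; ring.
move: (g2 *m _) => {z0 z1 r hk a b c d ha hb hc hd e} g3 z2 z1 z0 G2.
have [a [b [c [d [[ha hb hc hd] e r]]]]] := row_reduction (g3 2 1) (g3 2 2).
have hk := inner_Kg ha hb hc hd e.
move=> [m m0 hg]; apply: G2; apply: (QK _ _ hk); exists 1%:M; first exact: Kg1.
have p01 : g3 1 0 * g3 2 1 = g3 2 0 * g3 1 1.
  have := sp_pr 0 1 hg; rewrite /pr !mxE /= z0 z1 => h.
  by apply/eqP; rewrite -subr_eq0; apply/eqP; rewrite -[RHS](mulr0 m) -h; ring.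
have p02 : g3 1 0 * g3 2 2 = g3 2 0 * g3 1 2.
  have := sp_pr 0 2 hg; rewrite /pr !mxE /= z0 z2 => h.
  by apply/eqP; rewrite -subr_eq0; apply/eqP; rewrite -[RHS](mulr0 m) -h; ring.
have p12 : g3 1 1 * g3 2 2 - g3 2 1 * g3 1 2 = m.
  have := sp_pr 1 2 hg; rewrite /pr !mxE /= z1 z2 => h.
  by rewrite -[RHS]mulr1 -h; ring.
have g10 : g3 1 0 = 0.
  apply: (mulIf m0); rewrite mul0r -p12 mulrBr.
  rewrite (_ : g3 1 0 * (g3 1 1 * g3 2 2) = g3 1 1 * (g3 1 0 * g3 2 2)); last by ring.
  rewrite (_ : g3 1 0 * (g3 2 1 * g3 1 2) = g3 1 2 * (g3 1 0 * g3 2 1)); last by ring.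
  by rewrite p01 p02; ring.
have g20 : g3 2 0 = 0.
  apply: (mulIf m0); rewrite mul0r -p12 mulrBr.
  rewrite (_ : g3 2 0 * (g3 1 1 * g3 2 2) = g3 2 2 * (g3 2 0 * g3 1 1)); last by ring.
  rewrite (_ : g3 2 0 * (g3 2 1 * g3 1 2) = g3 2 1 * (g3 2 0 * g3 1 2)); last by ring.
  by rewrite -p01 -p02 g10; ring.
rewrite mulmx1 [g3]mx4_eta.
move=> -[[|[|[|[|?]]]] ?] [[|[|[|[|?]]]] ?] // _; rewrite mulmx4E !mxE /= ?z0 ?z1 ?z2 ?g10 ?g20;
  first [ring | rewrite -[RHS]r; ring].
Qed.

Hypothesis hl : prime l.

Definition borel_mx (a b c : nat) (p r s w t o : F) : 'M[F]_4 := mx_of 4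
  [:: [:: l%:R ^+ a; p; r; s]; [:: 0; l%:R ^+ b; w; t];
      [:: 0; 0; l%:R ^+ (c - b); o]; [:: 0; 0; 0; l%:R ^+ (c - a)]].

Lemma hermite_form g m c : integral_mx g -> sp g m ->
  pabs m = pabs (l%:R ^+ c : F) ->
  exists2 k, Kg k & exists a b p r s w t o,
  [/\ (a <= c)%N, (b <= c)%N, g *m k = borel_mx a b c p r s w t o,
      p * l%:R ^+ (c - a) + l%:R ^+ b * o = 0
    & r * l%:R ^+ (c - a) + w * o - l%:R ^+ (c - b) * t = 0].
Proof.
move=> gi hg hm.
have m0 : m != 0 by rewrite -pabs_eq0 hm pabs_eq0 lX_neq0.
have [k0 hk0 u] := iwasawa m0 hg.
have [k0i [n0 hn0 sk0]] := hk0.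
have := sp_mul hg sk0; have := integral_mulmx gi k0i; move: u.
have : pabs (m * n0) = pabs (l%:R ^+ c : F) by rewrite pabsM hn0 mulr1.
have : m * n0 != 0 by rewrite mulf_neq0 // pabs_unit_neq0.
move E : (g *m k0) => h; move: (m * n0) => n n1 hn u hi hh.
have d03 : h 0 0 * h 3 3 = n.
  have := sp_pr 0 3 hh; rewrite /pr !mxE /= mulr1 => <-.
  by rewrite (u 1 0) // (u 2 0) // (u 3 0) //; ring.
have d12 : h 1 1 * h 2 2 = n.
  have := sp_pr 1 2 hh; rewrite /pr !mxE /= mulr1 => <-.
  by rewrite (u 3 1) // (u 2 1) // (u 3 2) //; ring.
have nz0 : h 0 0 != 0 by apply: contraNneq n1 => e; rewrite -d03 e mul0r.
have nz3 : h 3 3 != 0 by apply: contraNneq n1 => e; rewrite -d03 e mulr0.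
have nz1 : h 1 1 != 0 by apply: contraNneq n1 => e; rewrite -d12 e mul0r.
have nz2 : h 2 2 != 0 by apply: contraNneq n1 => e; rewrite -d12 e mulr0.
have [a [ua [hua ea]]] := Zl_unit_decomp hl nz0 (hi _ _).
have [b [ub [hub eb]]] := Zl_unit_decomp hl nz1 (hi _ _).
have [a' [ua' [hua' ea']]] := Zl_unit_decomp hl nz3 (hi _ _).
have [b' [ub' [hub' eb']]] := Zl_unit_decomp hl nz2 (hi _ _).
have inj (e f : nat) : pabs (l%:R ^+ e : F) = pabs (l%:R ^+ f : F) -> e = f.
  by rewrite !pabs_lX // => /invr_inj; apply: (@ieexprIn R l%:R);
    rewrite ?lgt0 // gt_eqF // lge1.
have ca : (a + a')%N = c.
  by apply: inj; rewrite -hn -d03 ea ea' exprD !pabsM hua hua' !mulr1.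
have cb : (b + b')%N = c.
  by apply: inj; rewrite -hn -d12 eb eb' exprD !pabsM hub hub' !mulr1.
pose v := ua * ua'.
have vE : v = ub * ub'.
  have : l%:R ^+ c * v = l%:R ^+ c * (ub * ub').
    rewrite -{2}cb -ca /v !exprD.
    by move: d03 d12; rewrite ea ea' eb eb' => <- d; rewrite -[LHS]mulrACA -[RHS]mulrACA d.
  by move/(mulfI (lX_neq0 hl c)).
have hv : pabs v = 1 by rewrite pabsM hua hua' mulr1.
have [nua nub nua' nub'] : [/\ ua != 0, ub != 0, ua' != 0 & ub' != 0].
  by split; apply: pabs_unit_neq0.
pose k1 := diag4 ua^-1 ub^-1 ub'^-1 ua'^-1.
have hk1 : Kg k1.
  apply: (@diag4_Kg _ _ _ _ v^-1); rewrite ?pabsV ?hua ?hub ?hua' ?hub' ?invr1 //.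
    by rewrite -invfM.
  by rewrite vE -invfM.
exists (k0 *m k1); first exact: KgM.
exists a, b, (h 0 1 / ub), (h 0 2 / ub'), (h 0 3 / ua'), (h 1 2 / ub'),
  (h 1 3 / ua'), (h 2 3 / ua').
have ca' : (c - a)%N = a' by rewrite -ca addKn.
have cb' : (c - b)%N = b' by rewrite -cb addKn.
split.
- by rewrite -ca leq_addr.
- by rewrite -cb leq_addr.
- rewrite mulmxA E [h]mx4_eta /borel_mx ca' cb'.
  rewrite ea eb ea' eb'; move: (l%:R ^+ a) (l%:R ^+ b) (l%:R ^+ a') (l%:R ^+ b') => A B A' B'.
  rewrite (u 1 0) // (u 2 0) // (u 3 0) // (u 2 1) // (u 3 1) // (u 3 2) //.
  apply/matrixP; ij4; rewrite mulmx4E !mxE /=;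
    by field.
- have := sp_pr 1 3 hh; rewrite /pr !mxE /= mulr0 ca'.
  rewrite (u 2 1) // (u 3 1) // ea' eb => e.
  apply: (mulIf nub); apply: (mulIf nua'); rewrite mul0r mul0r -[RHS]e.
  move: (l%:R ^+ b) (l%:R ^+ a') => B A'.
  by field; rewrite nua' nub.
- have := sp_pr 2 3 hh; rewrite /pr !mxE /= mulr0 ca' cb'.
  rewrite (u 3 2) // ea' eb' => e.
  apply: (mulIf nub'); apply: (mulIf nua'); rewrite mul0r mul0r -[RHS]e.
  move: (l%:R ^+ b') (l%:R ^+ a') => B A'.
  by field; rewrite nua' nub'.
Qed.

End Iwasawa.

Ltac zl := repeat first
  [ assumption | exact: rpred1 | exact: rpred0 | exact: rpred_nat | apply: rpredB
  | apply: rpredD | rewrite rpredN | apply: rpredM | apply: rpredX ].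

Section Cosets.
Context {l : nat} {R : realType} {F : padicType l R}.
Hypothesis hl : prime l.
Implicit Types (g h k : 'M[F]_4) (m n x y p r s w t o : F).
Notation borel_mx := (@borel_mx l R F).

Definition unip p r s w t o : 'M[F]_4 := mx_of 4
  [:: [:: 1; p; r; s]; [:: 0; 1; w; t]; [:: 0; 0; 1; o]; [:: 0; 0; 0; 1]].

Lemma unip_integral p r s w t o :
  [/\ p \in Zl, r \in Zl & s \in Zl] -> [/\ w \in Zl, t \in Zl & o \in Zl] ->
  integral_mx (unip p r s w t o).
Proof.
move=> [? ? ?] [? ? ?].
by ij4; rewrite mxE /= ?rpred0 ?rpred1.
Qed.

Lemma borel_mul_unip a b c p r s w t o p1 r1 s1 w1 t1 o1 :
  borel_mx a b c p r s w t o *m unip p1 r1 s1 w1 t1 o1 =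
  borel_mx a b c (l%:R ^+ a * p1 + p) (l%:R ^+ a * r1 + p * w1 + r)
    (l%:R ^+ a * s1 + p * t1 + r * o1 + s) (l%:R ^+ b * w1 + w)
    (l%:R ^+ b * t1 + w * o1 + t) (l%:R ^+ (c - b) * o1 + o).
Proof.
rewrite /borel_mx; move: (l%:R ^+ a) (l%:R ^+ b) (l%:R ^+ (c - a)) (l%:R ^+ (c - b)) => A B A' B'.
by apply/matrixP; ij4; rewrite mulmx4E !mxE /=; ring.
Qed.

Lemma borel_sp a b c p r s w t o : (a <= c)%N -> (b <= c)%N ->
  p * l%:R ^+ (c - a) + l%:R ^+ b * o = 0 ->
  r * l%:R ^+ (c - a) + w * o - l%:R ^+ (c - b) * t = 0 ->
  sp (borel_mx a b c p r s w t o) (l%:R ^+ c).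
Proof.
move=> ac bc e1 e2; have ea : l%:R ^+ a * l%:R ^+ (c - a) = l%:R ^+ c :> F by rewrite -exprD subnKC.
have eb : l%:R ^+ b * l%:R ^+ (c - b) = l%:R ^+ c :> F by rewrite -exprD subnKC.
move: e1 e2 ea eb; rewrite /borel_mx.
move: (l%:R ^+ a) (l%:R ^+ b) (l%:R ^+ (c - a)) (l%:R ^+ (c - b)) (l%:R ^+ c).
move=> A B A' B' C e1 e2 ea eb; apply: spP.
ij4; rewrite /pr !mxE /= ?mulr0;
  first [ring | rewrite -ea; ring | rewrite -eb; ring | rewrite -[RHS]e1; ring
        | rewrite -[RHS]e2; ring | rewrite -[RHS]oppr0 -[in RHS]e1; ring
        | rewrite -[RHS]oppr0 -[in RHS]e2; ring].
Qed.

Lemma borel_coset a b c p r s w t o p' r' s' w' t' o' p1 r1 s1 w1 t1 o1 :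
  sp (borel_mx a b c p r s w t o) (l%:R ^+ c) ->
  sp (borel_mx a b c p' r' s' w' t' o') (l%:R ^+ c) ->
  [/\ p1 \in Zl, r1 \in Zl & s1 \in Zl] -> [/\ w1 \in Zl, t1 \in Zl & o1 \in Zl] ->
  [/\ p' = l%:R ^+ a * p1 + p, r' = l%:R ^+ a * r1 + p * w1 + r
    & s' = l%:R ^+ a * s1 + p * t1 + r * o1 + s] ->
  [/\ w' = l%:R ^+ b * w1 + w, t' = l%:R ^+ b * t1 + w * o1 + t
    & o' = l%:R ^+ (c - b) * o1 + o] ->
  exists2 k, Kg k & borel_mx a b c p' r' s' w' t' o' = borel_mx a b c p r s w t o *m k.
Proof.
move=> sp1 sp2 i1 i2 [e1 e2 e3] [e4 e5 e6].
pose k := unip p1 r1 s1 w1 t1 o1.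
have ek : borel_mx a b c p' r' s' w' t' o' = borel_mx a b c p r s w t o *m k.
  by rewrite borel_mul_unip -e1 -e2 -e3 -e4 -e5 -e6.
exists k => //; split; first exact: unip_integral.
have lc : l%:R ^+ c != 0 :> F by exact: lX_neq0.
exists ((l%:R ^+ c)^-1 * l%:R ^+ c); first by rewrite mulVf ?pabs1.
have -> : k = sp_inv (borel_mx a b c p r s w t o) (l%:R ^+ c) *m borel_mx a b c p' r' s' w' t' o'.
  by rewrite ek mulmxA sp_invl // mul1mx.
by apply: sp_mul => //; apply: sp_invP.
Qed.

Lemma lXn_ratio_le (a b : nat) x : x \in Zl -> l%:R ^+ a = l%:R ^+ b * x :> F -> (b <= a)%N.
Proof.
move=> xZ e; have := congr1 (fun y : F => pabs y) e; rewrite /= pabsM !pabs_lX // => e2.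
have : l%:R ^- a <= l%:R ^- b :> R.
  by rewrite e2; apply: ler_piMr; [rewrite invr_ge0 exprn_ge0 // ltW // lgt0|exact: xZ].
by rewrite lef_pV2 ?posrE ?exprn_gt0 ?lgt0 // ler_eXn2l ?lge1.
Qed.

Lemma borel_coset_inv a b a' b' c p r s w t o p' r' s' w' t' o' k :
  integral_mx k ->
  borel_mx a' b' c p' r' s' w' t' o' = borel_mx a b c p r s w t o *m k ->
  (a <= c)%N -> (b <= c)%N -> (a' <= c)%N -> (b' <= c)%N ->
  [/\ a' = a, b' = b & exists p1 r1 s1 w1 t1 o1,
  [/\ [/\ p1 \in Zl, r1 \in Zl & s1 \in Zl], [/\ w1 \in Zl, t1 \in Zl & o1 \in Zl],
  [/\ p' = l%:R ^+ a * p1 + p, r' = l%:R ^+ a * r1 + p * w1 + r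
    & s' = l%:R ^+ a * s1 + p * t1 + r * o1 + s] &
  [/\ w' = l%:R ^+ b * w1 + w, t' = l%:R ^+ b * t1 + w * o1 + t
    & o' = l%:R ^+ (c - b) * o1 + o]]].
Proof.
move=> ki e ac bc ac' bc'.
have E i j := congr1 (fun X : 'M[F]_4 => X i j) e.
have := E 3 0; have := E 3 1; have := E 3 2; have := E 3 3.
have := E 2 0; have := E 2 1; have := E 2 2; have := E 2 3.
have := E 1 0; have := E 1 1; have := E 1 2; have := E 1 3.
have := E 0 0; have := E 0 1; have := E 0 2; have := E 0 3.
rewrite /= !mulmx4E !mxE /= !mul0r !add0r.
move=> e03 e02 e01 e00 e13 e12 e11 e10 e23 e22 e21 e20 e33 e32 e31 e30.
have van (n : nat) x : 0 = l%:R ^+ n * x -> x = 0.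
  by move=> /esym/eqP; rewrite mulf_eq0 (negbTE (lX_neq0 hl n)) => /eqP.
have k30 := van _ _ e30; have k31 := van _ _ e31; have k32 := van _ _ e32.
move: e20 e21 e22; rewrite k30 k31 k32 !mulr0 !addr0 => /van k20 /van k21 e22.
move: e10 e11; rewrite k30 k31 k20 k21 !mulr0 !addr0 => /van k10 e11.
move: e00; rewrite k10 k20 k30 !mulr0 !addr0 => e00.
have ha : a' = a.
  have h1 := lXn_ratio_le (ki _ _) e00; have h2 := lXn_ratio_le (ki _ _) e33.
  by lia.
have hb : b' = b.
  have h1 := lXn_ratio_le (ki _ _) e11; have h2 := lXn_ratio_le (ki _ _) e22.
  by lia.
split=> //; subst a' b'.
have one (n : nat) x : l%:R ^+ n = l%:R ^+ n * x -> x = 1.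
  by move=> h; apply: (mulfI (lX_neq0 hl n)); rewrite -h mulr1.
have k00 := one _ _ e00; have k11 := one _ _ e11; have k22 := one _ _ e22; have k33 := one _ _ e33.
exists (k 0 1), (k 0 2), (k 0 3), (k 1 2), (k 1 3), (k 2 3).
split; [by split; apply: ki|by split; apply: ki| |].
  split.
  - by rewrite e01 k11 k21 k31; ring.
  - by rewrite e02 k22 k32; ring.
  - by rewrite e03 k33; ring.
split.
- by rewrite e12 k22 k32; ring.
- by rewrite e13 k33; ring.
- by rewrite e23 k33; ring.
Qed.

(* Left multiplication by an element of [K] permutes the cosets [rep i K]. *)
Lemma coset_sum_invariant (I : finType) (rep : I -> 'M[F]_4) (S : 'M[F]_4 -> Prop)
    (V : zmodType) (v : 'M[F]_4 -> V) k :
  (forall i, S (rep i)) -> (forall k g, Kg k -> S g -> S (k *m g)) ->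
  (forall g, S g -> exists i, exists2 k, Kg k & g = rep i *m k) ->
  (forall i j k, Kg k -> rep i = rep j *m k -> i = j) ->
  (forall g k, Kg k -> v (g *m k) = v g) -> Kg k ->
  \sum_i v (k *m rep i) = \sum_i v (rep i).
Proof.
move=> Srep KS cover inj vK hk.
have ex i : exists j, exists2 k', Kg k' & k *m rep i = rep j *m k' by apply: cover; apply: KS.
pose pi i := sval (cid (ex i)).
have piP i : exists2 k', Kg k' & k *m rep i = rep (pi i) *m k' by rewrite /pi; case: cid.
have pi_inj : injective pi.
  move=> i j e; have [k1 hk1 e1] := piP i; have [k2 hk2 e2] := piP j.
  have [k' hk' [kk' k'k]] := KgV hk; have [k3 hk3 [k23 k32]] := KgV hk2.
  apply: (inj _ _ (k3 *m k1)); first exact: KgM.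
  have r1 : rep i = k' *m (rep (pi i) *m k1) by rewrite -e1 mulmxA k'k mul1mx.
  have r2 : rep (pi i) = k *m rep j *m k3 by rewrite e2 e -mulmxA k23 mulmx1.
  by rewrite r1 r2 !mulmxA k'k mul1mx.
rewrite [RHS](reindex_inj pi_inj) /=; apply: eq_bigr => i _.
by have [k' hk' ->] := piP i; rewrite vK.
Qed.

End Cosets.

Section HeckeCosets.
Context {l : nat} {R : realType} {F : padicType l R}.
Hypothesis hl : prime l.
Implicit Types (g h k : 'M[F]_4) (m n x y p r s w t o : F).
Notation borel_mx := (@borel_mx l R F).

Lemma residueE x : x \in Zl -> exists (u : 'I_l) x', x' \in Zl /\ x = u%:R + l%:R * x'.
Proof.
move=> /(residue hl)[u ul h]; exists (Ordinal ul), ((x - u%:R) / l%:R); split=> //=.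
by rewrite mulrC divfK ?lF_neq0 // addrC subrK.
Qed.

Lemma residue2E x : x \in Zl ->
  exists (u : 'I_(l ^ 2)) x', x' \in Zl /\ x = u%:R + l%:R ^+ 2 * x'.
Proof.
move=> /(residueX hl 2)[u ul h]; exists (Ordinal ul), ((x - u%:R) / l%:R ^+ 2); split=> //=.
by rewrite mulrC divfK ?lX_neq0 // addrC subrK.
Qed.

Lemma nat_cong_inj (n u v : nat) x : (u < l ^ n)%N -> (v < l ^ n)%N -> x \in Zl ->
  u%:R = l%:R ^+ n * x + v%:R -> u = v.
Proof.
move=> hu hv hx e; apply: (nat_residue_inj (F := F) hl hu hv).
by rewrite e addrK mulrC mulKf // lX_neq0.
Qed.

Lemma ord_cong_inj (u v : 'I_l) x : x \in Zl -> u%:R = l%:R * x + v%:R -> u = v.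
Proof.
by move=> hx e; apply/ord_inj/(@nat_cong_inj 1 _ _ x); rewrite ?expn1 ?expr1 ?ltn_ord.
Qed.

Lemma ordS_cong_inj (u v : 'I_l.-1) x : x \in Zl -> u.+1%:R = l%:R * x + v.+1%:R -> u = v.
Proof.
move=> hx e; apply/ord_inj/succn_inj/(@nat_cong_inj 1 _ _ x); rewrite ?expr1 //.
  by have := ltn_ord u; have := prime_gt0 hl; rewrite expn1; lia.
by have := ltn_ord v; have := prime_gt0 hl; rewrite expn1; lia.
Qed.

Lemma unit_ordS (u : 'I_l.-1) : pabs (u.+1%:R : F) = 1.
Proof.
by apply: pabs_nat_unit => //; have := ltn_ord u; have := prime_gt0 hl; lia.
Qed.

Lemma ordS_not_l (u : 'I_l.-1) x : x \in Zl -> u.+1%:R <> l%:R * x :> F.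
Proof.
move=> hx e; have := unit_ordS u; rewrite e pabsM => h.
have := @pabs_l_lt1 l R F hl; by rewrite ltNge -h (ler_piMr (pabs_ge0 _) hx).
Qed.

Lemma residue_ordS x : pabs x = 1 ->
  exists (u : 'I_l.-1) x', x' \in Zl /\ x = u.+1%:R + l%:R * x'.
Proof.
move=> hx; have [|u [x' [hx' e]]] := @residueE x; first by rewrite ZlE hx.
case: u e => -[|u] hu e.
  have := @pabs_l_lt1 l R F hl; by rewrite ltNge -hx e add0r pabsM (ler_piMr (pabs_ge0 _) hx').
have hu' : (u < l.-1)%N by rewrite -ltnS (prednK (prime_gt0 hl)).
by exists (Ordinal hu'), x'.
Qed.

Lemma Zl_sqr_div x : x \in Zl -> x ^+ 2 / l%:R \in Zl -> x / l%:R \in Zl.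
Proof.
move=> hx h; apply: (Zl_lt1 hl); rewrite lt_neqAle -ZlE hx andbT.
apply/eqP => hx1; move: h; rewrite -pabs_le_div ?lF_neq0 // pabsX hx1 expr1n.
by rewrite leNgt pabs_l_lt1.
Qed.

Lemma coset_trans g h k : Kg k -> (exists2 k', Kg k' & g *m k = h *m k') ->
  exists2 k', Kg k' & g = h *m k'.
Proof.
move=> hk [k' hk' e]; have [k1 hk1 [kk1 _]] := KgV hk.
exists (k' *m k1); first exact: KgM.
by rewrite mulmxA -e -mulmxA kk1 mulmx1.
Qed.

(* the double coset of diag (l, l, 1, 1) under GSp4(Z_l) *)
Definition S1 g := integral_mx g /\ exists2 m, pabs m = pabs (l%:R : F) & sp g m.

Lemma S1_Kl k g : Kg k -> S1 g -> S1 (k *m g).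
Proof.
move=> [ki [n hn hk]] [gi [m hm hg]]; split; first exact: integral_mulmx.
by exists (n * m); [rewrite pabsM hn hm mul1r|exact: sp_mul].
Qed.

Definition idxT : finType := ('I_l * 'I_l * 'I_l + 'I_l * 'I_l + 'I_l + unit)%type.

Definition repT (i : idxT) : 'M[F]_4 :=
  match i with
  | inl (inl (inl (u, v, w))) => borel_mx 1 1 1 0 u%:R v%:R w%:R u%:R 0
  | inl (inl (inr (x, y))) => borel_mx 1 0 1 x%:R 0 y%:R 0 0 (- x%:R)
  | inl (inr x) => borel_mx 0 1 1 0 0 0 x%:R 0 0
  | inr _ => borel_mx 0 0 1 0 0 0 0 0 0
  end.

Ltac borel_int :=
  ij4; rewrite mxE /= ?expr0; zl.

Lemma repT_sp i : sp (repT i) (l%:R ^+ 1).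
Proof.
by case: i => [[[[[u v] w]|[x y]]|x]|?]; apply: borel_sp; rewrite //= ?expr0 ?expr1; ring.
Qed.

Lemma repT_S1 i : S1 (repT i).
Proof.
split; last by exists (l%:R ^+ 1); [rewrite expr1|exact: repT_sp].
by case: i => [[[[[u v] w]|[x y]]|x]|?]; borel_int.
Qed.

Lemma S1_cover g : S1 g -> exists i, exists2 k, Kg k & g = repT i *m k.
Proof.
move=> [gi [m hm hg]].
have hm1 : pabs m = pabs (l%:R ^+ 1 : F) by rewrite expr1.
have [k hk [a [b [p [r [s [w [t [ o [ac bc E e1 e2]]]]]]]]]] := hermite_form hl gi hg hm1.
have := integral_mulmx gi hk.1; rewrite E => bi.
have pZ : p \in Zl by move: (bi 0 1); rewrite mxE.
have rZ : r \in Zl by move: (bi 0 2); rewrite mxE.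
have sZ : s \in Zl by move: (bi 0 3); rewrite mxE.
have wZ : w \in Zl by move: (bi 1 2); rewrite mxE.
have tZ : t \in Zl by move: (bi 1 3); rewrite mxE.
have oZ : o \in Zl by move: (bi 2 3); rewrite mxE.
have spb := borel_sp s ac bc e1 e2.
suff [i [k' hk' e]] : exists i, exists2 k', Kg k' & g *m k = repT i *m k'.
  by exists i; apply: (coset_trans hk); exists k'.
rewrite E; move: ac bc e1 e2 spb {E bi}; case: a b => [|[|a]] [|[|b]] // _ _;
  rewrite /= ?subn0 ?subnn ?expr0 ?expr1 ?mulr1 ?mul1r => e1 e2 spb.
- exists (inr tt).
  have ho : o = - (p * l%:R) by rewrite -[RHS]addr0 -e1; ring.
  have ht : t = r - w * p.
    by apply: (mulfI (lF_neq0 hl)); rewrite -[RHS]subr0 -e2 ho; ring.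
  apply: (borel_coset hl (p1 := p) (r1 := r) (s1 := s) (w1 := w) (t1 := t) (o1 := - p)
    (repT_sp (inr tt)) spb); do ?split => //; rewrite ?rpredN //= ?expr1 ?ho; ring.
- have [x [w1 [w1Z hw]]] := residueE wZ.
  exists (inl (inr x)).
  have ho : o = - p.
    by apply: (mulfI (lF_neq0 hl)); rewrite -[RHS]addr0 -e1; ring.
  have ht : t = r * l%:R - w * p by rewrite -[RHS]subr0 -e2 ho; ring.
  apply: (borel_coset hl (p1 := p) (r1 := r) (s1 := s) (w1 := w1) (t1 := r - p * w1) (o1 := - p)
    (repT_sp (inl (inr x))) spb); do ?split => //; rewrite ?rpredN //=;
    first [by zl | rewrite ?expr1 ?expr0 ?ht ?ho ?hw; ring].
- have [x [p1 [p1Z hp]]] := residueE pZ.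
  have ho : o = - p by rewrite -[RHS]addr0 -e1; ring.
  have hr : r = l%:R * t + w * p by rewrite -[RHS]addr0 -e2 ho; ring.
  have [y [s1 [s1Z hs]]] : exists (u : 'I_l) x', x' \in Zl /\ s - x%:R * t = u%:R + l%:R * x'.
    by apply: residueE; zl.
  exists (inl (inl (inr (x, y)))).
  have {}hs : s = x%:R * t + y%:R + l%:R * s1 by rewrite -addrA -hs; ring.
  apply: (borel_coset hl (p1 := p1) (r1 := p1 * w + t) (s1 := s1) (w1 := w) (t1 := t) (o1 := - p1)
    (repT_sp (inl (inl (inr (x, y))))) spb); do ?split => //; rewrite ?rpredN //=;
    first [by zl | rewrite ?expr1 ?expr0 ?hr ?ho ?hs ?hp; ring].
- have [u [r1 [r1Z hr]]] := residueE rZ.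
  have [w0 [w1 [w1Z hw]]] := residueE wZ.
  have [v [s1 [s1Z hs]]] : exists (v : 'I_l) x', x' \in Zl /\ s - u%:R * o = v%:R + l%:R * x'.
    by apply: residueE; zl.
  exists (inl (inl (inl (u, v, w0)))).
  have {}hs : s = u%:R * o + v%:R + l%:R * s1 by rewrite -addrA -hs; ring.
  have hp : p = - (l%:R * o) by rewrite -[RHS]add0r -e1; ring.
  have ht : t = r + w * o by rewrite -[RHS]subr0 -e2; ring.
  apply: (borel_coset hl (p1 := - o) (r1 := r1) (s1 := s1) (w1 := w1) (t1 := o * w1 + r1) (o1 := o)
    (repT_sp (inl (inl (inl (u, v, w0))))) spb); do ?split => //; rewrite ?rpredN //=;
    first [by zl | rewrite ?expr1 ?expr0 ?ht ?hs ?hp ?hr ?hw; ring].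
Qed.

Lemma repT_inj i j k : Kg k -> repT i = repT j *m k -> i = j.
Proof.
move=> [ki _].
case: i => [[[[[u v] w]|[x y]]|x]|[]]; case: j => [[[[[u' v'] w']|[x' y']]|x']|[]] //;
  move=> /(borel_coset_inv hl ki)/(_ isT isT isT isT)[] // _ _ [p1 [r1 [s1 [w1 [t1 [ o1]]]]]];
  rewrite /= ?expr0 ?expr1 ?mul1r ?mul0r ?mulr0 ?addr0.
- move=> [[? ? ?] [? ? o1Z] [_ hr hs] [hw _ ho]].
  have o10 : o1 = 0 by rewrite -ho.
  have -> : u = u' by apply: (ord_cong_inj _ hr).
  have -> : w = w' by apply: (ord_cong_inj _ hw).
  have -> // : v = v'.
  by apply: (@ord_cong_inj _ _ s1) => //; rewrite hs o10; ring.
- move=> [[? ? ?] [w1Z t1Z o1Z] [hp hr hs] [hw ht ho]].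
  have t10 : t1 = 0 by rewrite ht.
  have -> : x = x' by apply: (ord_cong_inj _ hp).
  have -> // : y = y'.
  by apply: (@ord_cong_inj _ _ s1) => //; rewrite hs -ht; ring.
- move=> [[? ? ?] [w1Z t1Z o1Z] [hp hr hs] [hw ht ho]].
  by have -> : x = x' by apply: (ord_cong_inj _ hw).
Qed.

End HeckeCosets.

Section HeckeCosets1.
Context {l : nat} {R : realType} {F : padicType l R}.
Hypothesis hl : prime l.
Implicit Types (g h k : 'M[F]_4) (m n x y p r s w t o : F).
Notation borel_mx := (@borel_mx l R F).

(* The double coset of diag (l^2, l, l, 1) under GSp4(Z_l): the reduction of *)
(* g modulo l has rank one.                                                *)
Definition S2 g :=
  [/\ integral_mx g, exists2 m, pabs m = pabs (l%:R ^+ 2 : F) & sp g m,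
      exists (u : 'M[F]_(4, 1)) (w : 'M[F]_(1, 4)) (M : 'M[F]_4),
        [/\ integral_mx u, integral_mx w, integral_mx M & g = u *m w + l%:R *: M]
    & ~ integral_mx (l%:R^-1 *: g)].

Lemma S2_Kl k g : Kg k -> S2 g -> S2 (k *m g).
Proof.
move=> hk [gi [m hm hg] [u [w [M [ui wi Mi e]]]] gn].
have [k' [k'i _] [_ k'k]] := KgV hk; case: hk => ki [n hn hk]; split.
- exact: integral_mulmx.
- by exists (n * m); [rewrite pabsM hn hm mul1r|exact: sp_mul].
- exists (k *m u), w, (k *m M); split=> //; try exact: integral_mulmx.
  by rewrite e mulmxDr -scalemxAr mulmxA.
- move=> h; apply: gn; have -> : g = k' *m (k *m g) by rewrite mulmxA k'k mul1mx.
  by rewrite scalemxAr; apply: integral_mulmx.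
Qed.

Lemma S2_Kr k g : Kg k -> S2 g -> S2 (g *m k).
Proof.
move=> hk [gi [m hm hg] [u [w [M [ui wi Mi e]]]] gn].
have [k' [k'i _] [kk' _]] := KgV hk; case: hk => ki [n hn hk]; split.
- exact: integral_mulmx.
- by exists (m * n); [rewrite pabsM hn hm mulr1|exact: sp_mul].
- exists u, (w *m k), (M *m k); split=> //; try exact: integral_mulmx.
  by rewrite e mulmxDl -scalemxAl mulmxA.
- move=> h; apply: gn; have -> : g = g *m k *m k' by rewrite -mulmxA kk' mulmx1.
  by rewrite scalemxAl; apply: integral_mulmx.
Qed.

Lemma S2_minor g i j i' j' : S2 g ->
  exists2 x, x \in Zl & g i j * g i' j' - g i j' * g i' j = l%:R * x.
Proof.
move=> [_ _ [u [w [M [ui wi Mi ->]]]] _].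
have E a b : (u *m w + l%:R *: M) a b = u a 0 * w 0 b + l%:R * M a b.
  by rewrite !mxE big_ord_recl big_ord0 addr0.
exists (u i 0 * w 0 j * M i' j' + M i j * (u i' 0 * w 0 j' + l%:R * M i' j')
  - u i 0 * w 0 j' * M i' j - M i j' * (u i' 0 * w 0 j + l%:R * M i' j)).
  have := ui i 0; have := ui i' 0; have := wi 0 j; have := wi 0 j'.
  have := Mi i j; have := Mi i' j'; have := Mi i' j; have := Mi i j'; move=> *; zl.
by rewrite !E; ring.
Qed.

Lemma one_not_l x : x \in Zl -> 1 <> l%:R * x.
Proof.
move=> hx e; have := @pabs_l_lt1 l R F hl.
have := congr1 (fun y : F => pabs y) e; rewrite /= pabs1 pabsM => h.
by rewrite ltNge h (ler_piMr (pabs_ge0 _) hx).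
Qed.

Lemma S2_intro g (u : seq F) (w : seq F) (M : seq (seq F)) :
  sp g (l%:R ^+ 2) ->
  integral_mx (\col_(i < 4) nth 0 u i) -> integral_mx (\row_(i < 4) nth 0 w i) ->
  integral_mx (mx_of 4 M) ->
  (forall i j : 'I_4, g i j = nth 0 u i * nth 0 w j + l%:R * nth 0 (nth [::] M i) j) ->
  (exists i j, pabs (g i j) = 1) -> S2 g.
Proof.
move=> hg ui wi Mi e gn.
have e' : g = \col_(i < 4) nth 0 u i *m \row_(i < 4) nth 0 w i + l%:R *: mx_of 4 M.
  by apply/matrixP => i j; rewrite e !mxE big_ord_recl big_ord0 addr0 !mxE.
split; [|by exists (l%:R ^+ 2)|by exists (\col_(i < 4) nth 0 u i), (\row_(i < 4) nth 0 w i), (mx_of 4 M)|].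
  rewrite e' => i j; rewrite mxE rpredD //; first exact: integral_mulmx.
  by rewrite mxE rpredM // l_Zl.
case: gn => i [j h] /(_ i j); rewrite mxE => gZ.
have := @pabs_l_lt1 l R F hl; rewrite ltNge -h.
by rewrite -[g i j](mulVKf (lF_neq0 hl)) pabsM (ler_piMr (pabs_ge0 _) gZ).
Qed.

Definition idxT1 : finType :=
  ('I_l * 'I_l * 'I_(l ^ 2) + 'I_l * 'I_(l ^ 2) + 'I_l + unit + 'I_l.-1 + 'I_l.-1 * 'I_l)%type.

Definition repT1 (i : idxT1) : 'M[F]_4 :=
  match i with
  | inl (inl (inl (inl (inl (a, b, c))))) =>
      borel_mx 2 1 2 (l%:R * a%:R) (l%:R * b%:R) c%:R 0 b%:R (- a%:R)
  | inl (inl (inl (inl (inr (a, c))))) => borel_mx 1 2 2 0 a%:R 0 c%:R (l%:R * a%:R) 0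
  | inl (inl (inl (inr a))) => borel_mx 1 0 2 a%:R 0 0 0 0 (- (l%:R * a%:R))
  | inl (inl (inr _)) => borel_mx 0 1 2 0 0 0 0 0 0
  | inl (inr w) => borel_mx 1 1 2 0 0 0 w.+1%:R 0 0
  | inr (v, u) => borel_mx 1 1 2 0 u%:R v.+1%:R (u%:R ^+ 2 / v.+1%:R) u%:R 0
  end.

Lemma unit_ordS_neq0 (v : 'I_l.-1) : v.+1%:R != 0 :> F.
Proof. exact/pabs_unit_neq0/unit_ordS. Qed.

Lemma repT1_sp i : sp (repT1 i) (l%:R ^+ 2).
Proof.
case: i => [[[[[[[a b] c]|[a c]]|a]|?]|w]|[v u]]; apply: borel_sp;
  rewrite //= ?subn0 ?subnn ?expr0 ?expr1; ring.
Qed.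

Lemma inv_ordS_Zl (v : 'I_l.-1) : (v.+1%:R)^-1 \in (Zl : {pred F}).
Proof. by case: (unitZl (@unit_ordS l R F hl v)). Qed.

Ltac S2_side := first
  [ by move=> -[[|[|[|[|?]]]] ?] ? //; rewrite mxE /=; zl
  | by move=> ? -[[|[|[|[|?]]]] ?] //; rewrite mxE /=; zl
  | by ij4; rewrite mxE /=; zl | by ij4; rewrite mxE /= ?expr1; ring | idtac ].

Lemma repT1_S2 i : S2 (repT1 i).
Proof.
have sp2 := repT1_sp i.
have lZ := @l_Zl l R F.
case: i sp2 => [[[[[[[a b] c]|[a c]]|a]|?]|w]|[v u]] sp2.
- apply: (S2_intro (u := [:: c%:R; b%:R; - a%:R; 1]) (w := [:: 0; 0; 0; 1])
   (M := [:: [:: l%:R; a%:R; b%:R; 0]; [:: 0; 1; 0; 0]; [:: 0; 0; 1; 0]; [:: 0; 0; 0; 0]])) => //; S2_side.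
  by exists 3, 3; rewrite mxE /= expr0 pabs1.
- apply: (S2_intro (u := [:: a%:R; c%:R; 1; 0]) (w := [:: 0; 0; 1; 0])
   (M := [:: [:: 1; 0; 0; 0]; [:: 0; l%:R; 0; a%:R]; [:: 0; 0; 0; 0]; [:: 0; 0; 0; 1]])) => //; S2_side.
  by exists 2, 2; rewrite mxE /= expr0 pabs1.
- apply: (S2_intro (u := [:: a%:R; 1; 0; 0]) (w := [:: 0; 1; 0; 0])
   (M := [:: [:: 1; 0; 0; 0]; [:: 0; 0; 0; 0]; [:: 0; 0; l%:R; - a%:R]; [:: 0; 0; 0; 1]])) => //; S2_side.
  by exists 1, 1; rewrite mxE /= expr0 pabs1.
- apply: (S2_intro (u := [:: 1; 0; 0; 0]) (w := [:: 1; 0; 0; 0])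
   (M := [:: [:: 0; 0; 0; 0]; [:: 0; 1; 0; 0]; [:: 0; 0; 1; 0]; [:: 0; 0; 0; l%:R]])) => //; S2_side.
  by exists 0, 0; rewrite mxE /= expr0 pabs1.
- apply: (S2_intro (u := [:: 0; w.+1%:R; 0; 0]) (w := [:: 0; 0; 1; 0])
   (M := [:: [:: 1; 0; 0; 0]; [:: 0; 1; 0; 0]; [:: 0; 0; 1; 0]; [:: 0; 0; 0; 1]])) => //; S2_side.
  by exists 1, 2; rewrite mxE /= unit_ordS.
- have v0 := unit_ordS_neq0 v; have vZ := inv_ordS_Zl v.
  apply: (S2_intro (u := [:: 1; u%:R / v.+1%:R; 0; 0]) (w := [:: 0; 0; u%:R; v.+1%:R])
   (M := [:: [:: 1; 0; 0; 0]; [:: 0; 1; 0; 0]; [:: 0; 0; 1; 0]; [:: 0; 0; 0; 1]])) => //; S2_side.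
  + rewrite /repT1 /=; move: (v.+1%:R) v0 => V V0.
    by ij4; rewrite mxE /= ?expr1; field.
  + by exists 0, 3; rewrite mxE /= unit_ordS.
Qed.

Lemma S2_cover g : S2 g -> exists i, exists2 k, Kg k & g = repT1 i *m k.
Proof.
move=> hg2; have [gi [m hm hg] _ _] := hg2.
have [k hk [a [b [p [r [s [w [t [ o [ac bc E e1 e2]]]]]]]]]] := hermite_form hl gi hg hm.
have := S2_Kr hk hg2; rewrite E => S2b; have bi := let: And4 h _ _ _ := S2b in h.
have mi i j i' j' := S2_minor i j i' j' S2b.
have pZ : p \in Zl by move: (bi 0 1); rewrite mxE.
have rZ : r \in Zl by move: (bi 0 2); rewrite mxE.
have sZ : s \in Zl by move: (bi 0 3); rewrite mxE.
have wZ : w \in Zl by move: (bi 1 2); rewrite mxE.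
have tZ : t \in Zl by move: (bi 1 3); rewrite mxE.
have oZ : o \in Zl by move: (bi 2 3); rewrite mxE.
have lZ := @l_Zl l R F.
have l0 := @lF_neq0 l R F hl.
have spb := borel_sp s ac bc e1 e2.
suff [i [k' hk' e]] : exists i, exists2 k', Kg k' & g *m k = repT1 i *m k'.
  by exists i; apply: (coset_trans hk); exists k'.
rewrite E; move: ac bc e1 e2 spb mi S2b {E bi}.
case: a b => [|[|[|a]]] [|[|[|b]]] // _ _;
  rewrite /= ?subn0 ?subnn ?expr0 ?expr1 ?mulr1 ?mul1r => e1 e2 spb mi S2b.
- have [x xZ] := mi 0 0 1 1; rewrite !mxE /= ?subn0 ?expr0 => h.
  by case: (one_not_l xZ); rewrite -h; ring.
- exists (inl (inl (inr tt))).
  have ho : o = - (p * l%:R).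
    by apply: (mulfI l0); rewrite -[RHS]addr0 -e1; ring.
  have [w1 w1Z hw] : exists2 w1, w1 \in Zl & w = l%:R * w1.
    by have [x xZ h] := mi 0 0 1 2; exists x => //; rewrite -h !mxE /= expr0; ring.
  have ht : t = r * l%:R - w1 * l%:R * p.
    by apply: (mulfI l0); rewrite -[RHS]subr0 -e2 ho hw; ring.
  apply: (borel_coset hl (p1 := p) (r1 := r) (s1 := s) (w1 := w1) (t1 := r - p * w1) (o1 := - p)
    (repT1_sp (inl (inl (inr tt)))) spb); do ?split => //; rewrite ?rpredN //=;
    first [by zl | rewrite ?expr0 ?expr1 ?ho ?ht ?hw; ring].
- have [x xZ] := mi 0 0 2 2; rewrite !mxE /= ?subn0 ?expr0 => h.
  by case: (one_not_l xZ); rewrite -h; ring.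
- have [c [p1 [p1Z hp]]] := residueE hl pZ.
  exists (inl (inl (inl (inr c)))).
  have ho : o = - (p * l%:R) by rewrite -[RHS]addr0 -e1; ring.
  have hr : r = l%:R * t + w * p.
    by apply: (mulfI l0); rewrite -[RHS]addr0 -e2 ho; ring.
  have [s1 s1Z hs] : exists2 s1, s1 \in Zl & s = p * t + l%:R * s1.
    have [x xZ h] := mi 0 1 1 3; exists (- x); rewrite ?rpredN //.
    by rewrite mulrN -h !mxE /= expr0; ring.
  apply: (borel_coset hl (p1 := p1) (r1 := p1 * w + t) (s1 := p1 * t + s1) (w1 := w)
    (t1 := t) (o1 := - p1)
    (repT1_sp (inl (inl (inl (inr c))))) spb); do ?split => //; rewrite ?rpredN //=;
    first [by zl | rewrite ?expr0 ?expr1 ?ho ?hr ?hs ?hp; ring].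
- have ho : o = - p by apply: (mulfI l0); rewrite -[RHS]addr0 -e1; ring.
  have ht : t = r + w * o / l%:R.
    by apply: (mulfI l0); rewrite -[RHS]subr0 -e2; field.
  have [p1 p1Z hp] : exists2 p1, p1 \in Zl & p = l%:R * p1.
    have [x xZ] := mi 0 1 2 3; rewrite !mxE /= ho => h.
    exists (p / l%:R); last by field.
    apply: (Zl_sqr_div hl pZ); rewrite (_ : _ / _ = - x) ?rpredN //.
    by apply: (mulfI l0); rewrite mulrN -h; field.
  have {}ht : t = r - w * p1 by rewrite ht ho hp; field.
  have {}ho : o = - (l%:R * p1) by rewrite ho hp.
  have [e eZ he] : exists2 e, e \in Zl & r * t - s * w = l%:R * e.
    by have [x xZ h] := mi 0 2 1 3; exists x => //; rewrite -h !mxE.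
  have SZ : s + r * p1 \in Zl by zl.
  have hrs : r ^+ 2 = (s + r * p1) * w + l%:R * e by rewrite -he ht; ring.
  case: (eqVneq (pabs (s + r * p1)) 1) => hS.
    have [v [s1 [s1Z hs]]] := residue_ordS hl hS.
    have [u [r1 [r1Z hr]]] := residueE hl rZ.
    move EV : (v.+1%:R) (unit_ordS_neq0 v) (inv_ordS_Zl v) hs => V V0 VZ hs.
    exists (inr (v, u)).
    pose w1 := (- e - s1 * w + 2 * u%:R * r1 + l%:R * r1 ^+ 2) / V.
    have w1Z : w1 \in Zl by rewrite /w1; zl.
    have hw : w = u%:R ^+ 2 / V + l%:R * w1.
      apply: (mulfI V0); rewrite /w1.
      rewrite (_ : V * (_ + _) = u%:R ^+ 2 +
        l%:R * (- e - s1 * w + 2 * u%:R * r1 + l%:R * r1 ^+ 2)); last by field.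
      have -> : V = s + r * p1 - l%:R * s1 by rewrite hs addrK.
      rewrite mulrBl (_ : (s + r * p1) * w = r ^+ 2 - l%:R * e); last by rewrite hrs addrK.
      by rewrite hr; ring.
    have {}hs : s = V + l%:R * s1 - r * p1 by rewrite -hs addrK.
    apply: (borel_coset hl (p1 := p1) (r1 := r1) (s1 := s1 - p1 * r1) (w1 := w1)
      (t1 := r1 - p1 * w1) (o1 := - p1)
      (repT1_sp (inr (v, u))) spb); do ?split => //; rewrite ?rpredN //= ?EV; first [by zl | idtac].
    + by rewrite hp; ring.
    + by rewrite hr; ring.
    + by rewrite hs hr; ring.
    + by rewrite hw; ring.
    + by rewrite ht {1}hw hr; field.
    + by rewrite ho; ring.
  have {hS}S1 : pabs (s + r * p1) < 1 by rewrite lt_neqAle hS.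
  have {S1}S1 := Zl_lt1 hl S1.
  pose s1 := (s + r * p1) / l%:R.
  have hs : s = l%:R * s1 - r * p1 by rewrite /s1; field.
  have r1Z : r / l%:R \in Zl.
    apply: (Zl_sqr_div hl rZ); rewrite hrs.
    rewrite (_ : _ / _ = s1 * w + e); first by zl.
    by rewrite /s1; field.
  pose r1 := r / l%:R.
  have hr : r = l%:R * r1 by rewrite /r1; field.
  have w1 : pabs w = 1.
    apply/eqP; rewrite eq_le -ZlE wZ /= leNgt; apply/negP => /(Zl_lt1 hl) wl.
    case: S2b => _ _ _; apply.
    have lV1 : l%:R^-1 * l%:R = 1 :> F by rewrite mulVf.
    have lV n : n / l%:R \in Zl -> l%:R^-1 * n \in Zl by rewrite mulrC.
    ij4; rewrite !mxE /= ?expr1 ?mulr0 ?rpred0 ?lV1 ?rpred1 //; apply: lV => //.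
    + by rewrite hp mulrC mulKf.
    + by rewrite hs hr (_ : _ / _ = s1 - r1 * p1); [zl|field].
    + by rewrite ht mulrBl mulrAC; zl.
    + by rewrite ho mulNr rpredN mulrC mulKf.
  have [w0 [w2 [w2Z hw]]] := residue_ordS hl w1.
  exists (inl (inr w0)).
  have s1Z : s1 \in Zl by [].
  have {r1Z}r1Z : r1 \in Zl by [].
  apply: (borel_coset hl (p1 := p1) (r1 := r1) (s1 := s1 - p1 * r1) (w1 := w2)
      (t1 := r1 - p1 * w2) (o1 := - p1)
      (repT1_sp (inl (inr w0))) spb); do ?split => //; rewrite ?rpredN //=; first [by zl | idtac].
  + by rewrite hp; ring.
  + by rewrite hr; ring.
  + by rewrite hs hr; ring.
  + by rewrite hw; ring.
  + by rewrite ht hw hr; ring.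
  + by rewrite ho; ring.
- have [c [r1 [r1Z hr]]] := residueE hl rZ.
  have [d [w1 [w1Z hw]]] := residue2E hl wZ.
  exists (inl (inl (inl (inl (inr (c, d)))))).
  have hp : p = - (l%:R * o).
    by apply: (mulfI l0); rewrite -[LHS]subr0 -e1; ring.
  have ht : t = r * l%:R + w * o by rewrite -[RHS]subr0 -e2; ring.
  have [s1 s1Z hs] : exists2 s1, s1 \in Zl & s = r * o + l%:R * s1.
    have [x xZ h] := mi 0 2 2 3; exists (- x); rewrite ?rpredN //.
    by rewrite mulrN -h !mxE /= expr0; ring.
  apply: (borel_coset hl (p1 := - o) (r1 := r1) (s1 := o * r1 + s1) (w1 := w1)
    (t1 := o * w1 + r1) (o1 := o)
    (repT1_sp (inl (inl (inl (inl (inr (c, d))))))) spb); do ?split => //; rewrite ?rpredN //=;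
    first [by zl | rewrite ?expr0 ?expr1 ?ht ?hp ?hs ?hr ?hw; ring].
- have [x xZ] := mi 1 1 3 3; rewrite !mxE /= ?subn0 ?expr0 => h.
  by case: (one_not_l xZ); rewrite -h; ring.
- have [c [ o1 [ o1Z hc]]] : exists (u : 'I_l) x', x' \in Zl /\ - o = u%:R + l%:R * x'.
    by apply: residueE; rewrite ?rpredN.
  have ho : o = - c%:R + l%:R * (- o1).
    by rewrite -(opprK o) hc; ring.
  have [d [t1 [t1Z ht]]] := residueE hl tZ.
  have [f [s1 [s1Z hf]]] : exists (u : 'I_(l ^ 2)) x', x' \in Zl /\
      s - c%:R * t - d%:R * o = u%:R + l%:R ^+ 2 * x'.
    by apply: residue2E => //; zl.
  exists (inl (inl (inl (inl (inl (c, d, f)))))).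
  have hs : s = f%:R + l%:R ^+ 2 * s1 + c%:R * t + d%:R * o by rewrite -hf; ring.
  have hp : p = - (l%:R * o) by rewrite -[LHS]subr0 -e1; ring.
  have [w1 w1Z hw] : exists2 w1, w1 \in Zl & w = l%:R * w1.
    by have [x xZ h] := mi 1 2 3 3; exists x => //; rewrite -h !mxE /= expr0; ring.
  have hr : r = l%:R * (t - w1 * o).
    by rewrite -[LHS]subr0 -e2 hw; ring.
  apply: (borel_coset hl (p1 := o1) (r1 := o1 * w1 + t1) (s1 := s1) (w1 := w1)
    (t1 := t1) (o1 := - o1)
    (repT1_sp (inl (inl (inl (inl (inl (c, d, f))))))) spb); do ?split => //; rewrite ?rpredN //=;
    first [by zl | rewrite ?expr0 ?expr1 ?hp ?hr ?hs ?hw ?ho ?ht; ring].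
- have [x xZ] := mi 2 2 3 3; rewrite !mxE /= ?subn0 ?subnn ?expr0 => h.
  by case: (one_not_l xZ); rewrite -h; ring.
Qed.

Lemma repT1_inj i j k : Kg k -> repT1 i = repT1 j *m k -> i = j.
Proof.
have van x : 0 = l%:R * x -> x = 0.
  by move=> /esym/eqP; rewrite mulf_eq0 (negbTE (lF_neq0 hl)) => /eqP.
move=> [ki _].
case: i => [[[[[[[a b] c]|[a c]]|a]|[]]|w]|[v u]];
  case: j => [[[[[[[a' b'] c']|[a' c']]|a']|[]]|w']|[v' u']] //;
  move=> /(borel_coset_inv hl ki)/(_ isT isT isT isT)[] // _ _ [p1 [r1 [s1 [w1 [t1 [ o1]]]]]];
  rewrite /= ?expr0 ?expr1 ?mul1r ?mul0r ?mulr0 ?addr0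
   => -[[p1Z r1Z s1Z] [w1Z t1Z o1Z] [hp hr hs] [hw ht ho]].
- have w10 := van _ hw.
  have ea : a = a'.
    apply: (ord_cong_inj hl p1Z); apply: (mulfI (lF_neq0 hl)).
    by rewrite hp; ring.
  have eb : b = b' by apply: (ord_cong_inj hl t1Z).
  subst a' b'.
  have t10 : t1 = 0 by apply: van; apply: (addIr b%:R); rewrite add0r.
  have o10 : o1 = 0 by apply: van; apply: (addIr (- a%:R)); rewrite add0r.
  have -> // : c = c'.
  apply/ord_inj/(@nat_cong_inj _ _ F hl 2 _ _ s1) => //.
  by rewrite hs t10 o10; ring.
- have -> : a = a' by apply: (ord_cong_inj hl r1Z).
  by have -> // : c = c' by apply/ord_inj/(@nat_cong_inj _ _ F hl 2 _ _ w1).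
- by have -> : a = a' by apply: (ord_cong_inj hl p1Z).
- by have -> : w = w' by apply: (ordS_cong_inj hl w1Z).
- have o10 := van _ ho.
  case: (ordS_not_l hl (u := v') (x := - s1)); rewrite ?rpredN //.
  apply/eqP; rewrite -subr_eq0; apply/eqP; rewrite [RHS]hs o10; ring.
- have o10 := van _ ho.
  by case: (ordS_not_l hl (u := v) (x := s1)) => //; rewrite hs; ring.
- have o10 := van _ ho.
  have -> : u = u' by apply: (ord_cong_inj hl r1Z).
  by have -> : v = v' by apply: (ordS_cong_inj hl s1Z); rewrite hs o10; ring.
Qed.

End HeckeCosets1.

(** * Principal series and Hecke eigenvalues *)

Section Smooth.
Context {l : nat} {R : realType} {F : padicType l R}.
Hypothesis hl : prime l.

Lemma lX_small (r : R) : 0 < r -> exists k : nat, l%:R ^- k < r.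
Proof.
move=> r0; exists (Num.bound r^-1).
rewrite invf_plt ?posrE ?exprn_gt0 ?lgt0 //.
have r1 : 0 <= r^-1 by rewrite invr_ge0 ltW.
rewrite (lt_le_trans (archi_boundP r1)) // -natrX ler_nat ltnW // ltn_expl //.
exact: prime_gt1.
Qed.

Lemma nbhs_FP (x : F) (A : set F) :
  nbhs x A <-> exists k : nat, forall y, (y - x) / l%:R ^+ k \in Zl -> A y.
Proof.
rewrite nbhs_pabs; split=> [[r r0 h]|[k h]].
  have [k kr] := lX_small r0; exists k => y hy; apply: h => /=.
  by rewrite (le_lt_trans _ kr) // -(@pabs_lX l R F) pabs_le_div // lX_neq0.
exists (l%:R ^- k); first by rewrite invr_gt0 exprn_gt0 ?lgt0.
by move=> y /= hy; apply: h; rewrite -pabs_le_div ?lX_neq0 // pabs_lX ltW.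
Qed.

Lemma nbhs_mxP p q (M : 'M[F]_(p, q)) (A : set 'M[F]_(p, q)) :
  nbhs M A <->
  exists k : nat, forall h : 'M[F]_(p, q), (forall i j, (h i j - M i j) / l%:R ^+ k \in Zl) -> A h.
Proof.
split=> [[P MP sub]|[k h]]; last first.
  exists (fun i j => [set y | (y - M i j) / l%:R ^+ k \in Zl]) => [i j|].
    by apply/nbhs_FP; exists k.
  by move=> N hN; apply: h => i j; apply: hN.
have ex i j := cid ((nbhs_FP _ _).1 (MP i j)).
pose k := \max_(i < p) \max_(j < q) sval (ex i j).
exists k => h hh; apply: sub => i j /=.
apply: (svalP (ex i j)); set n := sval (ex i j).
have nk : (n <= k)%N.
  apply: leq_trans (leq_bigmax i).
  exact: (@leq_bigmax _ (fun j => sval (ex i j)) j).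
have -> : (h i j - M i j) / l%:R ^+ n = l%:R ^+ (k - n) * ((h i j - M i j) / l%:R ^+ k).
  rewrite -{2}(subnK nk) exprD.
  have := lX_neq0 (F := F) hl (k - n); have := lX_neq0 (F := F) hl n.
  by move: (l%:R ^+ (k - n)) (l%:R ^+ n) => A' B B0 A0; field; rewrite A0 B0.
by rewrite rpredM // rpredX // l_Zl.
Qed.

Lemma integral_scale p q (g : 'M[F]_(p, q)) :
  exists k : nat, forall i j, l%:R ^+ k * g i j \in Zl.
Proof.
have ex x : {k : nat | l%:R ^+ k * x \in (Zl : {pred F})}.
  apply: cid; have [->|x0] := eqVneq x 0; first by exists 0%N; rewrite mulr0 rpred0.
  have [[n|n] [u [hu ->]]] := unit_decomp hl x0.
    by exists 0%N; rewrite expr0 mul1r rpredM ?rpredX ?l_Zl //; case: (unitZl hu).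
  exists n.+1; rewrite NegzE -exprnN mulrA divff ?lX_neq0 // mul1r.
  by case: (unitZl hu).
pose k := \max_(i < p) \max_(j < q) sval (ex (g i j)).
exists k => i j; have := svalP (ex (g i j)); set n := sval (ex (g i j)) => hn.
have nk : (n <= k)%N.
  apply: leq_trans (leq_bigmax i).
  exact: (@leq_bigmax _ (fun j => sval (ex (g i j))) j).
by rewrite -(subnK nk) exprD -mulrA rpredM // rpredX // l_Zl.
Qed.

Lemma smooth_rtrans n (G : pred 'M[F]_n) (f : 'M[F]_n -> R[i]) (g : 'M[F]_n) :
  g \in unitmx -> (forall h, G h -> G (invmx g *m h *m g)) ->
  smooth_fun G f -> smooth_fun G (rtrans g f).
Proof.
move=> gu Gg /nbhs_mxP[k hk].
have [a ha] := integral_scale g; have [b hb] := integral_scale (invmx g).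
apply/nbhs_mxP; exists (k + a + b)%N => h hh Gh.
suff e : rtrans (invmx g *m h *m g) f = f.
  apply/funext => x; rewrite /rtrans -[in RHS]e /rtrans.
  by rewrite -!mulmxA mulKVmx.
apply: (hk _ _ (Gg _ Gh)) => i j.
have -> : (invmx g *m h *m g) i j - 1%:M i j = (invmx g *m (h - 1%:M) *m g) i j.
  by rewrite mulmxBr mulmxBl mulmx1 mulVmx // [RHS]mxE [X in _ = _ + X]mxE.
rewrite mxE mulr_suml rpred_sum // => m _; rewrite mxE !mulr_suml rpred_sum // => m' _.
have hm := hh m' m.
have hD : (h - 1%:M) m' m = h m' m - 1%:M m' m by rewrite mxE [X in _ + X = _]mxE.
have -> : invmx g i m' * (h - 1%:M) m' m * g m j / l%:R ^+ k =
  (l%:R ^+ b * invmx g i m') * ((h m' m - 1%:M m' m) / l%:R ^+ (k + a + b)) * (l%:R ^+ a * g m j) :> F.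
  rewrite hD !exprD; have := lX_neq0 (F := F) hl k.
  have := lX_neq0 (F := F) hl a; have := lX_neq0 (F := F) hl b.
  move: (l%:R ^+ k) (l%:R ^+ a) (l%:R ^+ b) => K A B B0 A0 K0.
  by field; rewrite K0 A0 B0.
by apply: rpredM; [apply: rpredM; [exact: hb|exact: hm]|exact: ha].
Qed.

Lemma smooth_add n (G : pred 'M[F]_n) (f1 f2 : 'M[F]_n -> R[i]) (a : R[i]) :
  smooth_fun G f1 -> smooth_fun G f2 -> smooth_fun G (fun g => a * f1 g + f2 g).
Proof.
rewrite /smooth_fun => h1 h2; apply: filterS2 h1 h2 => h e1 e2 Gh.
apply/funext => x; have := e1 Gh; have := e2 Gh => {}e2 {}e1.
by rewrite -[in RHS]e1 -[in RHS]e2.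
Qed.

End Smooth.

Section AbsChar.
Context {l : nat} {R : realType} {F : padicType l R}.
Hypothesis hl : prime l.
Implicit Types x y : F.

Lemma abscharM (r : R) x y : abschar r (x * y) = abschar r x * abschar r y.
Proof. by rewrite /abschar pabsM powRM ?pabs_ge0 // rmorphM. Qed.

Lemma abschar_eq (r : R) x y : pabs x = pabs y -> abschar r x = abschar r y.
Proof. by rewrite /abschar => ->. Qed.

Lemma abschar1 (r : R) : abschar r (1 : F) = 1.
Proof. by rewrite /abschar pabs1 powR1. Qed.

Lemma abschar_unramified (r : R) : unramified (@abschar l R F r).
Proof. by move=> u hu; rewrite (@abschar_eq r u 1) ?pabs1 // abschar1. Qed.

Lemma near1_pabs : \forall u \near (1 : F), pabs u = 1.
Proof.
apply/(nbhs_FP hl); exists 1%N => y; rewrite expr1 => h.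
rewrite -[y](subrK 1) addrC pabs_addl pabs1 //.
rewrite -[y - 1](divfK (lF_neq0 hl)) pabsM.
by rewrite (le_lt_trans _ (@pabs_l_lt1 l R F hl)) // ler_piMl // pabs_ge0.
Qed.

Lemma abschar_is_char (r : R) : is_char (@abschar l R F r).
Proof.
split; [exact: abschar1|by move=> *; exact: abscharM|].
by near=> u; apply: abschar_unramified; near: u; exact: near1_pabs.
Unshelve. all: by end_near. Qed.

Lemma unram_is_char (chi : F -> R[i]) : chi 1 = 1 ->
  (forall x y, x != 0 -> y != 0 -> chi (x * y) = chi x * chi y) ->
  unramified chi -> is_char chi.
Proof.
move=> h1 hM hu; split => //.
by near=> u; apply: hu; near: u; exact: near1_pabs.
Unshelve. all: by end_near. Qed.

Lemma char_neq0 (chi : F -> R[i]) x : is_char chi -> x != 0 -> chi x != 0.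
Proof.
move=> [h1 hM _] x0; apply/eqP => h.
have := hM x x^-1 x0; rewrite invr_eq0 x0 divff // h1 h mul0r => /(_ isT)/eqP.
by rewrite oner_eq0.
Qed.

Lemma charX (chi : F -> R[i]) x n : is_char chi -> x != 0 -> chi (x ^+ n) = chi x ^+ n.
Proof.
move=> [h1 hM _] x0; elim: n => [|n IH]; rewrite ?expr0 // !exprS hM ?IH //.
by rewrite expf_neq0.
Qed.

Lemma charV (chi : F -> R[i]) x : is_char chi -> x != 0 -> chi x^-1 = (chi x)^-1.
Proof.
move=> hc x0; apply: (mulfI (char_neq0 hc x0)); rewrite divff ?char_neq0 //.
by case: hc => [h1 hM _]; rewrite -hM ?divff ?invr_eq0.
Qed.

Lemma unram_eq (chi : F -> R[i]) x y : is_char chi -> unramified chi ->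
  x != 0 -> pabs x = pabs y -> chi x = chi y.
Proof.
move=> hc hu x0 e.
have y0 : y != 0 by rewrite -pabs_gt0 -e pabs_gt0.
rewrite -[y](mulVKf x0) [in RHS](let: And3 _ h _ := hc in h) ?mulf_neq0 ?invr_eq0 //.
rewrite (hu (x^-1 * y)) ?mulr1 //.
by rewrite pabsM pabsV e mulVf // pabs_eq0.
Qed.

Definition sqrtl : R[i] := abschar (- 2^-1) (l%:R : F).

Lemma abschar_l (r : R) : abschar r (l%:R : F) = (l%:R `^ (- r))%:C.
Proof.
rewrite /abschar pabs_prime -powR_inv1 ?ler0n // -powRrM mulN1r //.
Qed.

Lemma abschar_add (r s : R) x : x != 0 ->
  abschar (r + s) x = abschar r x * abschar s x.
Proof.
move=> x0; rewrite /abschar powRD ?rmorphM //.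
by rewrite pabs_eq0 (negbTE x0) implybT.
Qed.

Lemma abschar_natl n x : abschar n%:R x = (pabs x ^+ n)%:C.
Proof. by rewrite /abschar powR_mulrn ?pabs_ge0. Qed.

Lemma abscharN (r : R) x : abschar (- r) x = (abschar r x)^-1.
Proof. by rewrite /abschar powRN fmorphV. Qed.

Lemma sqrtl_sqr : sqrtl ^+ 2 = l%:R.
Proof.
rewrite /sqrtl expr2 -abschar_add ?lF_neq0 // (_ : _ + _ = - 1%:R); last by field.
by rewrite abscharN abschar_natl pabs_prime expr1 fmorphV invrK rmorph_nat.
Qed.

Lemma sqrtl_neq0 : sqrtl != 0.
Proof.
apply/eqP => h; have := sqrtl_sqr; rewrite h expr0n /= => /esym/eqP.
by rewrite pnatr_eq0 eqn0Ngt prime_gt0.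
Qed.

Lemma abschar_3half : abschar (- (3 / 2)) (l%:R : F) = sqrtl ^+ 3.
Proof.
by rewrite /sqrtl 2!exprS expr1 -!abschar_add ?lF_neq0 //; congr abschar; field.
Qed.

End AbsChar.

Section PrincipalSeries.
Context {l : nat} {R : realType} {F : padicType l R}.
Hypothesis hl : prime l.
Variables nu1 nu2 rho : F -> R[i].
Hypothesis hc1 : is_char nu1.
Hypothesis hc2 : is_char nu2.
Hypothesis hc3 : is_char rho.
Notation PS := (principal_series nu1 nu2 rho).

Lemma GSp4_mul (g h : 'M[F]_4) : GSp4 g -> GSp4 h -> GSp4 (g *m h).
Proof.
move=> /GSp4P[m m0 hg] /GSp4P[n n0 hh]; apply/GSp4P; exists (m * n).
  by rewrite mulf_neq0.
exact: sp_mul.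
Qed.

Lemma GSp4_inv (g : 'M[F]_4) : GSp4 g -> GSp4 (invmx g).
Proof.
move=> hg; have gu : g \in unitmx by case/and3P: hg.
case/GSp4P: hg => m m0 hg; apply/GSp4P; exists m^-1; first by rewrite invr_eq0.
have -> : invmx g = sp_inv g m by rewrite -[LHS]mul1mx -(sp_invl m0 hg) -mulmxA mulmxV // mulmx1.
exact: sp_invP.
Qed.

Lemma GSp4_mulr (g h : 'M[F]_4) : GSp4 h -> GSp4 (g *m h) = GSp4 g.
Proof.
move=> hh; apply/idP/idP => gh; last exact: GSp4_mul.
have hu : h \in unitmx by case/and3P: hh.
by rewrite -(mulmxK hu g); apply: GSp4_mul => //; apply: GSp4_inv.
Qed.

Lemma PS_rtrans (g : 'M[F]_4) v : GSp4 g -> PS v -> PS (rtrans g v).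
Proof.
move=> hg [z s e]; split.
- by move=> h hh; rewrite /rtrans z // GSp4_mulr.
- apply: smooth_rtrans => //; first by case/and3P: hg.
  by move=> h hh; rewrite GSp4_mulr // GSp4_mul // GSp4_inv.
- move=> b h x y t hb hh ub ex ey et1 et2.
  by rewrite /rtrans -mulmxA (e _ _ x y t) // GSp4_mulr.
Qed.

Lemma PS_add a v1 v2 : PS v1 -> PS v2 -> PS (fun g => a * v1 g + v2 g).
Proof.
move=> [z1 s1 e1] [z2 s2 e2]; split.
- by move=> h hh; rewrite z1 // z2 // mulr0 addr0.
- exact: smooth_add.
- move=> b h x y t hb hh ub ex ey et1 et2.
  by rewrite (e1 _ _ x y t) // (e2 _ _ x y t) //; ring.
Qed.

Lemma PS0 : PS (fun=> 0).
Proof.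
split=> // [|*]; last by rewrite mulr0.
by rewrite /smooth_fun; near=> h.
Unshelve. all: by end_near. Qed.

Lemma PS_sum I (r : seq I) (v : I -> 'M[F]_4 -> R[i]) :
  (forall i, PS (v i)) -> PS (fun g => \sum_(i <- r) v i g).
Proof.
move=> h; elim: r => [|i r IH].
  by under eq_fun do rewrite big_nil; exact: PS0.
rewrite (_ : (fun g => _) = (fun g => 1 * v i g + \sum_(j <- r) v j g)).
  exact: PS_add.
by apply/funext => g; rewrite big_cons mul1r.
Qed.

(* the value of the inducing character, times the modulus factor, on upper *)
(* triangular matrices of diagonal (l^a, l^b, l^(c-b), l^(c-a)) *)
Definition ps_char (a b c : nat) : R[i] :=
  l%:R ^- (2 * a + b) * @sqrtl l R F ^+ (3 * c) *
  nu1 l%:R ^+ a * nu2 l%:R ^+ b * rho l%:R ^+ c.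

Lemma PS_borel v a b c p r s w t o (h : 'M[F]_4) : PS v -> (a <= c)%N -> (b <= c)%N -> GSp4 h ->
  sp (borel_mx a b c p r s w t o) (l%:R ^+ c) ->
  v (borel_mx a b c p r s w t o *m h) = ps_char a b c * v h.
Proof.
move=> [_ _ e] ac bc hh hb.
have l0 := @lF_neq0 l R F hl.
rewrite (e _ _ (l%:R ^+ a) (l%:R ^+ b) (l%:R ^+ c)) //.
- congr (_ * _); rewrite /ps_char.
  rewrite !(charX _ (abschar_is_char hl _)) ?charX //.
  have -> : abschar 1 ((l%:R ^+ a) ^+ 2 * l%:R ^+ b : F) = l%:R ^- (2 * a + b).
    rewrite -exprM mulnC -exprD (charX _ (abschar_is_char hl _)) // -[1]/(1%:R).
    by rewrite abschar_natl pabs_prime expr1 fmorphV rmorph_nat exprVn.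
  by rewrite abschar_3half // -exprM.
- by apply/GSp4P; exists (l%:R ^+ c); rewrite ?lX_neq0.
- by move=> -[[|[|[|[|?]]]] ?] [[|[|[|[|?]]]] ?] // _; rewrite mxE.
- by rewrite mxE.
- by rewrite mxE.
- by rewrite mxE /= -exprB // unitfE.
- by rewrite mxE /= -exprB // unitfE.
Qed.

Lemma hecke_eigen v (I : finType) (rep : I -> 'M[F]_4) (S : 'M[F]_4 -> Prop)
    (c : I -> R[i]) (g : 'M[F]_4) :
  PS v -> (forall k, Kg k -> rtrans k v = v) ->
  (forall i, S (rep i)) -> (forall k g, Kg k -> S g -> S (k *m g)) ->
  (forall g, S g -> exists i, exists2 k, Kg k & g = rep i *m k) ->
  (forall i j k, Kg k -> rep i = rep j *m k -> i = j) ->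
  (forall i, GSp4 (rep i)) -> (forall i, v (rep i) = c i * v 1%:M) ->
  \sum_i v (g *m rep i) = (\sum_i c i) * v g.
Proof.
move=> pv vK Srep KS cover inj sprep hc; have [z _ e] := pv.
have vK' h k : Kg k -> v (h *m k) = v h.
  by move=> hk; rewrite -[in RHS](vK k hk).
case hg : (GSp4 g); last first.
  rewrite z ?hg // mulr0 big1 // => i _.
  by rewrite z // GSp4_mulr ?hg.
have /GSp4P[m m0 sg] := hg.
have [k hk u] := iwasawa m0 sg.
have [k' hk' [kk' k'k]] := KgV hk.
move: u; move bE : (g *m k) => b ub.
have gb : g = b *m k' by rewrite -bE -mulmxA kk' mulmx1.
have gk : GSp4 k by case/and4P: (KgZ hk).
have gk' : GSp4 k' by case/and4P: (KgZ hk').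
have hb : GSp4 b by rewrite -bE; exact: GSp4_mul.
have /GSp4P[n n0 sb] := hb.
have d03 : b 0 0 * b 3 3 = n.
  have := sp_pr 0 3 sb; rewrite /pr !mxE /= mulr1 => <-.
  by rewrite (ub 1 0) // (ub 2 0) // (ub 3 0) //; ring.
have d12 : b 1 1 * b 2 2 = n.
  have := sp_pr 1 2 sb; rewrite /pr !mxE /= mulr1 => <-.
  by rewrite (ub 3 1) // (ub 2 1) // (ub 3 2) //; ring.
have nz0 : b 0 0 != 0 by apply: contraNneq n0 => E; rewrite -d03 E mul0r.
have nz1 : b 1 1 != 0 by apply: contraNneq n0 => E; rewrite -d12 E mul0r.
have E h : GSp4 h -> v (b *m h) = abschar 1 (b 0 0 ^+ 2 * b 1 1) *
    abschar (- (3 / 2)) n * nu1 (b 0 0) * nu2 (b 1 1) * rho n * v h.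
  move=> hh; apply: e => //; first by rewrite -d12 mulrC mulKf.
  by rewrite -d03 mulrC mulKf.
have vg : v g = v (b *m 1%:M) by rewrite mulmx1 gb vK'.
have g1 : GSp4 (1%:M : 'M[F]_4) by case/and4P: (KgZ (@Kg1 l R F)).
rewrite vg E // gb.
under eq_bigr => i _ do rewrite -mulmxA (E (k' *m rep i)) ?GSp4_mul //.
rewrite -mulr_sumr (coset_sum_invariant Srep KS cover inj vK' hk').
by under eq_bigr => i _ do rewrite hc; rewrite -mulr_suml; ring.
Qed.

End PrincipalSeries.

(** * Fourier transforms and Siegel sections *)

Section ComplexIntegral.
Context {R : realType} {d : measure_display} {T : measurableType d}.
Variable m : {measure set T -> \bar R}.
Variable D : set T.
Hypothesis mD : measurable D.

Lemma ReM (a b : R[i]) : complex.Re (a * b) =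
  complex.Re a * complex.Re b - complex.Im a * complex.Im b.
Proof. by case: a; case: b. Qed.

Lemma ImM (a b : R[i]) : complex.Im (a * b) =
  complex.Re a * complex.Im b + complex.Im a * complex.Re b.
Proof. by case: a; case: b. Qed.

Lemma ReD (a b : R[i]) : complex.Re (a + b) = complex.Re a + complex.Re b.
Proof. by case: a; case: b. Qed.

Lemma ImD (a b : R[i]) : complex.Im (a + b) = complex.Im a + complex.Im b.
Proof. by case: a; case: b. Qed.

Lemma integrable_scale (k : R) (f : T -> R) :
  m.-integrable D (EFin \o f) -> m.-integrable D (fun x => (k * f x)%:E).
Proof.
move=> h; rewrite (_ : (fun x => _) = (fun x => k%:E * (EFin \o f) x)%E); last first.
  by apply/funext => x; rewrite EFinM.
exact: integrableZl.
Qed.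

Lemma integrable_plus (f g : T -> R) :
  m.-integrable D (EFin \o f) -> m.-integrable D (EFin \o g) ->
  m.-integrable D (fun x => (f x + g x)%:E).
Proof.
move=> hf hg; rewrite (_ : (fun x => _) = ((EFin \o f) \+ (EFin \o g))%E) //.
exact: integrableD.
Qed.

Lemma cintegrableZ (c : R[i]) f :
  cintegrable m D f -> cintegrable m D (fun x => c * f x).
Proof.
move=> [h1 h2]; split.
  rewrite (_ : (fun x => _) = (fun x => (complex.Re c * complex.Re (f x) +
     (- complex.Im c) * complex.Im (f x))%:E)); last first.
    by apply/funext => x; rewrite ReM mulNr.
  by apply: integrable_plus; apply: integrable_scale.
rewrite (_ : (fun x => _) = (fun x => (complex.Re c * complex.Im (f x) +
     complex.Im c * complex.Re (f x))%:E)); last first.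
  by apply/funext => x; rewrite ImM.
by apply: integrable_plus; apply: integrable_scale.
Qed.

Lemma cintegralZ (c : R[i]) f : cintegrable m D f ->
  cintegral m D (fun x => c * f x) = c * cintegral m D f.
Proof.
move=> [h1 h2]; rewrite /cintegral; case: c => a b.
have -> : Rintegral m D (fun x => complex.Re ((a +i* b) * f x)) =
   a * Rintegral m D (fun x => complex.Re (f x)) - b * Rintegral m D (fun x => complex.Im (f x)).
  rewrite -!RintegralZl // -RintegralB //; last 2 first.
  - exact: integrable_scale.
  - exact: integrable_scale.
  by apply: eq_Rintegral => x _; rewrite ReM.
have -> : Rintegral m D (fun x => complex.Im ((a +i* b) * f x)) =
   a * Rintegral m D (fun x => complex.Im (f x)) + b * Rintegral m D (fun x => complex.Re (f x)).
  rewrite -!RintegralZl // -RintegralD //; last 2 first.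
  - exact: integrable_scale.
  - exact: integrable_scale.
  by apply: eq_Rintegral => x _; rewrite ImM.
by [].
Qed.

Lemma cintegrableD f g : cintegrable m D f -> cintegrable m D g ->
  cintegrable m D (fun x => f x + g x).
Proof.
move=> [h1 h2] [h3 h4]; split.
  rewrite (_ : (fun x => _) = (fun x => (complex.Re (f x) + complex.Re (g x))%:E)).
    exact: integrable_plus.
  by apply/funext => x; rewrite ReD.
rewrite (_ : (fun x => _) = (fun x => (complex.Im (f x) + complex.Im (g x))%:E)).
  exact: integrable_plus.
by apply/funext => x; rewrite ImD.
Qed.

Lemma cintegralD f g : cintegrable m D f -> cintegrable m D g ->
  cintegral m D (fun x => f x + g x) = cintegral m D f + cintegral m D g.
Proof.
move=> [h1 h2] [h3 h4]; rewrite /cintegral.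
have -> : Rintegral m D (fun x => complex.Re (f x + g x)) =
    Rintegral m D (fun x => complex.Re (f x) + complex.Re (g x)).
  by apply: eq_Rintegral => x _; exact: ReD.
have -> : Rintegral m D (fun x => complex.Im (f x + g x)) =
    Rintegral m D (fun x => complex.Im (f x) + complex.Im (g x)).
  by apply: eq_Rintegral => x _; exact: ImD.
by rewrite !RintegralD.
Qed.

Lemma eq_cintegral f g : {in D, f =1 g} -> cintegral m D f = cintegral m D g.
Proof. by move=> h; congr (_ +i* _); apply: eq_Rintegral => x xD; rewrite h. Qed.

Lemma eq_cintegrable f g : {in D, f =1 g} -> cintegrable m D f -> cintegrable m D g.
Proof.
by move=> h [h1 h2]; split; [apply: eq_integrable h1|apply: eq_integrable h2] => // x xD /=; rewrite h.
Qed.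

Variable tau : T -> T.
Hypothesis mtau : measurable_fun setT tau.
Hypothesis tau_pres : forall A, measurable A -> m (tau @^-1` A) = m A.
Hypothesis tauD : tau @^-1` D = D.

Lemma ge0_integral_preserve (f : T -> \bar R) : measurable_fun D f ->
  (forall y, 0 <= f y)%E ->
  (\int[m]_(x in D) f (tau x) = \int[m]_(x in D) f x)%E.
Proof.
move=> mf f0; rewrite -[in LHS]tauD -(ge0_integral_pushforward mtau) //.
by apply: eq_measure_integral => A mA _; exact: tau_pres.
Qed.

Lemma measurable_preserve d' (T' : measurableType d') (f : T -> T') :
  measurable_fun D f -> measurable_fun D (f \o tau).
Proof.
move=> mf _ A mA; rewrite comp_preimage -{1}tauD -preimage_setI.
by rewrite -[X in measurable X]setTI; apply: mtau => //; exact: mf.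
Qed.

Lemma integral_preserve (f : T -> \bar R) : measurable_fun D f ->
  (\int[m]_(x in D) f (tau x) = \int[m]_(x in D) f x)%E.
Proof.
move=> mf; rewrite integralE [RHS]integralE; congr (_ - _)%E.
  rewrite -[RHS]ge0_integral_preserve //; last exact: measurable_funepos.
  by apply: eq_integral => x _; rewrite funepos_comp.
rewrite -[RHS]ge0_integral_preserve //; last exact: measurable_funeneg.
by apply: eq_integral => x _; rewrite funeneg_comp.
Qed.

Lemma integrable_preserve (f : T -> \bar R) :
  m.-integrable D f -> m.-integrable D (f \o tau).
Proof.
move=> /integrableP[mf fi]; apply/integrableP; split; first exact: measurable_preserve.
rewrite (integral_preserve (f := fun x => `|f x|%E)) //.
exact: measurableT_comp.
Qed.

Lemma cintegrable_preserve f : cintegrable m D f -> cintegrable m D (f \o tau).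
Proof. by move=> [h1 h2]; split; [exact: (integrable_preserve h1)|exact: (integrable_preserve h2)]. Qed.

Lemma cintegral_preserve f : cintegrable m D f ->
  cintegral m D (f \o tau) = cintegral m D f.
Proof.
move=> [/integrableP[h1 _] /integrableP[h2 _]].
by rewrite /cintegral /Rintegral; congr (fine _ +i* fine _);
  [rewrite -(integral_preserve h1)|rewrite -(integral_preserve h2)].
Qed.

End ComplexIntegral.

Section PadicMeasure.
Context {l : nat} {R : realType} {F : padicType l R}.
Hypothesis hl : prime l.
Notation T := (padic_borel F).

Lemma open_measurable (A : set F) : open A -> measurable (A : set T).
Proof. by move=> oA; exact: sub_sigma_algebra. Qed.

Lemma near_close (x : F) (k : nat) : \forall y \near x, (y - x) / l%:R ^+ k \in Zl.
Proof. by apply/(nbhs_FP hl); exists k. Qed.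

Lemma near_pabs (x : F) : x != 0 -> \forall y \near x, pabs y = pabs x.
Proof.
move=> x0; apply/nbhs_pabs; exists (pabs x); first by rewrite pabs_gt0.
by move=> y /= h; rewrite -[y](subrK x) addrC pabs_addl.
Qed.

Lemma locconst_measurable (D : set F) d' (T' : measurableType d') (f : F -> T') :
  open D -> (forall x, D x -> \forall y \near x, f y = f x) ->
  measurable_fun (D : set T) (f : T -> T').
Proof.
move=> oD h _ A mA; apply: open_measurable.
rewrite openE => x [xD fx]; rewrite /interior.
have nD : nbhs x D by apply: open_nbhs_nbhs.
apply: filterS2 nD (h _ xD) => y yD e; split=> //.
by rewrite /preimage /= e.
Qed.

Lemma open_neq0 : open [set x : F | x != 0].
Proof.
rewrite openE => x /= x0; apply: filterS (near_pabs x0) => y /= e.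
by rewrite -pabs_gt0 e pabs_gt0.
Qed.

Lemma addl_measurable (a : F) : measurable_fun setT ((fun x => a + x) : T -> T).
Proof.
apply: (@measurability _ _ T T setT _ (@open F)) => //.
move=> _ [U oU <-]; rewrite setTI; apply: open_measurable.
rewrite openE => x /= Uax; rewrite /interior.
have : nbhs (a + x) U by apply: open_nbhs_nbhs.
move=> /(nbhs_FP hl)[k hk]; apply/(nbhs_FP hl); exists k => y hy.
by apply: hk; rewrite opprD addrACA subrr add0r.
Qed.

Lemma mull_measurable (a : F) : a != 0 -> measurable_fun setT ((fun x => a * x) : T -> T).
Proof.
move=> a0; apply: (@measurability _ _ T T setT _ (@open F)) => //.
move=> _ [U oU <-]; rewrite setTI; apply: open_measurable.
rewrite openE => x /= Uax; rewrite /interior.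
have : nbhs (a * x) U by apply: open_nbhs_nbhs.
move=> /nbhs_pabs[r r0 hr]; apply/nbhs_pabs.
exists (r / pabs a); first by rewrite divr_gt0 ?pabs_gt0.
move=> y /= hy; apply: hr => /=.
by rewrite -mulrBr pabsM mulrC -ltr_pdivlMr // pabs_gt0.
Qed.

Definition ball0 (b : F) : set F := [set x | pabs x <= pabs b].

Lemma ball0_open b : b != 0 -> open (ball0 b).
Proof.
move=> b0; rewrite openE => x xb; rewrite /interior.
apply/nbhs_pabs; exists (pabs b); first by rewrite pabs_gt0.
move=> y /= h; rewrite /ball0 /= -[y](subrK x) (le_trans (pabsD _ _)) //.
by rewrite ge_max ltW.
Qed.

Lemma ball0_measurable b : b != 0 -> measurable (ball0 b : set T).
Proof. by move=> b0; apply: open_measurable; exact: ball0_open. Qed.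

End PadicMeasure.

Section AdditiveCharacter.
Context {l : nat} {R : realType} {F : padicType l R}.
Hypothesis hl : prime l.
Variable e : F -> R[i].
Hypothesis he : is_std_addchar e.

Lemma addcharD x y : e (x + y) = e x * e y. Proof. by case: he. Qed.

Lemma addchar0 : e 0 = 1.
Proof. by case: he => _ h _; exact: (nbhs_singleton h). Qed.

Lemma addcharMn x n : e (x *+ n) = e x ^+ n.
Proof. by elim: n => [|n IH]; rewrite ?addchar0 // mulrS exprS addcharD IH. Qed.

Lemma addchar1 : e 1 = 1.
Proof.
case: he => _ _ /(_ 0%N); rewrite expr0 invr1 => ->.
by rewrite expr0 divr1 mulr_natl /cis cos2pi sin2pi.
Qed.

Lemma addchar_near : exists k : nat, forall x, x / l%:R ^+ k \in Zl -> e x = 1.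
Proof.
case: he => _ /(nbhs_FP hl)[k hk] _; exists k => x hx; apply: hk.
by rewrite subr0.
Qed.

Lemma addchar_Zl x : x \in Zl -> e x = 1.
Proof.
move=> hx; have [k hk] := addchar_near; have [u _ hu] := residueX hl k hx.
rewrite -[x](subrK u%:R) addcharD (hk _ hu) mul1r -[u%:R]mulr_natl mulr1.
by rewrite -[u%:R]/(1 *+ u) addcharMn addchar1 expr1n.
Qed.

Lemma addchar_inv_l : e (l%:R^-1) != 1.
Proof.
case: he => _ _ /(_ 1%N); rewrite !expr1 => ->.
apply/eqP => /(congr1 (@complex.Re R)) /= h.
have l2 : (2 : R) <= l%:R by rewrite ler_nat prime_gt1.
have l0 := @lgt0 l R hl.
have p0 := @pi_gt0 R.
have t0 : 0 < 2 * pi / l%:R :> R by rewrite divr_gt0 // mulr_gt0.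
have : cos (2 * pi / l%:R) < cos (0 : R).
  rewrite ltr_cos // in_itv /= ?lexx ?(ltW p0) // (ltW t0) /=.
  by rewrite ler_pdivrMr // mulrC ler_wpM2l // ltW.
by rewrite h cos0 ltxx.
Qed.

Lemma addchar_norm x : `|e x| = 1.
Proof.
have [n hn] : exists n : nat, l%:R ^+ n * x \in Zl.
  have [k hk] := integral_scale hl (const_mx x : 'M[F]_1).
  by exists k; have := hk 0 0; rewrite mxE.
have : `|e x| ^+ (l ^ n) == 1.
  by rewrite -normrX -addcharMn -mulr_natl natrX addchar_Zl // normr1.
by rewrite pexpr_eq1 ?normr_ge0 // ?expn_gt0 ?prime_gt0 // => /eqP.
Qed.

End AdditiveCharacter.

Lemma normc_ge_Im (R : realType) (z : R[i]) : (`|complex.Im z|)%:C <= `|z|.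
Proof. by rewrite normc_def lecR -sqrtr_sqr ler_wsqrtr // lerDr sqr_ge0. Qed.

Section Fourier.
Context {l : nat} {R : realType} {F : padicType l R}.
Hypothesis hl : prime l.
Variable mu : {measure set (padic_borel F) -> \bar R}.
Hypothesis hmu : is_haar_add mu.
Variable e : F -> R[i].
Hypothesis he : is_std_addchar e.
Notation T := (padic_borel F).

Lemma translate_preimage (a : F) (A : set F) :
  (fun x => a + x) @^-1` A = (fun x => - a + x) @` A.
Proof.
apply/seteqP; split=> [x /= h|x /= [y Ay <-]]; first by exists (a + x) => //; rewrite addKr.
by rewrite addNKr.
Qed.

Lemma haar_translate (a : F) (A : set T) : measurable A ->
  mu ((fun x => a + x) @^-1` A) = mu A.
Proof. by move=> mA; rewrite translate_preimage; case: hmu => _; apply. Qed.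

Lemma ball0_split n : ball0 (l%:R ^+ n : F) =
  \big[setU/set0]_(u < l) ((fun x => l%:R ^+ n * u%:R + x) @` ball0 (l%:R ^+ n.+1 : F)).
Proof.
have n0 := lX_neq0 (F := F) hl n.
rewrite -(bigcup_mkord l (fun u : nat =>
  (fun x => l%:R ^+ n * u%:R + x) @` ball0 (l%:R ^+ n.+1 : F))).
apply/seteqP; split=> [x hx|x].
  have [u [y [yZ E]]] : exists (u : 'I_l) x', x' \in Zl /\ x / l%:R ^+ n = u%:R + l%:R * x'.
    by apply: residueE => //; rewrite -pabs_le_div.
  exists (u : nat); first exact: ltn_ord.
  exists (x - l%:R ^+ n * u%:R); last by rewrite addrC subrK.
  rewrite /ball0 /= pabs_le_div ?lX_neq0 //.
  rewrite (_ : _ / _ = y) //; apply: (mulIf (lX_neq0 hl n.+1)); rewrite divfK ?lX_neq0 //.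
  by rewrite -[x in LHS](divfK n0) E exprS; ring.
move=> [u _ [y hy <-]].
rewrite /ball0 /= (le_trans (pabsD _ _)) // ge_max; apply/andP; split.
  by rewrite pabsM ler_piMr ?pabs_ge0 // -ZlE rpred_nat.
apply: le_trans hy _; rewrite exprS pabsM ler_piMl ?pabs_ge0 //.
exact: ltW (pabs_l_lt1 hl).
Qed.

Lemma mu_ball n : mu (ball0 (l%:R ^+ n : F)) = (l%:R ^- n)%:E.
Proof.
elim: n => [|n IH].
  have [h _] := hmu; rewrite expr0 invr1 -h; congr (mu _).
  by apply/seteqP; split=> x; rewrite /ball0 /= pabs1.
have mB : measurable (ball0 (l%:R ^+ n.+1 : F) : set T).
  by apply: ball0_measurable => //; rewrite lX_neq0.
have mI (u : 'I_l) : measurable (((fun x => l%:R ^+ n * u%:R + x) @` ball0 (l%:R ^+ n.+1 : F)) : set T).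
  rewrite -[l%:R ^+ n * u%:R]opprK -translate_preimage -[X in measurable X]setTI.
  exact: addl_measurable.
move: IH; rewrite ball0_split measure_bigsetU_ord //; last first.
  move=> u v _ _ [x [[y hy <-] [y' hy' E]]]; apply/ord_inj.
  apply: (nat_residue_inj (F := F) hl (n := 1)); rewrite ?expn1 // expr1.
  have -> : u%:R - v%:R = (y' - y) / l%:R ^+ n :> F.
    apply: (mulIf (lX_neq0 hl n)); rewrite divfK ?lX_neq0 //.
    have -> : y' - y = l%:R ^+ n * v%:R + y' - l%:R ^+ n * v%:R - y by ring.
    by rewrite E; ring.
  rewrite -mulrA -invfM -exprSr -pabs_le_div ?lX_neq0 //.
  by rewrite (le_trans (pabsD _ _)) // ge_max pabsN; apply/andP; split.
rewrite (eq_bigr (fun _ => mu (ball0 (l%:R ^+ n.+1 : F)))); last first.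
  by move=> u _; case: hmu => _; apply.
have [l0 lR] : l%:R != 0 :> R /\ (0 < l)%N by rewrite pnatr_eq0 -lt0n prime_gt0.
move=> h0; have fB : mu (ball0 (l%:R ^+ n.+1 : F)) \is a fin_num.
  rewrite ge0_fin_numE ?measure_ge0 // (@le_lt_trans _ _ (l%:R ^- n)%:E) ?ltry //.
  by rewrite -h0 (bigD1 (Ordinal lR)) //= leeDl // sume_ge0.
move: h0; rewrite -(fineK fB) sumEFin sumr_const card_ord => h0.
have h := EFin_inj h0; congr EFin; apply: (mulfI l0).
by rewrite mulr_natl h exprS invfM mulVKf.
Qed.

Lemma mem_ball0 (b x : F) : (x \in ball0 b) = (pabs x <= pabs b).
Proof. by apply/idP/idP => [/set_mem|h]; last exact: mem_set. Qed.

Definition ind0 (b v : F) : R[i] := ((pabs v <= pabs b)%R)%:R.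

Lemma addchar_ind_locconst (y b : F) : b != 0 ->
  forall x, \forall x' \near x, e (y * x') * ind0 b x' = e (y * x) * ind0 b x.
Proof.
move=> b0 x; have [k hk] := addchar_near hl he.
have [a ha] := integral_scale hl (const_mx y : 'M[F]_1).
have h1 := near_close hl x (k + a).
have h2 : \forall x' \near x, pabs (x' - x) < pabs b.
  by apply/nbhs_pabs; exists (pabs b); rewrite ?pabs_gt0.
apply: filterS2 h1 h2 => x' h1 h2; congr (_ * _).
  rewrite -[in LHS](subrK x x') mulrDr (addcharD he) hk ?mul1r //.
  have := ha 0 0; rewrite mxE => hy.
  have -> : y * (x' - x) / l%:R ^+ k = (l%:R ^+ a * y) * ((x' - x) / l%:R ^+ (k + a)).
    rewrite exprD; have := lX_neq0 (F := F) hl k; have := lX_neq0 (F := F) hl a.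
    by move: (l%:R ^+ k) (l%:R ^+ a) => K A A0 K0; field; rewrite K0 A0.
  by rewrite rpredM.
congr ((nat_of_bool _)%:R); apply/idP/idP => h.
  by rewrite -(subKr x' x) (le_trans (pabsD _ _)) // ge_max h pabsN ltW.
by rewrite -(subrK x x') (le_trans (pabsD _ _)) // ge_max h ltW.
Qed.

Lemma addchar_ind_integrable n (y : F) :
  cintegrable mu setT (fun v => e (y * v) * ind0 (l%:R ^+ n) v).
Proof.
have b0 := lX_neq0 (F := F) hl n.
have lc := addchar_ind_locconst y b0.
have mB := ball0_measurable b0.
have iB : mu.-integrable setT (EFin \o (\1_(ball0 (l%:R ^+ n : F)) : T -> R)).
  apply/integrableP; split; first exact/measurable_EFinP.
  rewrite (eq_integral (fun x : T => (\1_(ball0 (l%:R ^+ n : F)) x)%:E)).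
    by rewrite integral_indic // setIT mu_ball ltry.
  by move=> x _; rewrite /= ger0_norm // indicE ler0n.
have bound x : `|e (y * x) * ind0 (l%:R ^+ n) x| = ((\1_(ball0 (l%:R ^+ n : F)) x : R))%:C.
  rewrite normrM addchar_norm // mul1r /ind0 indicE mem_ball0 normr_nat.
  by case: (_ <= _); rewrite /= ?rmorph1 ?rmorph0.
split; apply: (le_integrable _ _ _ iB) => //.
- apply/measurable_EFinP; apply: locconst_measurable => //; first exact: openT.
  by move=> x _; apply: filterS (lc x) => x' ->.
- move=> x _; rewrite /= lee_fin [leRHS]ger0_norm ?indicE ?ler0n // -lecR -indicE -bound.
  exact: normc_ge_Re.
- apply/measurable_EFinP; apply: locconst_measurable => //; first exact: openT.
  by move=> x _; apply: filterS (lc x) => x' ->.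
- move=> x _; rewrite /= lee_fin [leRHS]ger0_norm ?indicE ?ler0n // -lecR -indicE -bound.
  exact: normc_ge_Im.
Qed.

Lemma addchar_ind_integral n (y : F) :
  cintegral mu setT (fun v => e (y * v) * ind0 (l%:R ^+ n) v) =
  (l%:R ^- n) * ((pabs (y * l%:R ^+ n) <= 1)%R)%:R.
Proof.
have int := addchar_ind_integrable n y.
have b0 := lX_neq0 (F := F) hl n.
case: (leP (pabs (y * l%:R ^+ n)) 1) => h.
  rewrite mulr1 /cintegral.
  have E v : e (y * v) * ind0 (l%:R ^+ n) v = ind0 (l%:R ^+ n) v.
    rewrite /ind0; case: (boolP (_ <= _)) => hv; last by rewrite mulr0.
    rewrite mulr1 (addchar_Zl hl he) // ZlE (le_trans _ h) // !pabsM.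
    by rewrite ler_wpM2l ?pabs_ge0.
  have mB := ball0_measurable b0.
  have -> : Rintegral mu setT (fun x => complex.Re (e (y * x) * ind0 (l%:R ^+ n) x)) = l%:R ^- n.
    rewrite /Rintegral (eq_integral (fun x : T => (\1_(ball0 (l%:R ^+ n : F)) x)%:E)).
      by rewrite integral_indic // setIT mu_ball.
    move=> x _; rewrite E /ind0 indicE mem_ball0.
    by case: (_ <= _).
  have -> : Rintegral mu setT (fun x => complex.Im (e (y * x) * ind0 (l%:R ^+ n) x)) = 0.
    rewrite /Rintegral (eq_integral (fun x : T => 0%E)) ?integral0 // => x _.
    by rewrite E /ind0; case: (_ <= _).
  by rewrite -[_ +i* 0]/((l%:R ^- n)%:C) fmorphV rmorphXn rmorph_nat.
rewrite mulr0.
have y0 : y != 0 by apply: contraTneq h => ->; rewrite mul0r pabs0 ltNge ler01.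
pose a := l%:R^-1 / y.
have ha : pabs a <= pabs (l%:R ^+ n : F).
  rewrite pabs_le_div // /a.
  have := @pabs_ltZ l R F hl 1 (y * l%:R ^+ n); rewrite mulf_neq0 // pabs1 => /(_ isT h).
  by rewrite mul1r !invfM !mulrA.
have E : (fun v => e (y * v) * ind0 (l%:R ^+ n) v) \o (fun v => a + v) =
   (fun v => e l%:R^-1 * (e (y * v) * ind0 (l%:R ^+ n) v)).
  apply/funext => v /=; rewrite mulrDr (addcharD he) -mulrA; congr (_ * (_ * _)).
    by rewrite /a mulrCA mulfV // mulr1.
  congr ((nat_of_bool _)%:R); apply/idP/idP => hv.
    by rewrite -[v](addKr a) (le_trans (pabsD _ _)) // ge_max pabsN ha.
  by rewrite (le_trans (pabsD _ _)) // ge_max ha.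
have := cintegral_preserve measurableT (addl_measurable hl a) (haar_translate a) (preimage_setT _) int.
rewrite E cintegralZ //; set I := cintegral _ _ _ => H.
have : (e l%:R^-1 - 1) * I = 0 by rewrite mulrBl mul1r H subrr.
move/eqP; rewrite mulf_eq0 subr_eq0 (negbTE (addchar_inv_l hl he)) => /eqP //.
Qed.

Definition lat (a b : F) (w : 'rV[F]_2) : R[i] :=
  ((pabs (w 0 0 * a) <= 1) && (pabs (w 0 1 * b) <= 1))%:R.

Lemma fourier_prod (phi : 'rV[F]_2 -> R[i]) (p p' : F -> R[i]) w :
  (forall u v, phi (rv2 u v) = p u * p' v) ->
  (forall y, cintegrable mu setT (fun v => e (y * v) * p v)) ->
  (forall y, cintegrable mu setT (fun v => e (y * v) * p' v)) ->
  fourier mu e phi w = cintegral mu setT (fun v => e (- w 0 1 * v) * p v) *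
     cintegral mu setT (fun v => e (w 0 0 * v) * p' v).
Proof.
move=> hphi hp hp'; rewrite /fourier.
have inner u : cintegral mu setT (fun v => e (w 0 0 * v - w 0 1 * u) * phi (rv2 u v)) =
   (cintegral mu setT (fun v => e (w 0 0 * v) * p' v)) * (e (- w 0 1 * u) * p u).
  rewrite [RHS]mulrC -cintegralZ //; apply: eq_cintegral => v _.
  by rewrite hphi (addcharD he) mulNr; ring.
under eq_fun do rewrite inner.
by rewrite cintegralZ // mulrC.
Qed.

Lemma fourier_phi0 : fourier mu e phi0 = lat 1 1.
Proof.
apply/funext => w; rewrite (fourier_prod (p := ind0 (l%:R ^+ 0)) (p' := ind0 (l%:R ^+ 0))).
- rewrite !addchar_ind_integral !expr0 invr1 !mul1r /lat !mulr1 pabsN.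
  by rewrite -natrM mulnb andbC.
- by move=> u v; rewrite /phi0 /rv2 !mxE /= /ind0 expr0 pabs1 -natrM mulnb.
- by move=> y; apply: addchar_ind_integrable.
- by move=> y; apply: addchar_ind_integrable.
Qed.

Lemma unit_ind (v : F) : ((pabs v == 1)%R)%:R = ind0 (l%:R ^+ 0) v - ind0 (l%:R ^+ 1) v.
Proof.
rewrite /ind0 expr0 expr1 pabs1; case: (ltrgtP (pabs v) 1) => h.
- suff -> : pabs v <= pabs (l%:R : F) by rewrite subrr.
  by rewrite pabs_le_div ?lF_neq0 //; apply: Zl_lt1.
- by rewrite leNgt (lt_trans (pabs_l_lt1 hl) h) subrr.
- by rewrite h leNgt (pabs_l_lt1 hl) subr0.
Qed.

Lemma fourier_phit (t : nat) : fourier mu e (phit t) =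
  fun w => l%:R ^- t * lat 1 (l%:R ^+ t) w - l%:R ^- t.+1 * lat l%:R (l%:R ^+ t) w.
Proof.
have iU y : cintegrable mu setT (fun v => e (y * v) * ((pabs v == 1)%R)%:R).
  apply: (@eq_cintegrable _ _ _ mu setT measurableT (fun v => e (y * v) * ind0 (l%:R ^+ 0) v +
     (-1) * (e (y * v) * ind0 (l%:R ^+ 1) v))).
    by move=> v _; rewrite unit_ind; ring.
  apply: cintegrableD => //; first exact: addchar_ind_integrable.
  by apply: cintegrableZ => //; exact: addchar_ind_integrable.
apply/funext => w; rewrite (fourier_prod (p := ind0 (l%:R ^+ t)) (p' := fun v => ((pabs v == 1)%R)%:R)) //.
- rewrite addchar_ind_integral.
  rewrite (@eq_cintegral _ _ T mu setT _ (fun v : T => e (w 0 0 * v) * ind0 (l%:R ^+ 0) v +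
     (-1) * (e (w 0 0 * v) * ind0 (l%:R ^+ 1) v))); last first.
    by move=> v _; rewrite unit_ind; ring.
  rewrite cintegralD //; last 2 first.
  - exact: addchar_ind_integrable.
  - by apply: cintegrableZ => //; exact: addchar_ind_integrable.
  rewrite cintegralZ ?addchar_ind_integral //; last exact: addchar_ind_integrable.
  rewrite !expr0 invr1 mul1r !expr1 /lat !mulr1 mulNr pabsN.
  rewrite exprSr invfM -!mulnb !natrM.
  by ring.
- move=> u v; rewrite /phit /rv2 !mxE /= /ind0 pabs_lX -natrM mulnb //.
- by move=> y; apply: addchar_ind_integrable.
Qed.

End Fourier.

Section ComplexPower.
Context {R : realType}.
Implicit Types (a b : R) (s t : R[i]).

Lemma cisD (x y : R) : cis (x + y) = cis x * cis y.
Proof. by rewrite /cis cosD sinD; apply/eqP; rewrite eq_complex /= eqxx addrC eqxx. Qed.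

Lemma cis0 : cis (0 : R) = 1. Proof. by rewrite /cis cos0 sin0. Qed.

Lemma cpowM a b s : 0 < a -> 0 < b -> cpow (a * b) s = cpow a s * cpow b s.
Proof.
move=> a0 b0; rewrite /cpow powRM ?ltW // lnM ?posrE // mulrDr cisD rmorphM /=.
by rewrite mulrACA.
Qed.

Lemma cpowD a s t : 0 < a -> cpow a (s + t) = cpow a s * cpow a t.
Proof.
move=> a0; rewrite /cpow ReD ImD powRD; last by rewrite (gt_eqF a0) implybT.
by rewrite [X in cis X]mulrDl cisD rmorphM mulrACA.
Qed.

Lemma cpow0 a : 0 < a -> cpow a 0 = 1.
Proof. by move=> a0; rewrite /cpow /= powRr0 mul0r cis0 mulr1. Qed.

Lemma cpow_neq0 a s : 0 < a -> cpow a s != 0.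
Proof.
move=> a0; apply/eqP => h; have := cpowD s (- s) a0.
by rewrite subrr cpow0 // h mul0r => /eqP; rewrite oner_eq0.
Qed.

Lemma cpowN a s : 0 < a -> cpow a (- s) = (cpow a s)^-1.
Proof.
move=> a0; apply: (mulfI (cpow_neq0 s a0)).
by rewrite -cpowD // subrr cpow0 // divff ?cpow_neq0.
Qed.

Lemma cpow_real a (r : R) : 0 < a -> cpow a r%:C = (a `^ r)%:C.
Proof. by move=> a0; rewrite /cpow /= mul0r cis0 mulr1. Qed.

Lemma cpow1l s : cpow 1 s = 1.
Proof. by rewrite /cpow powR1 ln1 mulr0 cis0 mul1r. Qed.

Lemma cpowV a s : 0 < a -> cpow a^-1 s = (cpow a s)^-1.
Proof.
move=> a0; apply: (mulfI (cpow_neq0 s a0)).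
by rewrite -cpowM ?invr_gt0 // divff ?gt_eqF // cpow1l divff ?cpow_neq0.
Qed.

Lemma cpowX a s n : 0 < a -> cpow (a ^+ n) s = cpow a s ^+ n.
Proof.
move=> a0; elim: n => [|n IH]; first by rewrite cpow1l.
by rewrite !exprS cpowM ?exprn_gt0 // IH.
Qed.

Lemma cpowXz a s (n : int) : 0 < a -> cpow (a ^ n) s = cpow a s ^ n.
Proof.
move=> a0; case: n => n; first by rewrite -!exprnP cpowX.
by rewrite NegzE -!exprnN cpowV ?exprn_gt0 // cpowX.
Qed.

Lemma norm_cis (x : R) : `|cis x| = 1.
Proof. by rewrite normc_def /cis /= cos2Dsin2 sqrtr1. Qed.

Lemma norm_cpow a s : 0 < a -> `|cpow a s| = (a `^ complex.Re s)%:C.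
Proof.
move=> a0; rewrite /cpow normrM norm_cis mulr1 ger0_norm // ler0c.
exact: powR_ge0.
Qed.

End ComplexPower.

Section Zeta.
Context {l : nat} {R : realType} {F : padicType l R}.
Hypothesis hl : prime l.
Variable nu : {measure set (padic_borel F) -> \bar R}.
Hypothesis hnu : is_haar_mul nu.
Notation T := (padic_borel F).
Notation D0 := ([set x : F | x != 0] : set T).

Lemma D0_measurable : measurable D0.
Proof. by apply: open_measurable; exact: open_neq0. Qed.

Lemma dilate_preimage (a : F) (A : set F) : a != 0 ->
  (fun x => a * x) @^-1` A = (fun x => a^-1 * x) @` A.
Proof.
move=> a0; apply/seteqP; split=> [x /= h|x /= [y Ay <-]]; first by exists (a * x) => //; rewrite mulKf.
by rewrite mulVKf.
Qed.

Lemma haar_dilate (a : F) (A : set T) : a != 0 -> measurable A ->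
  nu ((fun x => a * x) @^-1` A) = nu A.
Proof.
move=> a0 mA; rewrite dilate_preimage //; case: hnu => _ _; apply=> //.
by rewrite invr_eq0.
Qed.

Lemma dilate_D0 (a : F) : a != 0 -> (fun x => a * x) @^-1` D0 = D0.
Proof. by move=> a0; apply/seteqP; split=> x /=; rewrite mulf_eq0 (negbTE a0). Qed.

Variable h : F -> R[i].
Hypothesis hM : forall x y, x != 0 -> y != 0 -> h (x * y) = h x * h y.
Hypothesis hu : unramified h.
Hypothesis hlt : `|h l%:R| < 1.

Let l0 : l%:R != 0 :> F := lF_neq0 hl.

Lemma h1 : h 1 = 1. Proof. by apply: hu; rewrite pabs1. Qed.

Lemma hV x : x != 0 -> h x * h x^-1 = 1.
Proof. by move=> x0; rewrite -hM ?invr_eq0 // divff // h1. Qed.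

Lemma h_neq0 x : x != 0 -> h x != 0.
Proof. by move=> x0; apply/eqP => e; have := hV x0; rewrite e mul0r => /esym/eqP; rewrite oner_eq0. Qed.

Lemma h_locconst x : x != 0 -> \forall y \near x, h y = h x.
Proof.
move=> x0; apply: filterS (near_pabs x0) => y e.
have y0 : y != 0 by rewrite -pabs_gt0 e pabs_gt0.
rewrite -[y](mulVKf x0) hM ?mulf_neq0 ?invr_eq0 // [h (_ * _)]hu ?mulr1 //.
by rewrite pabsM pabsV e mulVf // pabs_eq0.
Qed.

Lemma h_pow n : h (l%:R ^+ n) = h l%:R ^+ n.
Proof.
elim: n => [|n IH]; first by rewrite h1.
by rewrite !exprS hM ?IH // lX_neq0.
Qed.

Definition zf (c x : F) : R[i] := ((pabs (x * c) <= 1)%R)%:R * h x.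

Lemma zf_locconst c x : c != 0 -> x != 0 -> \forall y \near x, zf c y = zf c x.
Proof.
move=> c0 x0; apply: filterS2 (h_locconst x0) (near_pabs x0) => y e1 e2.
by rewrite /zf e1 !pabsM e2.
Qed.

Let r x : R := complex.Re `|h x|.

Lemma rE x : (r x)%:C = `|h x|.
Proof. by rewrite /r normc_def. Qed.

Let shell n : set F := [set x | pabs x = pabs (l%:R ^+ n : F)].

Lemma shell_open n : open (shell n).
Proof.
rewrite openE => x /= e; rewrite /interior.
have x0 : x != 0 by rewrite -pabs_gt0 e pabs_gt0 lX_neq0.
by apply: filterS (near_pabs x0) => y ey; rewrite /shell /= ey.
Qed.

Lemma shell_measurable n : measurable (shell n : set T).
Proof. by apply: open_measurable; exact: shell_open. Qed.

Lemma nu_shell n : nu (shell n) = 1%E.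
Proof.
case: hnu => _ h' _; rewrite -h' -(haar_dilate (a := l%:R ^- n) (A := [set x : F | pabs x = 1])).
- congr (nu _); apply/seteqP; split=> x /=; rewrite /shell /= pabsM pabsV.
    by move=> ->; rewrite mulVf // pabs_eq0 lX_neq0.
  by move=> e; rewrite -[LHS]mul1r -(divff (x := pabs (l%:R ^+ n : F))) ?pabs_eq0 ?lX_neq0 // -mulrA e mulr1.
- by rewrite invr_eq0 lX_neq0.
- have -> : [set x : F | pabs x = 1] = shell 0 by apply/seteqP; split=> x; rewrite /shell /= pabs1.
  exact: shell_measurable.
Qed.

Let E0 : set F := [set x | x != 0 /\ pabs x <= 1].

Lemma E0_shells : E0 = \bigcup_n shell n.
Proof.
apply/seteqP; split=> [x [x0 x1]|x [n _ e]].
  have [n [u [hu' e]]] := Zl_unit_decomp hl x0 x1; exists n => //.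
  by rewrite /shell /= e pabsM hu' mulr1.
rewrite /E0 /= -pabs_gt0 e pabs_gt0 lX_neq0 //; split=> //.
by rewrite -ZlE rpredX // l_Zl.
Qed.

Lemma r_integral_fin : (\int[nu]_(x in E0) (r x)%:E < +oo)%E.
Proof.
have mr : measurable_fun (E0 : set T) (EFin \o r : T -> \bar R).
  apply/measurable_EFinP; apply: locconst_measurable => //.
    by rewrite E0_shells; apply: bigcup_open => n _; exact: shell_open.
  by move=> x [x0 _]; apply: filterS (h_locconst x0) => y; rewrite /r => ->.
have r0 x : 0 <= r x by rewrite -ler0c rE.
have tr : trivIset setT shell.
  move=> i j _ _ [x [ei ej]]; move: ei; rewrite /shell /= ej !pabs_lX => /invr_inj.
  by move=> /(@ieexprIn R l%:R) -> //; rewrite ?lgt0 // gt_eqF // lge1.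
rewrite E0_shells ge0_integral_bigcup //; first last.
- by move=> x _; rewrite lee_fin.
- by rewrite -E0_shells.
- exact: shell_measurable.
have rl : 0 <= r l%:R < 1 by rewrite r0 -ltcR rE.
apply: (@le_lt_trans _ _ ((1 - r l%:R)^-1)%:E); last exact: ltry.
apply: lime_le; first by apply: is_cvg_nneseries => n _ _; apply: integral_ge0 => x _; rewrite lee_fin.
near=> n.
rewrite (eq_bigr (fun k => (r l%:R ^+ k)%:E)); last first.
  move=> k _; rewrite (eq_integral (cst ((r l%:R ^+ k)%:E))).
    by rewrite integral_cst ?nu_shell ?mule1 //; exact: shell_measurable.
  move=> x /set_mem; rewrite /shell /= => e; congr EFin.
  apply: complexI; rewrite rmorphXn /= !rE -normrX -h_pow.
  have x0 : x != 0 by rewrite -pabs_gt0 e pabs_gt0 lX_neq0.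
  rewrite -[x in LHS](mulVKf (lX_neq0 hl k)) hM ?lX_neq0 ?mulf_neq0 ?invr_eq0 ?lX_neq0 //.
  by rewrite [h (_ * x)]hu ?mulr1 // pabsM pabsV e mulVf // pabs_eq0 lX_neq0.
rewrite sumEFin lee_fin; case/andP: rl => rl0 rl1.
rewrite -[leRHS]mul1r ler_pdivlMr ?subr_gt0 // mulrC -[1 - _]opprB mulNr big_mkord -subrX1 opprB.
by rewrite gerBl exprn_ge0.
Unshelve. all: by end_near. Qed.

Lemma zf1_integrable : cintegrable nu D0 (zf 1).
Proof.
have mD0 := D0_measurable.
have mE0 : measurable (E0 : set T).
  by rewrite E0_shells; apply: bigcup_measurable => n _; exact: shell_measurable.
have ig : nu.-integrable D0 (EFin \o (fun x => ((pabs x <= 1)%R)%:R * r x)).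
  apply/integrableP; split.
    apply/measurable_EFinP; apply: locconst_measurable; first exact: open_neq0.
    move=> x x0; apply: filterS2 (h_locconst x0) (near_pabs x0) => y e1 e2.
    by rewrite /r e1 e2.
  have r0 x : 0 <= r x by rewrite -ler0c rE.
  rewrite (eq_integral (fun x : T => (((fun y : T => (r y)%:E) : T -> \bar R) \_ (E0 : set T)) x)).
    rewrite -integral_mkcondr (_ : D0 `&` E0 = E0) ?r_integral_fin //.
    by apply/seteqP; split=> x; [case|move=> hx; split=> //; case: hx].
  move=> x /set_mem /= x0; rewrite patchE ger0_norm ?mulr_ge0 //.
  case: ifPn => [/set_mem [_ ->]|]; first by rewrite mul1r.
  case: (boolP (_ <= _)) => hx; rewrite ?mul0r //.
  by rewrite (mem_set (_ : E0 x)).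
have bound x : x != 0 -> `|zf 1 x| = (((pabs x <= 1)%R)%:R * r x)%:C.
  by move=> x0; rewrite /zf normrM normr_nat mulr1 rmorphM /= rE rmorph_nat.
have mz : forall x, D0 x -> \forall y \near x, zf 1 y = zf 1 x.
  by move=> x x0; apply: zf_locconst => //; rewrite oner_eq0.
have rg0 x : 0 <= ((pabs x <= 1)%R)%:R * r x by rewrite mulr_ge0 // -ler0c rE.
split; apply: (le_integrable mD0 _ _ ig).
- apply/measurable_EFinP; apply: locconst_measurable; first exact: open_neq0.
  by move=> x x0; apply: filterS (mz x x0) => y ->.
- move=> x x0; rewrite /= lee_fin [leRHS]ger0_norm // -lecR -bound //.
  exact: normc_ge_Re.
- apply/measurable_EFinP; apply: locconst_measurable; first exact: open_neq0.
  by move=> x x0; apply: filterS (mz x x0) => y ->.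
- move=> x x0; rewrite /= lee_fin [leRHS]ger0_norm // -lecR -bound //.
  exact: normc_ge_Im.
Qed.

Lemma zf_dilate c x : c != 0 -> x != 0 -> zf c x = h c^-1 * zf 1 (c * x).
Proof.
move=> c0 x0; rewrite /zf mulr1 [c * x]mulrC hM // -[LHS]mulr1 -(hV c0).
by ring.
Qed.

Lemma zf_integrable c : c != 0 -> cintegrable nu D0 (zf c).
Proof.
move=> c0; apply: (eq_cintegrable D0_measurable (f := fun x => h c^-1 * (zf 1 \o (fun x => c * x)) x)).
  by move=> x /set_mem x0; rewrite [RHS]zf_dilate.
apply: cintegrableZ; first exact: D0_measurable.
apply: cintegrable_preserve zf1_integrable.
- exact: D0_measurable.
- exact: mull_measurable.
- by move=> A; apply: haar_dilate.
- exact: dilate_D0.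
Qed.

Lemma zf_integral_scale c : c != 0 ->
  cintegral nu D0 (zf c) = h c^-1 * cintegral nu D0 (zf 1).
Proof.
move=> c0; have mD0 := D0_measurable.
have pres := cintegral_preserve mD0 (mull_measurable c0)
  (fun A => haar_dilate (A := A) c0) (dilate_D0 c0) zf1_integrable.
rewrite -pres -cintegralZ //; last first.
  apply: cintegrable_preserve zf1_integrable => //.
  - exact: mull_measurable.
  - by move=> A; apply: haar_dilate.
  - exact: dilate_D0.
by apply: eq_cintegral => x /set_mem x0; rewrite zf_dilate.
Qed.

Lemma zf1_integral : cintegral nu D0 (zf 1) = (1 - h l%:R)^-1.
Proof.
have mD0 := D0_measurable.
have lV0 : l%:R^-1 != 0 :> F by rewrite invr_eq0.
set I := cintegral _ _ _.
have hi : cintegral nu D0 (zf l%:R^-1) = h l%:R * I.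
  by rewrite zf_integral_scale // invrK.
have hs : cintegral nu D0 (fun x => zf 1 x + (-1) * zf l%:R^-1 x) = I - h l%:R * I.
  rewrite cintegralD //; first by rewrite cintegralZ ?hi ?mulN1r //; exact: zf_integrable.
  - exact: zf1_integrable.
  - by apply: cintegrableZ => //; exact: zf_integrable.
have h1' : cintegral nu D0 (fun x => zf 1 x + (-1) * zf l%:R^-1 x) = 1.
  rewrite (@eq_cintegral _ _ T nu D0 _ (fun x : T => (((\1_(shell 0) x : R))%:C))).
    rewrite /cintegral /Rintegral /=.
    rewrite integral0 /= integral_indic //; last exact: shell_measurable.
    rewrite (_ : _ `&` D0 = shell 0) ?nu_shell //.
    apply/seteqP; split=> x; first by case.
    by move=> e; split=> //; rewrite /= -pabs_gt0 e pabs_gt0 lX_neq0.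
  move=> x /set_mem /= x0; rewrite /zf mulr1 indicE.
  have -> : (pabs (x / l%:R) <= 1) = (pabs x < 1).
    apply/idP/idP => [|hx]; last exact: Zl_lt1.
    by rewrite -ZlE -pabs_le_div // => hx; rewrite (le_lt_trans hx) // pabs_l_lt1.
  have -> : (x \in shell 0) = (pabs x == 1).
    by apply/idP/eqP => [/set_mem|hx]; [rewrite /shell /= pabs1|apply/mem_set; rewrite /shell /= pabs1].
  case: (ltrgtP (pabs x) 1) => hx /=.
  - by rewrite mulN1r subrr.
  - by rewrite !mul0r mulr0 addr0.
  - by rewrite mul0r mulr0 addr0 mul1r hu.
have hl1 : 1 - h l%:R != 0.
  by rewrite subr_eq0; apply: contraTneq hlt => <-; rewrite normr1 ltxx.
apply: (mulfI hl1); rewrite divff // mulrBl mul1r -hs h1' //.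
Qed.

Lemma zf_integral c : c != 0 ->
  cintegral nu D0 (zf c) = (h c)^-1 / (1 - h l%:R).
Proof.
move=> c0; rewrite zf_integral_scale // zf1_integral; congr (_ * _).
by apply: (mulfI (h_neq0 c0)); rewrite hV // divff // h_neq0.
Qed.

End Zeta.

Lemma int_shift (k : int) (m : nat) : (absz k <= m)%N -> exists n : nat, n%:Z = k + m%:Z.
Proof. by move=> h; exists (absz (k + m%:Z)); lia. Qed.

Section Siegel.
Context {l : nat} {R : realType} {F : padicType l R}.
Hypothesis hl : prime l.
Variable nu : {measure set (padic_borel F) -> \bar R}.
Hypothesis hnu : is_haar_mul nu.
Variables chi psi : F -> R[i].
Hypothesis hchi : is_char chi.
Hypothesis hpsi : is_char psi.
Hypothesis uchi : unramified chi.
Hypothesis upsi : unramified psi.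
Implicit Types (x y : F) (g : 'M[F]_2) (s : R[i]).
Notation T := (padic_borel F).
Notation D0 := ([set x : F | x != 0] : set T).

(* a generator of the ideal (x, y) *)
Definition rmax x y : F := if pabs x <= pabs y then y else x.

Lemma rmax_le x u v :
  (pabs (x * u) <= 1) && (pabs (x * v) <= 1) = (pabs (x * rmax u v) <= 1).
Proof.
rewrite /rmax; case: (leP (pabs u) (pabs v)) => uv.
  apply/andP/idP => [[]//|h]; split=> //; apply: le_trans h.
  by rewrite !pabsM ler_wpM2l ?pabs_ge0.
apply/andP/idP => [[]//|h]; split=> //; apply: le_trans h.
by rewrite !pabsM ler_wpM2l ?pabs_ge0 // ltW.
Qed.

Lemma rmax_neq0 x y : (x != 0) || (y != 0) -> rmax x y != 0.
Proof.
rewrite /rmax; case: leP => xy; last by rewrite -pabs_gt0 (le_lt_trans (pabs_ge0 y) xy).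
case/orP => // x0; rewrite -pabs_gt0; apply: lt_le_trans xy; by rewrite pabs_gt0.
Qed.

Lemma rmax_pabs x y : pabs (rmax x y) = Num.max (pabs x) (pabs y).
Proof. by rewrite /rmax; case: leP. Qed.

Lemma GL2_row g : GL2 g -> (g 1 0 != 0) || (g 1 1 != 0).
Proof.
rewrite /GL2 unitmxE unitfE; apply: contraR; rewrite negb_or !negbK => /andP[/eqP h0 /eqP h1].
by rewrite det2 h0 h1 !mulr0 subrr.
Qed.

Definition quot_char s x : R[i] := chi x / psi x * cpow (pabs x) (2 * s + 1).

Lemma quot_charM s x y : x != 0 -> y != 0 ->
  quot_char s (x * y) = quot_char s x * quot_char s y.
Proof.
move=> x0 y0; rewrite /quot_char pabsM cpowM ?pabs_gt0 //.
case: hchi => _ -> // _; case: (hpsi) => _ -> // _.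
by rewrite invfM; ring.
Qed.

Lemma quot_char_unramified s : unramified (quot_char s).
Proof. by move=> u hu; rewrite /quot_char uchi // upsi // hu cpow1l divr1 mulr1. Qed.

Lemma quot_char_l_lt1 : exists s0 : R, forall s, s0 < complex.Re s -> `|quot_char s l%:R| < 1.
Proof.
pose C : R := complex.Re `|chi l%:R / psi l%:R|.
have CE : `|chi l%:R / psi l%:R| = C%:C by rewrite /C normc_def.
have C0 : 0 <= C by rewrite -ler0c -CE.
have l0 := @lgt0 l R hl; have l1 := @lge1 l R hl.
have ll : 0 < ln (l%:R : R) by rewrite ln_gt0.
exists (ln (C + 1) / (2 * ln l%:R)) => s hs.
rewrite /quot_char normrM CE pabs_prime norm_cpow ?invr_gt0 // -rmorphM [X in _ < X](_ : 1 = 1%:C) ?ltcR //.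
rewrite -powR_inv1 ?ler0n // -powRrM mulN1r powRN.
rewrite ltr_pdivrMr ?powR_gt0 // mul1r.
apply: (@lt_le_trans _ _ (C + 1)); first by rewrite ltrDl.
have C1 : 0 < C + 1 by rewrite (le_lt_trans C0) // ltrDl.
rewrite -[C + 1]lnK ?posrE // /powR gt_eqF // ler_expR.
have -> : complex.Re (2 * s + 1) = 2 * complex.Re s + 1.
  by case: (s) => a b; rewrite /=; ring.
move: hs; rewrite ltr_pdivrMr ?mulr_gt0 // => hs.
apply: (le_trans (ltW hs)).
have -> : (2 * complex.Re s + 1) * ln (l%:R : R) = complex.Re s * (2 * ln l%:R) + ln l%:R by ring.
by rewrite lerDl ltW.
Qed.

Lemma siegel_value_unique phi g c c' :
  siegel_value nu phi chi psi g c -> siegel_value nu phi chi psi g c' -> c = c'.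
Proof.
move=> [P [m [s0 [h ->]]]] [P' [m' [s0' [h' ->]]]].
suff E : P * 'X^m' = P' * 'X^m.
  have := congr1 (fun p : {poly R[i]} => p.[1]) E.
  by rewrite /= !hornerM !hornerXn !expr1n !mulr1.
apply/eqP; rewrite -subr_eq0; apply/negPn/negP => D0'.
set D := _ - _ in D0'.
have l0 := @lgt0 l R hl; have l1 := @lge1 l R hl.
pose S := Num.max s0 s0'.
pose t (n : nat) : R := S + n.+1%:R.
have root n : root D (cpow l%:R (t n)%:C).
  have ht : S < t n by rewrite ltrDl ltr0n.
  have hs : s0 < complex.Re (t n)%:C by rewrite /= (le_lt_trans _ ht) // le_max lexx.
  have hs' : s0' < complex.Re (t n)%:C by rewrite /= (le_lt_trans _ ht) // le_max lexx orbT.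
  have [_ e1] := h _ hs; have [_ e2] := h' _ hs'.
  apply/rootP; rewrite /D hornerD hornerN !hornerM !hornerXn.
  have X0 : cpow (l%:R : R) (t n)%:C != 0 by apply: cpow_neq0.
  move: e1; rewrite e2 => e.
  apply/eqP; rewrite subr_eq0; apply/eqP.
  have := congr1 (fun w : R[i] => w * cpow l%:R (t n)%:C ^+ m' * cpow l%:R (t n)%:C ^+ m) e.
  by rewrite /= divfK ?expf_neq0 // mulrAC divfK ?expf_neq0 // => <-.
have := @max_poly_roots _ D [seq cpow l%:R (t n)%:C | n <- iota 0 (size D)] D0'.
rewrite size_map size_iota ltnn => H.
suff : false by [].
apply: H; first by apply/allP => x /mapP[n _ ->]; exact: root.
rewrite map_inj_uniq ?iota_uniq // => n n'.
rewrite !cpow_real // => /complexI.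
rewrite /powR gt_eqF // => /expR_inj /mulIf.
have -> : ln (l%:R : R) != 0 by rewrite gt_eqF // ln_gt0.
by move=> /(_ isT) /addrI /eqP; rewrite eqr_nat eqSS => /eqP.
Qed.

Lemma siegel_valueE phi g c : GL2 g ->
  siegel_value nu phi chi psi g c -> siegel nu phi chi psi g = c.
Proof.
move=> hg hc; rewrite /siegel hg; apply: xget_unique => // c' hc'.
exact: siegel_value_unique hc' hc.
Qed.

Definition eta x : R[i] := chi x / psi x * abschar 1 x.

Lemma pabs_cpow (r : R) x : x != 0 -> cpow (pabs x) r%:C = abschar r x.
Proof. by move=> x0; rewrite cpow_real ?pabs_gt0. Qed.

Lemma siegel_lat (A B : R[i]) a b a' b' g :
  a != 0 -> b != 0 -> a' != 0 -> b' != 0 -> GL2 g ->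
  siegel nu (fun w => A * lat a b w + B * lat a' b' w) chi psi g =
  chi (\det g) * abschar 2^-1 (\det g) *
  (A / eta (rmax (g 1 0 * a) (g 1 1 * b)) + B / eta (rmax (g 1 0 * a') (g 1 1 * b'))).
Proof.
move=> a0 b0 a0' b0' hg; apply: siegel_valueE => //.
have mD0 : measurable D0 by apply: open_measurable; exact: open_neq0.
have y0 c d : c != 0 -> d != 0 -> rmax (g 1 0 * c) (g 1 1 * d) != 0.
  move=> c0 d0; apply: rmax_neq0; rewrite !mulf_eq0 (negbTE c0) (negbTE d0) !orbF.
  exact: GL2_row.
set y := rmax (g 1 0 * a) _; set y' := rmax (g 1 0 * a') _.
have {}ya : y != 0 by exact: y0.
have {}yb : y' != 0 by exact: y0.
have latE x c d : lat c d (rv2 0 x *m g) = ((pabs (x * rmax (g 1 0 * c) (g 1 1 * d)) <= 1)%R)%:R :> R[i].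
  rewrite -rmax_le /lat !mxE !big_ord_recl !big_ord0 !mxE /=.
  have -> : lift ord0 ord0 = 1 :> 'I_2 by apply: val_inj.
  by rewrite !mul0r !add0r !addr0 !mulrA.
have [s0 hs0] := quot_char_l_lt1.
have dg : \det g != 0 by move: hg; rewrite /GL2 unitmxE unitfE.
have [n [u [hu en]]] := unit_decomp hl ya.
have [n' [u' [hu' en']]] := unit_decomp hl yb.
have [d [v [hv ed]]] := unit_decomp hl dg.
have l0 := @lgt0 l R hl.
have pabsE (k : int) w x : x = l%:R ^ k * w -> pabs w = 1 -> pabs x = (l%:R : R) ^ (- k).
  by move=> -> hw; rewrite pabsM hw mulr1 pabs_lXz.
have py := pabsE _ _ _ en hu; have py' := pabsE _ _ _ en' hu'; have pd := pabsE _ _ _ ed hv.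
pose k1 : int := 2 * n - d; pose k2 : int := 2 * n' - d.
pose m := (absz k1 + absz k2)%N.
have [m1 hm1] : exists m1 : nat, m1%:Z = k1 + m%:Z by apply: int_shift; exact: leq_addr.
have [m2 hm2] : exists m2 : nat, m2%:Z = k2 + m%:Z by apply: int_shift; exact: leq_addl.
pose K := chi (\det g) * abschar 2^-1 (\det g).
exists ((K * (A / eta y))%:P * 'X^m1 + (K * (B / eta y'))%:P * 'X^m2), m, s0; split; last first.
  by rewrite hornerD !hornerM !hornerC !hornerXn !expr1n !mulr1 /K; ring.
move=> s hs.
have qlt := hs0 s hs.
have qM := quot_charM s; have qu := quot_char_unramified s.
have zE : forall x, zeta_integrand (fun w => A * lat a b w + B * lat a' b' w) chi psi g s x =
    A * zf (quot_char s) y x + B * zf (quot_char s) y' x.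
  by move=> x; rewrite /zeta_integrand !latE /zf /quot_char -/y -/y'; ring.
have i1 := zf_integrable hl hnu (qM) qu qlt ya.
have i2 := zf_integrable hl hnu (qM) qu qlt yb.
have zEf : zeta_integrand (fun w => A * lat a b w + B * lat a' b' w) chi psi g s =
    (fun x => A * zf (quot_char s) y x + B * zf (quot_char s) y' x) by apply/funext.
split; first by rewrite zEf; apply: cintegrableD => //; apply: cintegrableZ.
rewrite /siegel_at zEf.
rewrite [cintegral nu _ _](_ : _ = A * ((quot_char s y)^-1 / (1 - quot_char s l%:R)) +
    B * ((quot_char s y')^-1 / (1 - quot_char s l%:R))); last first.
  transitivity (cintegral nu D0 (fun x => A * zf (quot_char s) y x) +
      cintegral nu D0 (fun x => B * zf (quot_char s) y' x)).
    exact: (cintegralD mD0 (cintegrableZ mD0 A i1) (cintegrableZ mD0 B i2)).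
  by rewrite !cintegralZ // !(zf_integral hl hnu qM qu qlt).
have q1 : 1 - quot_char s l%:R != 0.
  by rewrite subr_eq0; apply: contraTneq qlt => <-; rewrite normr1 ltxx.
have -> : Lchar (fun x => chi x / psi x) (2 * s + 1) = (1 - quot_char s l%:R)^-1.
  rewrite /Lchar asboolT; last by move=> w hw; rewrite uchi // upsi // divr1.
  by rewrite cpowN // -cpowV // -(@pabs_prime l R F).
rewrite invrK.
pose X := cpow (l%:R : R) s.
have X0 : X != 0 by apply: cpow_neq0.
have half : (2^-1 : R[i]) = (2^-1 : R)%:C by rewrite fmorphV rmorph_nat.
have dE : cpow (pabs (\det g)) (s + 2^-1) = X ^ (- d) * abschar 2^-1 (\det g).
  rewrite cpowD ?pabs_gt0 // half pabs_cpow //; congr (_ * _).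
  by rewrite pd cpowXz.
have qE w k : w != 0 -> pabs w = (l%:R : R) ^ (- k) ->
    (quot_char s w)^-1 = X ^ (2 * k) / eta w.
  move=> w0 pw; rewrite /quot_char /eta.
  have -> : cpow (pabs w) (2 * s + 1) = X ^ (- (2 * k)) * abschar 1 w.
    rewrite cpowD ?pabs_gt0 // -[1]/((1 : R)%:C) pabs_cpow //; congr (_ * _).
    rewrite (_ : 2 * s = s + s); last by rewrite mulr_natl mulr2n.
    rewrite cpowD ?pabs_gt0 // pw cpowXz // -expfzDr //.
    by congr (_ ^ _); ring.
  by rewrite mulrCA invfM invr_expz opprK.
rewrite (qE _ n) // (qE _ n') // dE -/X.
have p1 : X ^+ m1 / X ^+ m = X ^ (2 * n) * X ^ (- d).
  by rewrite exprnP hm1 exprnN -!expfzDr //; congr (_ ^ _); rewrite /k1; ring.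
have p2 : X ^+ m2 / X ^+ m = X ^ (2 * n') * X ^ (- d).
  by rewrite exprnP hm2 exprnN -!expfzDr //; congr (_ ^ _); rewrite /k2; ring.
rewrite hornerD !hornerM !hornerC !hornerXn -/X [in RHS]mulrDl -!mulrA p1 p2 /K.
move: (X ^ (2 * n)) (X ^ (2 * n')) (X ^ (- d)) => X1 X2 X3.
move: (1 - quot_char s l%:R) q1 => q q0.
move: (eta y)^-1 (eta y')^-1 => Y Y'.
by field.
Qed.

End Siegel.

(** * The spherical section of GL2 *)

Section Spherical.
Context {l : nat} {R : realType} {F : padicType l R}.
Hypothesis hl : prime l.
Variables chi psi : F -> R[i].
Hypothesis hchi : is_char chi.
Hypothesis hpsi : is_char psi.
Hypothesis uchi : unramified chi.
Hypothesis upsi : unramified psi.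
Hypothesis psi_l : psi l%:R = @sqrtl l R F.
Implicit Types (x y u : F) (g h k : 'M[F]_2).
Notation eta := (eta chi psi).

Definition sph g : R[i] :=
  if GL2 g then chi (\det g) * abschar 2^-1 (\det g) / eta (rmax (g 1 0) (g 1 1)) else 0.

Definition dg x y : 'M[F]_2 := mx_of 2 [:: [:: x; 0]; [:: 0; y]].
Definition low u : 'M[F]_2 := mx_of 2 [:: [:: 1; 0]; [:: u; 1]].
Definition c0 : R[i] := chi l%:R / @sqrtl l R F.

Lemma mulmx2E p q (g : 'M[F]_(p, 2)) (h : 'M[F]_(2, q)) i j :
  (g *m h) i j = g i 0 * h 0 j + g i 1 * h 1 j.
Proof.
rewrite mxE !big_ord_recl big_ord0 addr0.
by have -> : lift ord0 ord0 = 1 :> 'I_2 by apply: val_inj.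
Qed.

Lemma GL2E g : GL2 g = (\det g != 0). Proof. by rewrite /GL2 unitmxE unitfE. Qed.

Lemma GL2_mul g h : GL2 (g *m h) = GL2 g && GL2 h.
Proof. by rewrite !GL2E det_mulmx mulf_eq0 negb_or. Qed.

Lemma etaM x y : x != 0 -> y != 0 -> eta (x * y) = eta x * eta y.
Proof.
move=> x0 y0; rewrite /eta abscharM.
by case: hchi => _ -> // _; case: (hpsi) => _ -> // _; rewrite invfM; ring.
Qed.

Lemma eta_unramified : unramified eta.
Proof. by move=> u hu; rewrite /eta uchi // upsi // abschar_unramified // divr1 mulr1. Qed.

Lemma eta_is_char : is_char eta.
Proof.
by apply: unram_is_char => //; [apply: eta_unramified; exact: pabs1|exact: etaM|exact: eta_unramified].
Qed.

Lemma eta_eq x y : x != 0 -> pabs x = pabs y -> eta x = eta y.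
Proof. exact: unram_eq eta_is_char eta_unramified. Qed.

Lemma eta_neq0 x : x != 0 -> eta x != 0.
Proof. exact: char_neq0 eta_is_char. Qed.

Lemma abschar_half_l : abschar 2^-1 (l%:R : F) = (@sqrtl l R F)^-1.
Proof. by rewrite /sqrtl abscharN invrK. Qed.

Lemma c0_neq0 : c0 != 0.
Proof. by rewrite mulf_neq0 ?invr_eq0 ?sqrtl_neq0 // char_neq0 // lF_neq0. Qed.

Lemma eta_l : eta l%:R = c0 / l%:R.
Proof.
rewrite /eta psi_l -/c0 -[1]/(1%:R) abschar_natl pabs_prime expr1 fmorphV rmorph_nat //.
Qed.

Lemma rmax_row_neq0 g : GL2 g -> rmax (g 1 0) (g 1 1) != 0.
Proof. by move=> hg; apply: rmax_neq0; exact: GL2_row. Qed.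

Lemma sph_mul g h : GL2 g -> GL2 h ->
  sph (g *m h) = chi (\det h) * abschar 2^-1 (\det h) * (chi (\det g) * abschar 2^-1 (\det g)) /
    eta (rmax (g 1 0 * h 0 0 + g 1 1 * h 1 0) (g 1 0 * h 0 1 + g 1 1 * h 1 1)).
Proof.
move=> hg hh; rewrite /sph GL2_mul hg hh /= !mulmx2E det_mulmx abscharM.
rewrite !GL2E in hg hh; case: hchi => _ -> // _; congr (_ / _); ring.
Qed.

Lemma ind_rtrans f h : GL2 h -> indGL2 chi psi f -> indGL2 chi psi (rtrans h f).
Proof.
move=> hh [z s e]; split.
- by move=> g hg; rewrite /rtrans z // GL2_mul hh andbT.
- apply: smooth_rtrans => // k hk.
  by rewrite !GL2_mul hk hh !andbT /GL2 unitmx_inv; exact: hh.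
- by move=> a b d g a0 d0 hg; rewrite /rtrans -mulmxA e // GL2_mul hg.
Qed.

Lemma ind_add a f1 f2 : indGL2 chi psi f1 -> indGL2 chi psi f2 ->
  indGL2 chi psi (fun g => a * f1 g + f2 g).
Proof.
move=> [z1 s1 e1] [z2 s2 e2]; split.
- by move=> g hg; rewrite z1 // z2 // mulr0 addr0.
- exact: smooth_add.
- by move=> *; rewrite e1 // e2 //; ring.
Qed.

Lemma ind_0 : indGL2 chi psi (fun=> 0).
Proof.
split=> // [|*]; last by rewrite mulr0.
by rewrite /smooth_fun; near=> h.
Unshelve. all: by end_near. Qed.

Lemma ind_sum I (r : seq I) (f : I -> 'M[F]_2 -> R[i]) :
  (forall i, indGL2 chi psi (f i)) -> indGL2 chi psi (fun g => \sum_(i <- r) f i g).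
Proof.
move=> h; elim: r => [|i r IH].
  by under eq_fun do rewrite big_nil; exact: ind_0.
rewrite (_ : (fun g => _) = (fun g => 1 * f i g + \sum_(j <- r) f j g)).
  exact: ind_add.
by apply/funext => g; rewrite big_cons mul1r.
Qed.

Lemma rmax_row_le x y k : integral_mx k ->
  pabs (rmax (x * k 0 0 + y * k 1 0) (x * k 0 1 + y * k 1 1)) <= pabs (rmax x y).
Proof.
move=> ki; rewrite !rmax_pabs ge_max; apply/andP; split.
  rewrite (le_trans (pabsD _ _)) // ge_max !le_max !pabsM.
  by rewrite (ler_piMr (pabs_ge0 x) (ki 0 0)) (ler_piMr (pabs_ge0 y) (ki 1 0)) orbT.
rewrite (le_trans (pabsD _ _)) // ge_max !le_max !pabsM.
by rewrite (ler_piMr (pabs_ge0 x) (ki 0 1)) (ler_piMr (pabs_ge0 y) (ki 1 1)) orbT.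
Qed.

Lemma integral_inv2 k : integral_mx k -> pabs (\det k) = 1 ->
  exists2 k', integral_mx k' & k *m k' = 1%:M.
Proof.
move=> ki hd; have d0 := pabs_unit_neq0 hd; have [_ dV] := unitZl hd.
exists ((\det k)^-1 *: mx_of 2 [:: [:: k 1 1; - k 0 1]; [:: - k 1 0; k 0 0]]).
  move=> i j; rewrite mxE rpredM //.
  by move: i j => -[[|[|?]] ?] [[|[|?]] ?] //; rewrite mxE /= ?rpredN; apply: ki.
apply/matrixP => i j; rewrite mulmx2E !mxE.
move: d0; rewrite det2 => d0.
move: i j => -[[|[|?]] ?] [[|[|?]] ?] //=.
- by rewrite (_ : Ordinal _ = 0); [field|apply: val_inj].
- by rewrite (_ : Ordinal _ = 0); [field|apply: val_inj].
- by rewrite (_ : Ordinal _ = 1); [field|apply: val_inj].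
- by rewrite (_ : Ordinal _ = 1); [field|apply: val_inj].
Qed.

Lemma sph_unit k : integral_mx k -> pabs (\det k) = 1 -> rtrans k sph = sph.
Proof.
move=> ki hd; apply/funext => g; rewrite /rtrans.
have hk : GL2 k by rewrite GL2E pabs_unit_neq0.
case hg : (GL2 g); last by rewrite /sph GL2_mul hg.
rewrite sph_mul // uchi // abschar_unramified // !mul1r /sph hg.
congr (_ / _); apply: eta_eq.
  have := rmax_row_neq0 (g := g *m k); rewrite GL2_mul hg hk !mulmx2E; exact.
apply/eqP; rewrite eq_le rmax_row_le //.
have [k' k'i kk'] := integral_inv2 ki hd.
have E j : g 1 j = (g *m k) 1 0 * k' 0 j + (g *m k) 1 1 * k' 1 j.
  by rewrite -mulmx2E -mulmxA kk' mulmx1.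
have := rmax_row_le ((g *m k) 1 0) ((g *m k) 1 1) k'i.
by rewrite -!E !mulmx2E.
Qed.

Lemma sph_ind : indGL2 chi psi sph.
Proof.
split.
- by move=> g /negbTE hg; rewrite /sph hg.
- apply/(nbhs_mxP hl); exists 1%N => h hh _; apply: sph_unit.
    move=> i j; have := hh i j; rewrite expr1 => h1.
    rewrite -[h i j](subrK (1%:M i j)) rpredD //; last by rewrite mxE rpred_nat.
    by rewrite -[_ - _](divfK (lF_neq0 hl)) rpredM // l_Zl.
  have E i j : exists2 x, x \in Zl & h i j = 1%:M i j + l%:R * x.
    exists ((h i j - 1%:M i j) / l%:R); first by have := hh i j; rewrite expr1.
    by rewrite mulrC divfK ?lF_neq0 // addrC subrK.
  have [a ha e00] := E 0 0; have [b hb e01] := E 0 1.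
  have [c hc e10] := E 1 0; have [d hd e11] := E 1 1.
  have lZ := @l_Zl l R F.
  rewrite det2 e00 e01 e10 e11 !mxE /=.
  rewrite (_ : _ - _ = 1 + l%:R * (a + d + l%:R * a * d - l%:R * b * c)); last by ring.
  rewrite pabs_addl pabs1 // pabsM (le_lt_trans _ (@pabs_l_lt1 l R F hl)) //.
  by rewrite ler_piMr ?pabs_ge0 // -ZlE; zl.
- move=> a b d g a0 d0 hg; have hm : GL2 (mx_of 2 [:: [:: a; b]; [:: 0; d]]).
    by rewrite GL2E det2 !mxE /= mulr0 subr0 mulf_neq0.
  rewrite /sph GL2_mul hg hm det_mulmx !mulmx2E !mxE /= !mul0r !add0r.
  have dm : \det (mx_of 2 [:: [:: a; b]; [:: 0; d]]) = a * d.
    by rewrite det2 !mxE /= mulr0 subr0.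
  have g0 : \det g != 0 by rewrite -GL2E.
  have r0 := rmax_row_neq0 hg.
  have -> : eta (rmax (d * g 1 0) (d * g 1 1)) = eta d * eta (rmax (g 1 0) (g 1 1)).
    rewrite -etaM //; apply: eta_eq.
      by apply: rmax_neq0; rewrite !mulf_eq0 (negbTE d0) /=; exact: GL2_row.
    by rewrite pabsM !rmax_pabs !pabsM maxr_pMr ?pabs_ge0.
  rewrite dm; have [_ cM _] := hchi; rewrite !cM ?mulf_neq0 // !abscharM /eta.
  have -> : abschar 1 d = abschar 2^-1 d * abschar 2^-1 d :> R[i].
    by rewrite -abschar_add //; congr abschar; field.
  have -> : abschar 2^-1 d^-1 = (abschar 2^-1 d)^-1 :> R[i].
    by rewrite (charV (abschar_is_char hl _)).
  have x1 := char_neq0 (abschar_is_char hl 2^-1) d0.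
  have x2 := char_neq0 hchi d0; have x3 := char_neq0 hpsi d0.
  have x4 := eta_neq0 r0; move: x4; rewrite /eta.
  move: (_ / _ * _) => Y Y0.
  by field; rewrite x1 x2 x3 Y0.
Qed.

Lemma sph_scale x g : x != 0 -> sph (g *m dg x x) = chi x * psi x * sph g.
Proof.
move=> x0; have hd : GL2 (dg x x) by rewrite GL2E det2 !mxE /= mulr0 subr0 mulf_neq0.
case hg : (GL2 g); last by rewrite /sph GL2_mul hg mulr0.
rewrite sph_mul // !mxE /= !mulr0 addr0 add0r /sph hg.
have -> : eta (rmax (g 1 0 * x) (g 1 1 * x)) = eta x * eta (rmax (g 1 0) (g 1 1)).
  rewrite -etaM ?rmax_row_neq0 //; apply: eta_eq.
    by apply: rmax_neq0; rewrite !mulf_eq0 (negbTE x0) !orbF; exact: GL2_row.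
  by rewrite pabsM !rmax_pabs !pabsM maxr_pMr ?pabs_ge0 // ![pabs x * _]mulrC.
rewrite det2 !mxE /= mulr0 subr0; have [_ cM _] := hchi; rewrite !cM // !abscharM {1}/eta.
have -> : abschar 1 x = abschar 2^-1 x * abschar 2^-1 x :> R[i].
  by rewrite -abschar_add //; congr abschar; field.
have x1 := char_neq0 (abschar_is_char hl 2^-1) x0.
have x2 := char_neq0 hchi x0; have x3 := char_neq0 hpsi x0.
have x4 := eta_neq0 (rmax_row_neq0 hg); move: (eta _) x4 => Y Y0.
by field; rewrite x1 x2 x3 Y0.
Qed.

Lemma rmax_sum x y : rmax x y != 0 ->
  \sum_(u < l) (eta (rmax (x + y * u%:R) (y * l%:R)))^-1 + (eta (rmax (x * l%:R) y))^-1 =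
  (l%:R + l%:R / c0) / eta (rmax x y).
Proof.
have l0 := @lF_neq0 l R F hl; have lC : l%:R != 0 :> R[i] by rewrite pnatr_eq0 eqn0Ngt prime_gt0.
have llt := @pabs_l_lt1 l R F hl.
have etal z : z != 0 -> (eta (z * l%:R))^-1 = l%:R / c0 / eta z.
  move=> z0; rewrite etaM // eta_l; have := eta_neq0 z0; have := c0_neq0.
  by move: c0 (eta z) => c Y c1 Y1; field; rewrite c1 Y1 lC.
have max_l a b : a != 0 -> pabs b <= pabs a -> eta (rmax a b) = eta a.
  move=> a0 ba; apply/esym/eta_eq => //; by rewrite rmax_pabs; apply/esym/max_idPl.
have max_r a b : b != 0 -> pabs a <= pabs b -> eta (rmax a b) = eta b.
  move=> b0 ab; apply/esym/eta_eq => //; by rewrite rmax_pabs; apply/esym/max_idPr.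
case: (ltP (pabs y) (pabs x)) => xy.
  move=> _; have x0 : x != 0 by rewrite -pabs_gt0 (le_lt_trans (pabs_ge0 y) xy).
  rewrite [in RHS]max_l ?(ltW xy) // [in X in _ + X]max_l ?mulf_neq0 //; last first.
    by rewrite mulrC pabs_le_div ?mulf_neq0 //; apply: pabs_ltZ.
  rewrite (eq_bigr (fun _ => (eta x)^-1)) => [|u _]; last first.
    have yu : pabs (y * u%:R) < pabs x.
      by rewrite (le_lt_trans _ xy) // pabsM ler_piMr ?pabs_ge0 // -ZlE rpred_nat.
    have xu : pabs (x + y * u%:R) = pabs x by rewrite pabs_addl.
    have xu0 : x + y * u%:R != 0 by rewrite -pabs_gt0 xu pabs_gt0.
    rewrite max_l //; first by congr (_^-1); apply: eta_eq.
    by rewrite xu (le_trans _ (ltW xy)) // pabsM ler_piMr ?pabs_ge0 // ltW.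
  by rewrite sumr_const card_ord etal // -[_^-1 *+ l]mulr_natl mulrDl.
move=> r0; have y0 : y != 0.
  apply: contraNneq r0 => e; move: xy; rewrite e pabs0 /rmax pabs0 => ->.
  by [].
have [|u0 [z [zZ e]]] := @residueE l R F hl (- x / y).
  by rewrite -pabs_le_div // pabsN.
have xE : x = - (y * (u0%:R + l%:R * z)) by rewrite -e; field.
rewrite [in RHS]max_r // [in X in _ + X]max_r //; last first.
  by rewrite (le_trans _ xy) // pabsM ler_piMr ?pabs_ge0 // ltW.
rewrite (bigD1 u0) //= max_r ?mulf_neq0 //; last first.
  rewrite xE (_ : _ + _ = y * l%:R * (- z)); last by ring.
  by rewrite pabsM ler_piMr ?pabs_ge0 // pabsN.
rewrite (eq_bigr (fun _ => (eta y)^-1)) => [|u uu0]; last first.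
  have xu : pabs (x + y * u%:R) = pabs y.
    rewrite xE (_ : _ + _ = y * (u%:R - u0%:R - l%:R * z)); last by ring.
    rewrite pabsM (_ : pabs (u%:R - u0%:R - l%:R * z) = 1) ?mulr1 //.
    have wZ : u%:R - u0%:R - l%:R * z \in Zl by have := @l_Zl l R F; move=> *; zl.
    apply/eqP; rewrite eq_le -ZlE wZ /= leNgt; apply/negP => /(Zl_lt1 hl) wl.
    move/negP: uu0; apply; apply/eqP/ord_inj.
    apply: (nat_residue_inj (F := F) hl (n := 1)); rewrite ?expn1 // expr1.
    rewrite (_ : _ / _ = (u%:R - u0%:R - l%:R * z) / l%:R + z); last by field.
    by rewrite rpredD.
  have xu0 : x + y * u%:R != 0 by rewrite -pabs_gt0 xu pabs_gt0.
  rewrite max_l //; first by congr (_^-1); apply: eta_eq.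
  by rewrite xu pabsM ler_piMr ?pabs_ge0 // ltW.
rewrite sumr_const cardC1 card_ord etal // -addrA -mulrSr prednK ?prime_gt0 //.
by rewrite -[_^-1 *+ l]mulr_natl mulrDl addrC.
Qed.

Lemma sph_hecke g :
  \sum_(u < l) sph (g *m (low u%:R *m dg 1 l%:R)) + sph (g *m dg l%:R 1) =
  l%:R * (1 + c0) * sph g.
Proof.
have l0 := @lF_neq0 l R F hl.
case hg : (GL2 g); last first.
  rewrite /sph hg mulr0 GL2_mul hg addr0 big1 // => u _; by rewrite GL2_mul hg.
have h1 : GL2 (dg l%:R 1) by rewrite GL2E det2 !mxE /= mulr0 subr0 mulr1.
have h2 u : GL2 (low u *m dg 1 l%:R).
  by rewrite GL2E det_mulmx !det2 !mxE /= (_ : _ * _ = l%:R) //; ring.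
have d1 : \det (dg l%:R 1) = l%:R by rewrite det2 !mxE /= mulr0 subr0 mulr1.
have d2 u : \det (low u *m dg 1 l%:R) = l%:R.
  by rewrite det_mulmx !det2 !mxE /=; ring.
have E u : sph (g *m (low u *m dg 1 l%:R)) = c0 * (chi (\det g) * abschar 2^-1 (\det g)) *
    (eta (rmax (g 1 0 + g 1 1 * u) (g 1 1 * l%:R)))^-1.
  rewrite sph_mul // d2 abschar_half_l -/c0; congr (_ / eta (rmax _ _)).
    by rewrite !mulmx2E !mxE /=; ring.
  by rewrite !mulmx2E !mxE /=; ring.
under eq_bigr => u _ do rewrite E.
rewrite -mulr_sumr sph_mul // d1 abschar_half_l -/c0.
rewrite !mxE /= !mulr0 !mulr1 addr0 add0r -mulrDr rmax_sum ?rmax_row_neq0 // /sph hg.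
have := c0_neq0; move: c0 (eta _)^-1 => c Y c1.
by field.
Qed.

Definition sphn n g : R[i] := sph (g *m dg 1 (l%:R ^+ n)).

Variables (mu nu : {measure set (padic_borel F) -> \bar R}) (e : F -> R[i]).
Hypothesis hmu : is_haar_add mu.
Hypothesis hnu : is_haar_mul nu.
Hypothesis he : is_std_addchar e.

Lemma siegel_phi0 : siegel nu (fourier mu e phi0) chi psi = sph.
Proof.
apply/funext => g; rewrite (fourier_phi0 hl hmu he).
case hg : (GL2 g); last by rewrite /siegel /sph hg.
have -> : lat 1 1 = (fun w => 1 * lat 1 1 w + 0 * lat 1 1 w) :> ('rV[F]_2 -> R[i]).
  by apply/funext => w; rewrite mul1r mul0r addr0.
by rewrite (siegel_lat hl hnu hchi hpsi uchi upsi) ?oner_eq0 // /sph hg !mulr1 mul0r addr0 mul1r.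
Qed.

Lemma siegel_phit t : (0 < t)%N -> siegel nu (fourier mu e (phit t)) chi psi =
  fun g => ((l%:R * c0) ^- t : R[i]) * (sphn t g - sphn t.-1 g).
Proof.
case: t => // t _; apply/funext => g; rewrite (fourier_phit hl hmu he).
have l0 := @lF_neq0 l R F hl; have lt0 n := @lX_neq0 l R F hl n.
have lC : l%:R != 0 :> R[i] by rewrite pnatr_eq0 eqn0Ngt prime_gt0.
case hg : (GL2 g); last by rewrite /siegel /sphn /sph !GL2_mul hg subrr mulr0.
have -> : (fun w => l%:R ^- t.+1 * lat 1 (l%:R ^+ t.+1) w - l%:R ^- t.+2 * lat l%:R (l%:R ^+ t.+1) w) =
  (fun w => l%:R ^- t.+1 * lat 1 (l%:R ^+ t.+1) w + (- l%:R ^- t.+2) * lat l%:R (l%:R ^+ t.+1) w)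
    :> ('rV[F]_2 -> R[i]).
  by apply/funext => w; rewrite mulNr.
rewrite (siegel_lat hl hnu hchi hpsi uchi upsi) ?oner_eq0 //.
have c1 := c0_neq0.
have dgE a b : a != 0 -> b != 0 -> GL2 (dg a b).
  by move=> a0 b0; rewrite GL2E det2 !mxE /= mulr0 subr0 mulf_neq0.
have dd a b : \det (dg a b) = a * b by rewrite det2 !mxE /= mulr0 subr0.
have cl n : chi (l%:R ^+ n) * abschar 2^-1 (l%:R ^+ n : F) = c0 ^+ n.
  by rewrite charX // (charX _ (abschar_is_char hl _)) // abschar_half_l -exprMn.
have E1 n : sphn n g = c0 ^+ n * (chi (\det g) * abschar 2^-1 (\det g)) /
    eta (rmax (g 1 0 * 1) (g 1 1 * l%:R ^+ n)).
  rewrite /sphn sph_mul ?dgE ?oner_eq0 // dd mul1r cl; congr (_ / eta (rmax _ _)).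
    by rewrite !mxE /=; ring.
  by rewrite !mxE /=; ring.
rewrite !E1 /=.
have -> : eta (rmax (g 1 0 * l%:R) (g 1 1 * l%:R ^+ t.+1)) =
    eta l%:R * eta (rmax (g 1 0 * 1) (g 1 1 * l%:R ^+ t)).
  have r0 : rmax (g 1 0 * 1) (g 1 1 * l%:R ^+ t) != 0.
    apply: rmax_neq0; rewrite !mulf_eq0 oner_eq0 (negbTE (lt0 t)) !orbF; exact: GL2_row.
  rewrite -etaM //; apply: eta_eq.
    apply: rmax_neq0; rewrite !mulf_eq0 (negbTE l0) (negbTE (lt0 t.+1)) !orbF; exact: GL2_row.
  rewrite [RHS]pabsM !rmax_pabs maxr_pMr ?pabs_ge0 // exprS !pabsM pabs1.
  by congr (Num.max _ _); ring.
rewrite eta_l [(c0 / l%:R * _)^-1]invfM.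
move: (eta _)^-1 (eta _)^-1 c0 c1 => Y Y' c c1.
rewrite exprMn !exprS.
have ct : c ^+ t != 0 by rewrite expf_neq0.
have lct : l%:R ^+ t != 0 :> R[i] by rewrite expf_neq0.
move: (c ^+ t) (l%:R ^+ t) ct lct => ct lct ct0 lct0.
by field; rewrite ct0 lct0 c1 lC.
Qed.

End Spherical.

(** * Orbits of H(Z_l) on the Hecke cosets *)

Section Orbits.
Context {l : nat} {R : realType} {F : padicType l R}.
Hypothesis hl : prime l.
Implicit Types (g h k : 'M[F]_4) (m n x y : F).
Notation borel_mx := (@borel_mx l R F).

Definition mul_rows (A B : seq (seq F)) := [seq [seq
  a`_0 * (nth [::] B 0)`_j + a`_1 * (nth [::] B 1)`_j + a`_2 * (nth [::] B 2)`_j +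
  a`_3 * (nth [::] B 3)`_j | j <- iota 0 4] | a <- A].

Lemma mul_mx_of4 A B : size A = 4%N -> mx_of 4 A *m mx_of 4 B = mx_of 4 (mul_rows A B).
Proof.
move=> hA; apply/matrixP => i j; rewrite mulmx4E !mxE /mul_rows (nth_map [::]) ?hA //.
by rewrite (nth_map 0%N) ?size_iota // nth_iota.
Qed.

Lemma iota_mx_of (a b c d a' b' c' d' : F) :
  iota_H (mx_of 2 [:: [:: a; b]; [:: c; d]], mx_of 2 [:: [:: a'; b']; [:: c'; d']]) =
  mx_of 4 [:: [:: a; 0; 0; b]; [:: 0; a'; b'; 0]; [:: 0; c'; d'; 0]; [:: c; 0; 0; d]].
Proof. by rewrite /iota_H !mxE. Qed.

Definition same_orbit g g' := exists (h1 h2 : 'M[F]_2) k,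
  [/\ [/\ integral_mx h1, integral_mx h2, pabs (\det h1) = 1 & \det h2 = \det h1],
      Kg k & g' = iota_H (h1, h2) *m g *m k].

Lemma same_orbit_intro g g' m (h1 h2 : 'M[F]_2) (k : 'M[F]_4) :
  m != 0 -> sp g m -> sp g' m -> integral_mx h1 -> integral_mx h2 ->
  pabs (\det h1) = 1 -> \det h2 = \det h1 -> integral_mx k ->
  g' = iota_H (h1, h2) *m g *m k -> same_orbit g g'.
Proof.
move=> m0 hg hg' i1 i2 hd e ki E; exists h1, h2, k; split=> //; split=> //.
have d0 := pabs_unit_neq0 hd.
have sH : sp (iota_H (h1, h2) *m g) (\det h1 * m).
  by apply: sp_mul => //; apply: iota_sp.
have dm : \det h1 * m != 0 by rewrite mulf_neq0.
exists ((\det h1 * m)^-1 * m); first by rewrite pabsM pabsV pabsM hd mul1r mulVf // pabs_eq0.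
have -> : k = sp_inv (iota_H (h1, h2) *m g) (\det h1 * m) *m g'.
  by rewrite E mulmxA sp_invl // mul1mx.
by apply: sp_mul => //; apply: sp_invP.
Qed.

Definition split_rep := borel_mx 1 1 1 0 0 0 0 0 0.
Definition graph_rep := borel_mx 1 1 1 0 1 0 0 1 0.
Definition outer_rep := borel_mx 2 1 2 0 0 0 0 0 0.
Definition inner_rep := borel_mx 1 2 2 0 0 0 0 0 0.
Definition mixed_rep := borel_mx 1 2 2 0 1 0 0 l%:R 0.

Lemma split_rep_sp : sp split_rep (l%:R ^+ 1).
Proof. by apply: borel_sp => //=; rewrite ?expr0; ring. Qed.
Lemma graph_rep_sp : sp graph_rep (l%:R ^+ 1).
Proof. by apply: borel_sp => //=; rewrite ?expr0; ring. Qed.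
Lemma outer_rep_sp : sp outer_rep (l%:R ^+ 2).
Proof. by apply: borel_sp => //=; rewrite ?expr0; ring. Qed.
Lemma inner_rep_sp : sp inner_rep (l%:R ^+ 2).
Proof. by apply: borel_sp => //=; rewrite ?expr0; ring. Qed.
Lemma mixed_rep_sp : sp mixed_rep (l%:R ^+ 2).
Proof. by apply: borel_sp => //=; rewrite ?expr0; ring. Qed.

Ltac int2 := by ij2; rewrite mxE /=; zl.
Ltac int4 := by ij4; rewrite mxE /=; zl.

Ltac eq4 := rewrite /split_rep /graph_rep /outer_rep /inner_rep /mixed_rep /borel_mx
    iota_mx_of !mul_mx_of4 // /mul_rows /=;
  congr (mx_of _ [:: [:: _; _; _; _]; [:: _; _; _; _]; [:: _; _; _; _]; [:: _; _; _; _]]);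
  rewrite /= ?expr0 ?expr1; first [by ring | by field; do ?(apply/andP; split)].
Ltac orbit hg hg' s1 s2 sk :=
  apply: (same_orbit_intro (h1 := mx_of 2 s1) (h2 := mx_of 2 s2) (k := mx_of 4 sk) _ hg hg');
  [exact: lX_neq0 | int2 | int2 | rewrite det2 !mxE /= | rewrite !det2 !mxE /= | int4 | eq4].

Lemma pabs1E x : x = 1 -> pabs x = 1. Proof. by move=> ->; exact: pabs1. Qed.

Lemma repT_orbit (i : @idxT l) : same_orbit
  (match i with
   | inl (inl (inl (u, _, _))) => if (u : nat) == 0%N then split_rep else graph_rep
   | inl (inl (inr (x, _))) => if (x : nat) == 0%N then split_rep else graph_rep
   | _ => split_rep end) (repT i).
Proof.
have lZ := @l_Zl l R F.
have spi := repT_sp (F := F) i.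
case: i spi => [[[[[u v] w]|[x y]]|x]|[]] spi.
- case: eqP => [u0|/eqP u0].
    rewrite /= u0 in spi *; orbit split_rep_sp spi
     [:: [:: 1; v%:R : F]; [:: 0; 1]] [:: [:: 1; w%:R : F]; [:: 0; 1]]
     [:: [:: 1; 0; 0; 0 : F]; [:: 0; 1; 0; 0]; [:: 0; 0; 1; 0]; [:: 0; 0; 0; 1]].
      by apply: pabs1E; ring.
    by ring.
  have hu : pabs (u%:R : F) = 1 by apply: pabs_nat_unit; rewrite // lt0n u0 ltn_ord.
  have [uZ uV] := unitZl hu; have un := pabs_unit_neq0 hu.
  rewrite /= in spi *; move: (u%:R : F) hu uZ uV un spi => U hu uZ uV un spi; orbit graph_rep_sp spi
     [:: [:: U; v%:R : F]; [:: 0; 1]] [:: [:: U; w%:R : F]; [:: 0; 1]]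
     [:: [:: U^-1; 0; 0; 0 : F]; [:: 0; U^-1; 0; 0]; [:: 0; 0; 1; 0]; [:: 0; 0; 0; 1]].
    by rewrite mulr1 mulr0 subr0.
  by ring.
- case: eqP => [u0|/eqP u0].
    rewrite /= u0 in spi *; orbit split_rep_sp spi
     [:: [:: 1; y%:R : F]; [:: 0; 1]] [:: [:: 0; 1 : F]; [:: -1; 0]]
     [:: [:: 1; 0; 0; 0 : F]; [:: 0; 0; -1; 0]; [:: 0; 1; 0; 0]; [:: 0; 0; 0; 1]].
      by apply: pabs1E; ring.
    by ring.
  have hu : pabs (x%:R : F) = 1 by apply: pabs_nat_unit; rewrite // lt0n u0 ltn_ord.
  have [_ uV] := unitZl hu; have un := pabs_unit_neq0 hu.
  have uZ : x%:R \in (Zl : {pred F}) by rewrite rpred_nat.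
  rewrite /= in spi *; move: (x%:R : F) hu uV un uZ spi => X hu uV un uZ spi; orbit graph_rep_sp spi
     [:: [:: 1; 0 : F]; [:: 0; 1]] [:: [:: - (y%:R / X); X^-1 : F]; [:: - X; 0]]
     [:: [:: 1; 0; y%:R / X; 0 : F]; [:: 0; 0; - X^-1; 0]; [:: 0; X; - (l%:R * y%:R / X); y%:R]; [:: 0; 0; 0; 1]].
    by apply: pabs1E; ring.
  by field.
- rewrite /= in spi *; orbit split_rep_sp spi
   [:: [:: 0; 1 : F]; [:: -1; 0]] [:: [:: 1; x%:R : F]; [:: 0; 1]]
   [:: [:: 0; 0; 0; -1 : F]; [:: 0; 1; 0; 0]; [:: 0; 0; 1; 0]; [:: 1; 0; 0; 0]].
    by apply: pabs1E; ring.
  by ring.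
- rewrite /= in spi *; orbit split_rep_sp spi
   [:: [:: 0; 1 : F]; [:: -1; 0]] [:: [:: 0; 1 : F]; [:: -1; 0]]
   [:: [:: 0; 0; 0; -1 : F]; [:: 0; 0; -1; 0]; [:: 0; 1; 0; 0]; [:: 1; 0; 0; 0]].
    by apply: pabs1E; ring.
  by ring.
Qed.

Lemma ord_unit (u : 'I_l) : (u : nat) <> 0%N -> pabs (u%:R : F) = 1.
Proof. by move=> /eqP u0; apply: pabs_nat_unit; rewrite // lt0n u0 ltn_ord. Qed.

Lemma repT1_orbit (i : @idxT1 l) : same_orbit
  (match i with
   | inl (inl (inl (inl (inl (a, b, _))))) =>
       if ((a : nat) == 0%N) && ((b : nat) == 0%N) then outer_rep else mixed_rep
   | inl (inl (inl (inl (inr (a, _))))) => if (a : nat) == 0%N then inner_rep else mixed_rep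
   | inl (inl (inl (inr a))) => if (a : nat) == 0%N then inner_rep else mixed_rep
   | inl (inl (inr _)) => outer_rep
   | inl (inr _) => inner_rep
   | inr (_, u) => if (u : nat) == 0%N then outer_rep else mixed_rep
   end) (repT1 i).
Proof.
have lZ := @l_Zl l R F.
have spi := repT1_sp (F := F) i.
case: i spi => [[[[[[[a b] c]|[a c]]|a]|[]]|w]|[v u]] spi.
- case: eqP => [a0|/ord_unit ha] /=; last first.
    have [aZ aV] := unitZl ha; have an := pabs_unit_neq0 ha.
    rewrite /= in spi *; move: (a%:R : F) ha aZ aV an spi => A ha aZ aV an spi; orbit mixed_rep_sp spi
     [:: [:: c%:R; -1 : F]; [:: 1; 0]] [:: [:: - A^-1; b%:R : F]; [:: 0; - A]]
     [:: [:: 0; 0; A^-1; 0 : F]; [:: 1; 0; 0; 0]; [:: 0; 0; - (l%:R / A); 1]; [:: - l%:R; - A; - b%:R; 0]].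
      by apply: pabs1E; ring.
    by field.
  case: eqP => [b0|/ord_unit hb] /=; last first.
    have [bZ bV] := unitZl hb; have bn := pabs_unit_neq0 hb.
    rewrite /= a0 in spi *; move: (b%:R : F) hb bZ bV bn spi => B hb bZ bV bn spi; orbit mixed_rep_sp spi
     [:: [:: c%:R; -1 : F]; [:: 1; 0]] [:: [:: 0; B : F]; [:: - B^-1; 0]]
     [:: [:: 0; - B^-1; 0; 0 : F]; [:: 1; 0; 0; 0]; [:: 0; l%:R / B; 0; 1]; [:: - l%:R; 0; - B; 0]].
      by apply: pabs1E; ring.
    by field.
  rewrite /= a0 b0 in spi *; orbit outer_rep_sp spi
   [:: [:: 1; c%:R : F]; [:: 0; 1]] [:: [:: 1; 0 : F]; [:: 0; 1]]
   [:: [:: 1; 0; 0; 0 : F]; [:: 0; 1; 0; 0]; [:: 0; 0; 1; 0]; [:: 0; 0; 0; 1]].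
    by apply: pabs1E; ring.
  by ring.
- case: eqP => [a0|/ord_unit ha] /=; last first.
    have [aZ aV] := unitZl ha; have an := pabs_unit_neq0 ha.
    rewrite /= in spi *; move: (a%:R : F) ha aZ aV an spi => A ha aZ aV an spi; orbit mixed_rep_sp spi
     [:: [:: A; 0 : F]; [:: 0; A^-1]] [:: [:: 1; c%:R : F]; [:: 0; 1]]
     [:: [:: A^-1; 0; 0; 0 : F]; [:: 0; 1; 0; 0]; [:: 0; 0; 1; 0]; [:: 0; 0; 0; A]].
      by apply: pabs1E; field.
    by field.
  rewrite /= a0 in spi *; orbit inner_rep_sp spi
   [:: [:: 1; 0 : F]; [:: 0; 1]] [:: [:: 1; c%:R : F]; [:: 0; 1]]
   [:: [:: 1; 0; 0; 0 : F]; [:: 0; 1; 0; 0]; [:: 0; 0; 1; 0]; [:: 0; 0; 0; 1]].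
    by apply: pabs1E; ring.
  by ring.
- case: eqP => [a0|/ord_unit ha] /=; last first.
    have [aZ aV] := unitZl ha; have an := pabs_unit_neq0 ha.
    rewrite /= in spi *; move: (a%:R : F) ha aZ aV an spi => A ha aZ aV an spi; orbit mixed_rep_sp spi
     [:: [:: A; 0 : F]; [:: 0; A^-1]] [:: [:: 0; 1 : F]; [:: -1; 0]]
     [:: [:: A^-1; 0; 0; 0 : F]; [:: 0; 0; -1; 0]; [:: 0; 1; 0; 0]; [:: 0; 0; 0; A]].
      by apply: pabs1E; field.
    by field.
  rewrite /= a0 in spi *; orbit inner_rep_sp spi
   [:: [:: 1; 0 : F]; [:: 0; 1]] [:: [:: 0; 1 : F]; [:: -1; 0]]
   [:: [:: 1; 0; 0; 0 : F]; [:: 0; 0; -1; 0]; [:: 0; 1; 0; 0]; [:: 0; 0; 0; 1]].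
    by apply: pabs1E; ring.
  by ring.
- rewrite /= in spi *; orbit outer_rep_sp spi
   [:: [:: 0; 1 : F]; [:: -1; 0]] [:: [:: 1; 0 : F]; [:: 0; 1]]
   [:: [:: 0; 0; 0; -1 : F]; [:: 0; 1; 0; 0]; [:: 0; 0; 1; 0]; [:: 1; 0; 0; 0]].
    by apply: pabs1E; ring.
  by ring.
- have hw := unit_ordS hl (F := F) w.
  have [wZ wV] := unitZl hw; have wn := pabs_unit_neq0 hw.
  rewrite /repT1 in spi *; move: (w.+1%:R : F) hw wZ wV wn spi => W hw wZ wV wn spi; orbit inner_rep_sp spi
   [:: [:: 1; 0 : F]; [:: 0; 1]] [:: [:: 0; W : F]; [:: - W^-1; l%:R]]
   [:: [:: 1; 0; 0; 0 : F]; [:: 0; 1; 0; 0]; [:: 0; l%:R / W; 1; 0]; [:: 0; 0; 0; 1]].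
    by apply: pabs1E; ring.
  by field.
- have hv := unit_ordS hl (F := F) v.
  have [vZ vV] := unitZl hv; have vn := pabs_unit_neq0 hv.
  case: eqP => [u0|/ord_unit hu] /=; last first.
    have [uZ uV] := unitZl hu; have un := pabs_unit_neq0 hu.
    rewrite /repT1 in spi *; move: (v.+1%:R : F) hv vZ vV vn (u%:R : F) hu uZ uV un spi
      => V hv vZ vV vn U hu uZ uV un spi; orbit mixed_rep_sp spi
     [:: [:: V; 0 : F]; [:: l%:R; V^-1]] [:: [:: 0; U : F]; [:: - U^-1; 0]]
     [:: [:: V^-1; - U^-1; 0; 0 : F]; [:: 1; 0; 0; 0]; [:: 0; l%:R / U; U / V; 1]; [:: - l%:R; 0; - U; 0]].
      by apply: pabs1E; field.
    by field; rewrite vn un.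
  rewrite /repT1 u0 expr0n mul0r in spi *; move: (v.+1%:R : F) hv vZ vV vn spi => V hv vZ vV vn spi;
    orbit outer_rep_sp spi
   [:: [:: 0; V : F]; [:: - V^-1; l%:R]] [:: [:: 1; 0 : F]; [:: 0; 1]]
   [:: [:: 1; 0; 0; 0 : F]; [:: 0; 1; 0; 0]; [:: 0; 0; 1; 0]; [:: l%:R / V; 0; 0; 1]].
    by apply: pabs1E; field.
  by field.
Qed.

End Orbits.

Lemma recursion_diff (K : fieldType) (q c : K) (x : nat -> K) : q != 0 -> q + 1 != 0 ->
  (q + 1) * x 1 = q * (1 + c) * x 0 ->
  (forall n, q * x n.+2 + c * q * x n = q * (1 + c) * x n.+1) ->
  forall n, x n.+1 - x n = c ^+ n * ((q * c - 1) / (q + 1)) * x 0.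
Proof.
move=> q0 q1 e0 eS; elim=> [|n IH].
  by apply: (mulfI q1); rewrite mulrBr e0 expr0; field.
apply: (mulfI q0).
have -> : q * (x n.+2 - x n.+1) =
  (q * x n.+2 + c * q * x n) - c * q * x n - q * x n.+1 by ring.
rewrite eS exprS.
have -> : q * (c * c ^+ n * ((q * c - 1) / (q + 1)) * x 0%N) =
  q * c * (c ^+ n * ((q * c - 1) / (q + 1)) * x 0%N) by ring.
by rewrite -IH; ring.
Qed.

Section HeckeRecursion.
Context {l : nat} {R : realType} {F : padicType l R}.
Hypothesis hl : prime l.
Variables chi psi : F -> R[i].
Hypothesis hchi : is_char chi.
Hypothesis hpsi : is_char psi.
Hypothesis uchi : unramified chi.
Hypothesis upsi : unramified psi.
Hypothesis psi_l : psi l%:R = @sqrtl l R F.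
Notation ind := (indGL2 chi psi).
Notation ee := (sphn chi psi).
Notation c := (c0 chi).
Notation sph := (sph chi psi).

Ltac mx2 := apply/matrixP; ij2; rewrite ?mulmx2E !mxE /=.

Definition wmx : 'M[F]_2 := mx_of 2 [:: [:: 0; 1]; [:: -1; 0]].
Definition upp (a b : F) : 'M[F]_2 := mx_of 2 [:: [:: a; b]; [:: 0; 1]].

Lemma dg_GL2 (a b : F) : a != 0 -> b != 0 -> GL2 (dg a b).
Proof. by move=> a0 b0; rewrite GL2E det2 !mxE /= mulr0 subr0 mulf_neq0. Qed.

Lemma chi_psi_l : chi l%:R * psi l%:R = c * l%:R.
Proof.
have s0 := @sqrtl_neq0 l R F hl.
rewrite psi_l /c -(@sqrtl_sqr l R F hl).
by move: (sqrtl) s0 (chi _) => S S0 X; field.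
Qed.

Lemma chi_psi_lV : chi l%:R^-1 * psi l%:R^-1 = (c * l%:R)^-1.
Proof. by rewrite !charV ?lF_neq0 // -invfM chi_psi_l. Qed.

Lemma sphn_ind n : ind (ee n).
Proof.
apply: (ind_rtrans hl (h := dg 1 (l%:R ^+ n))); last exact: sph_ind.
by apply: dg_GL2; rewrite ?oner_eq0 ?lX_neq0.
Qed.

Lemma sphn0 : ee 0 = sph.
Proof.
apply/funext => g; rewrite /sphn expr0; congr sph; rewrite -[RHS]mulmx1; congr (_ *m _).
by mx2.
Qed.

Lemma sphn_upp n a b : pabs a = 1 -> b \in Zl -> rtrans (upp a b) (ee n) = ee n.
Proof.
move=> ha hb; apply/funext => g; rewrite /rtrans /sphn.
have -> : g *m upp a b *m dg 1 (l%:R ^+ n) = g *m dg 1 (l%:R ^+ n) *m upp a (b * l%:R ^+ n).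
  by rewrite -!mulmxA; congr (_ *m _); mx2; ring.
rewrite -[LHS]/(rtrans (upp a (b * l%:R ^+ n)) sph _) sph_unit //.
  have lZ := @l_Zl l R F; have [aZ _] := unitZl ha.
  by ij2; rewrite mxE /=; zl.
by rewrite det2 !mxE /= mulr1 mulr0 subr0.
Qed.

Lemma sphn_shift n : rtrans (dg l%:R^-1 1) (ee n) = fun g => (c * l%:R)^-1 * ee n.+1 g.
Proof.
have l0 := @lF_neq0 l R F hl.
apply/funext => g; rewrite /rtrans /sphn -chi_psi_lV -(sph_scale hl hchi hpsi uchi upsi);
  last by rewrite invr_eq0.
congr sph.
rewrite -!mulmxA; congr (_ *m _); mx2; rewrite ?exprS; try ring.
by move: (l%:R ^+ n) => X; field.
Qed.

Lemma sphn_swap : rtrans wmx (ee 1) = rtrans (dg l%:R 1) sph.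
Proof.
apply/funext => g; rewrite /rtrans /sphn.
have -> : g *m wmx *m dg 1 (l%:R ^+ 1) = g *m dg l%:R 1 *m wmx.
  by rewrite -!mulmxA; congr (_ *m _); mx2; rewrite ?expr1; ring.
rewrite -[LHS]/(rtrans wmx sph _) sph_unit //.
  by ij2; rewrite mxE /=; zl.
by rewrite det2 !mxE /= mulr0 sub0r mulrN1 opprK pabs1.
Qed.

Lemma hecke0 : (fun g => \sum_(u < l) rtrans (low u%:R) (ee 1) g + rtrans wmx (ee 1) g) =
  (fun g => l%:R * (1 + c) * ee 0 g).
Proof.
apply/funext => g; rewrite sphn0 sphn_swap.
have H := sph_hecke hl hchi hpsi uchi upsi psi_l g.
suff -> : \sum_(u < l) rtrans (low u%:R) (ee 1) g =
    \sum_(u < l) sph (g *m (low u%:R *m dg 1 l%:R)) by exact: H.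
by apply: eq_bigr => u _; rewrite /rtrans /sphn expr1 mulmxA.
Qed.

Lemma heckeS n : (fun g => \sum_(u < l) rtrans (low (l%:R ^+ n.+1 * u%:R)) (ee n.+2) g +
    c * l%:R * ee n g) = (fun g => l%:R * (1 + c) * ee n.+1 g).
Proof.
apply/funext => g.
have H := sph_hecke hl hchi hpsi uchi upsi psi_l (g *m dg 1 (l%:R ^+ n.+1)).
have -> : \sum_(u < l) rtrans (low (l%:R ^+ n.+1 * u%:R)) (ee n.+2) g =
    \sum_(u < l) sph (g *m dg 1 (l%:R ^+ n.+1) *m (low u%:R *m dg 1 l%:R)).
  apply: eq_bigr => u _; rewrite /rtrans /sphn.
  have -> : g *m low (l%:R ^+ n.+1 * u%:R) *m dg 1 (l%:R ^+ n.+2) =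
     g *m dg 1 (l%:R ^+ n.+1) *m (low u%:R *m dg 1 l%:R); last by [].
  rewrite -!mulmxA; congr (_ *m _); rewrite [_ ^+ n.+2]exprS.
  by move: (l%:R ^+ n.+1) => X; mx2; ring.
have -> : c * l%:R * ee n g = sph (g *m dg 1 (l%:R ^+ n.+1) *m dg l%:R 1); last exact: H.
rewrite -chi_psi_l -(sph_scale hl hchi hpsi uchi upsi); last exact: lF_neq0.
have -> : g *m dg 1 (l%:R ^+ n) *m dg l%:R l%:R = g *m dg 1 (l%:R ^+ n.+1) *m dg l%:R 1; last by [].
rewrite -!mulmxA; congr (_ *m _); rewrite exprS.
by move: (l%:R ^+ n) => X; mx2; ring.
Qed.

Variable Phi : ('M[F]_2 -> R[i]) -> R[i].
Hypothesis Phi_lin : forall a p1 p2, ind p1 -> ind p2 ->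
  Phi (fun g => a * p1 g + p2 g) = a * Phi p1 + Phi p2.

Lemma Phi0 : Phi (fun=> 0) = 0.
Proof.
have := Phi_lin 1 (ind_0 chi psi) (ind_0 chi psi).
rewrite (_ : (fun g => _) = (fun=> 0)); last by apply/funext => g; rewrite mulr0 addr0.
by rewrite mul1r -[X in X = _]addr0 => /addrI <-.
Qed.

Lemma Phi_scale a p : ind p -> Phi (fun g => a * p g) = a * Phi p.
Proof.
move=> hp; rewrite -[RHS]addr0 -Phi0 -Phi_lin //; last exact: ind_0.
by congr Phi; apply/funext => g; rewrite addr0.
Qed.

Lemma Phi_add p1 p2 : ind p1 -> ind p2 -> Phi (fun g => p1 g + p2 g) = Phi p1 + Phi p2.
Proof.
move=> h1 h2; rewrite -[Phi p1]mul1r -Phi_lin //.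
by congr Phi; apply/funext => g; rewrite mul1r.
Qed.

Lemma Phi_sum (I : Type) (r : seq I) (p : I -> 'M[F]_2 -> R[i]) : (forall i, ind (p i)) ->
  Phi (fun g => \sum_(i <- r) p i g) = \sum_(i <- r) Phi (p i).
Proof.
move=> hp; elim: r => [|i r IH].
  by rewrite [RHS]big_nil -[RHS]Phi0; congr Phi; apply/funext => g; rewrite big_nil.
rewrite big_cons -IH -Phi_add //; last exact: ind_sum.
by congr Phi; apply/funext => g; rewrite big_cons.
Qed.

Lemma low_GL2 x : GL2 (low x : 'M[F]_2).
Proof. by rewrite GL2E det2 !mxE /= mul1r mul0r subr0 oner_eq0. Qed.

Lemma wmx_GL2 : GL2 wmx.
Proof. by rewrite GL2E det2 !mxE /= mulr0 sub0r mulrN1 opprK oner_eq0. Qed.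

Lemma Phi_hecke0 : \sum_(u < l) Phi (rtrans (low u%:R) (ee 1)) + Phi (rtrans wmx (ee 1)) =
  l%:R * (1 + c) * Phi (ee 0).
Proof.
have i1 u : ind (rtrans (low u%:R) (ee 1)).
  by apply: ind_rtrans => //; [exact: low_GL2|exact: sphn_ind].
rewrite -Phi_scale; last exact: sphn_ind.
rewrite -hecke0 Phi_add ?Phi_sum //; first exact: ind_sum.
by apply: ind_rtrans => //; [exact: wmx_GL2|exact: sphn_ind].
Qed.

Hypothesis Phi_inv : forall k p, integral_mx k -> \det k = 1 -> ind p ->
  Phi (rtrans k p) = Phi p.

Lemma Phi_low x n : x \in Zl -> Phi (rtrans (low x) (ee n)) = Phi (ee n).
Proof.
move=> hx; apply: Phi_inv; last exact: sphn_ind.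
  by ij2; rewrite mxE /=; zl.
by rewrite det2 !mxE /= mul0r subr0 mulr1.
Qed.

Lemma Phi_step0 : (l%:R + 1) * Phi (ee 1) = l%:R * (1 + c) * Phi (ee 0).
Proof.
rewrite -Phi_hecke0 (eq_bigr (fun _ => Phi (ee 1))); last first.
  by move=> u _; apply: Phi_low; rewrite rpred_nat.
rewrite sumr_const card_ord Phi_inv; last exact: sphn_ind.
- by rewrite mulrDl mul1r mulr_natl.
- by ij2; rewrite mxE /=; zl.
- by rewrite det2 !mxE /= mulr0 sub0r mulrN1 opprK.
Qed.

Lemma Phi_step n : l%:R * Phi (ee n.+2) + c * l%:R * Phi (ee n) =
  l%:R * (1 + c) * Phi (ee n.+1).
Proof.
rewrite -[RHS]Phi_scale; last exact: sphn_ind.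
have i1 u : ind (rtrans (low (l%:R ^+ n.+1 * u%:R)) (ee n.+2)).
  by apply: ind_rtrans => //; [exact: low_GL2|exact: sphn_ind].
have i2 : ind (fun g => c * l%:R * ee n g).
  rewrite (_ : (fun g => _) = (fun g => c * l%:R * ee n g + (fun=> 0) g)).
    by apply: ind_add => //; [exact: sphn_ind|exact: ind_0].
  by apply/funext => g; rewrite addr0.
rewrite -heckeS Phi_add ?Phi_sum //; last exact: ind_sum.
rewrite Phi_scale; last exact: sphn_ind.
have E u : Phi (rtrans (low (l%:R ^+ n.+1 * u%:R)) (ee n.+2)) = Phi (ee n.+2).
  by apply: Phi_low; rewrite rpredM ?rpredX ?l_Zl ?rpred_nat.
under eq_bigr => u _ do rewrite E.
by rewrite sumr_const card_ord mulr_natl.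
Qed.

Lemma Phi_diff n : Phi (ee n.+1) - Phi (ee n) =
  c ^+ n * ((l%:R * c - 1) / (l%:R + 1)) * Phi (ee 0).
Proof.
have lC : l%:R != 0 :> R[i] by rewrite pnatr_eq0 eqn0Ngt prime_gt0.
have l1 : l%:R + 1 != 0 :> R[i] by rewrite -mulrSr pnatr_eq0.
exact: (recursion_diff (x := fun m => Phi (ee m)) lC l1 Phi_step0 Phi_step).
Qed.

End HeckeRecursion.

Lemma sum_pairE (V : nmodType) (I J : finType) (f : I * J -> V) :
  \sum_p f p = \sum_i \sum_j f (i, j).
Proof. by rewrite pair_bigA; apply: eq_bigr => -[]. Qed.

Lemma sum_fst (K : pzSemiRingType) (I J : finType) (f : I -> K) :
  \sum_(p : I * J) f p.1 = #|J|%:R * \sum_i f i.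
Proof.
rewrite sum_pairE mulr_sumr; apply: eq_bigr => i _ /=.
by rewrite sumr_const mulr_natl.
Qed.

Lemma sum_snd (K : pzSemiRingType) (I J : finType) (f : J -> K) :
  \sum_(p : I * J) f p.2 = #|I|%:R * \sum_j f j.
Proof. by rewrite sum_pairE /= sumr_const mulr_natl. Qed.

Lemma sum_if0 (K : pzRingType) (l : nat) (x y : K) : (0 < l)%N ->
  \sum_(u < l) (if (u : nat) == 0%N then x else y) = x + (l%:R - 1) * y.
Proof.
case: l => // l _; rewrite big_ord_recl /=; congr (_ + _).
by rewrite sumr_const card_ord -[l.+1]addn1 natrD addrK mulr_natl.
Qed.

(** * The invariant form *)

Section Pairing.
Context {l : nat} {R : realType} {F : padicType l R}.
Hypothesis hl : prime l.
Variables nu1 nu2 rho chi1 chi2 psi1 psi2 : F -> R[i].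
Hypothesis hnu1 : is_char nu1.
Hypothesis hnu2 : is_char nu2.
Hypothesis hrho : is_char rho.
Notation PS := (principal_series nu1 nu2 rho).
Notation ind1 := (indGL2 chi1 psi1).
Notation ind2 := (indGL2 chi2 psi2).
Variable z : ('M[F]_2 * 'M[F]_2 -> R[i]) -> ('M[F]_4 -> R[i]) -> R[i].
Hypothesis hz : invariant_bilinear (indH chi1 chi2 psi1 psi2) PS z.

Definition pairing (p p' : 'M[F]_2 -> R[i]) v := z (restrH (fun h => p h.1 * p' h.2)) v.

Lemma tensor_indH p p' : ind1 p -> ind2 p' ->
  indH chi1 chi2 psi1 psi2 (restrH (fun h => p h.1 * p' h.2)).
Proof.
move=> hp hp'; exists 1%N, (fun=> p), (fun=> p'); split=> //.
by apply/funext => h; rewrite /restrH big_ord_recl big_ord0 addr0.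
Qed.

Lemma pairing_linl p' v a p1 p2 : ind2 p' -> PS v -> ind1 p1 -> ind1 p2 ->
  pairing (fun g => a * p1 g + p2 g) p' v = a * pairing p1 p' v + pairing p2 p' v.
Proof.
move=> h' hv h1 h2; case: hz => lin _ _.
have H := lin a _ _ v (tensor_indH h1 h') (tensor_indH h2 h') hv.
rewrite /pairing -H; congr (z _ v); apply/funext => h; rewrite /restrH.
by case: ifP => _; [ring|rewrite mulr0 addr0].
Qed.

Lemma pairing_linr p v a p1 p2 : ind1 p -> PS v -> ind2 p1 -> ind2 p2 ->
  pairing p (fun g => a * p1 g + p2 g) v = a * pairing p p1 v + pairing p p2 v.
Proof.
move=> h' hv h1 h2; case: hz => lin _ _.
have H := lin a _ _ v (tensor_indH h' h1) (tensor_indH h' h2) hv.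
rewrite /pairing -H; congr (z _ v); apply/funext => h; rewrite /restrH.
by case: ifP => _; [ring|rewrite mulr0 addr0].
Qed.

Lemma pairing_diff a a' p1 p2 q1 q2 v :
  ind1 p1 -> ind1 p2 -> ind2 q1 -> ind2 q2 -> PS v ->
  pairing (fun g => a * (p1 g - p2 g)) (fun g => a' * (q1 g - q2 g)) v =
  a * a' * (pairing p1 q1 v - pairing p1 q2 v - (pairing p2 q1 v - pairing p2 q2 v)).
Proof.
move=> hp1 hp2 hq1 hq2 hv.
have hq : ind2 (fun g => a' * (q1 g - q2 g)).
  rewrite (_ : (fun g => _) = (fun g => a' * q1 g + (fun g => - a' * q2 g + (fun=> 0) g) g)).
    by apply: ind_add => //; apply: ind_add => //; exact: ind_0.
  by apply/funext => g; rewrite addr0; ring.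
have zl q : ind2 q -> pairing (fun=> 0) q v = 0.
  move=> h; have := @pairing_linl q v 1 _ _ h hv (ind_0 chi1 psi1) (ind_0 chi1 psi1).
  rewrite (_ : (fun g => _) = (fun=> 0)); last by apply/funext => g; rewrite mulr0 addr0.
  by rewrite mul1r -[X in X = _]addr0 => /addrI <-.
have zr p : ind1 p -> pairing p (fun=> 0) v = 0.
  move=> h; have := @pairing_linr p v 1 _ _ h hv (ind_0 chi2 psi2) (ind_0 chi2 psi2).
  rewrite (_ : (fun g => _) = (fun=> 0)); last by apply/funext => g; rewrite mulr0 addr0.
  by rewrite mul1r -[X in X = _]addr0 => /addrI <-.
have El q : ind2 q -> pairing (fun g => a * (p1 g - p2 g)) q v = a * (pairing p1 q v - pairing p2 q v).
  move=> h; rewrite (_ : (fun g => _) = (fun g => a * p1 g + (fun g => - a * p2 g + (fun=> 0) g) g)).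
    rewrite pairing_linl //; last by apply: ind_add => //; exact: ind_0.
    by rewrite pairing_linl ?zl //; [ring|exact: ind_0].
  by apply/funext => g; rewrite addr0; ring.
have Er p : ind1 p -> pairing p (fun g => a' * (q1 g - q2 g)) v = a' * (pairing p q1 v - pairing p q2 v).
  move=> h; rewrite (_ : (fun g => _) = (fun g => a' * q1 g + (fun g => - a' * q2 g + (fun=> 0) g) g)).
    rewrite pairing_linr //; last by apply: ind_add => //; exact: ind_0.
    by rewrite pairing_linr ?zr //; [ring|exact: ind_0].
  by apply/funext => g; rewrite addr0; ring.
by rewrite El // !Er //; ring.
Qed.

Lemma pairing_scale a a' p q v : ind1 p -> ind2 q -> PS v ->
  pairing (fun g => a * p g) (fun g => a' * q g) v = a * a' * pairing p q v.
Proof.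
move=> hp hq hv.
have z1 : ind1 (fun=> 0) by exact: ind_0.
have z2 : ind2 (fun=> 0) by exact: ind_0.
have H := pairing_diff a a' hp z1 hq z2 hv.
have Z p' q' : (p' = fun=> 0) \/ (q' = fun=> 0) -> pairing p' q' v = pairing (fun=> 0) (fun=> 0) v.
  by case=> ->; congr (z _ v); apply/funext => h; rewrite /restrH ?mul0r ?mulr0.
have Z0 : pairing (fun=> 0) (fun=> 0) v = 0.
  have := @pairing_linl _ v 1 _ _ z2 hv z1 z1.
  rewrite (_ : (fun g => _) = (fun=> 0)); last by apply/funext => g; rewrite mulr0 addr0.
  by rewrite mul1r -[X in X = _]addr0 => /addrI <-.
have Z1 : pairing p (fun=> 0) v = 0 by rewrite Z //; right.
have Z2 : pairing (fun=> 0) q v = 0 by rewrite Z //; left.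
move: H; rewrite Z1 Z2 Z0 !subr0 => <-; congr pairing; apply/funext => g; by rewrite subr0.
Qed.

Lemma pairing0 p p' : ind1 p -> ind2 p' -> pairing p p' (fun=> 0) = 0.
Proof.
move=> hp hp'; case: hz => _ lin _.
have H := lin 1 _ _ _ (tensor_indH hp hp') (PS0 nu1 nu2 rho) (PS0 nu1 nu2 rho).
have E : (fun g : 'M[F]_4 => 1 * (0 : R[i]) + 0) = (fun=> 0).
  by apply/funext => g; rewrite mulr0 addr0.
move: H; rewrite /= E -/(pairing p p' _) mul1r -[X in X = _]addr0.
by move=> /addrI <-.
Qed.

Lemma pairing_sum p p' (I : Type) (r : seq I) (v : I -> 'M[F]_4 -> R[i]) :
  ind1 p -> ind2 p' -> (forall i, PS (v i)) ->
  pairing p p' (fun g => \sum_(i <- r) v i g) = \sum_(i <- r) pairing p p' (v i).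
Proof.
move=> hp hp' hv; case: hz => _ lin _; have lin' := lin _ _ _ _ (tensor_indH hp hp').
elim: r => [|i r IH].
  rewrite big_nil -[RHS](pairing0 hp hp').
  by congr (z _ _); apply/funext => g; rewrite big_nil.
rewrite big_cons -IH -[pairing p p' (v i)]mul1r.
have H := lin' 1 _ _ (hv i) (PS_sum r hv); rewrite -[RHS]H.
by congr (z _ _); apply/funext => g; rewrite big_cons mul1r.
Qed.

Lemma Hgrp_mul (g h : 'M[F]_2 * 'M[F]_2) : Hgrp h -> Hgrp (g.1 *m h.1, g.2 *m h.2) = Hgrp g.
Proof.
case: g h => g1 g2 [h1 h2] /and3P[/= H1 H2 /eqP e]; rewrite /Hgrp /= !GL2_mul H1 H2 !andbT.
rewrite !det_mulmx e; congr [&& _, _ & _]; apply/eqP/eqP => [|-> //].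
by apply: mulIf; rewrite -GL2E.
Qed.

Variable v0 : 'M[F]_4 -> R[i].
Hypothesis hv0 : PS v0.
Hypothesis v0K : forall k, Kg k -> rtrans k v0 = v0.
Notation B p p' g := (pairing p p' (rtrans g v0)).

Lemma pairing_inv h1 h2 p p' g : GL2 h1 -> \det h2 = \det h1 -> GSp4 g -> ind1 p -> ind2 p' ->
  B (rtrans h1 p) (rtrans h2 p') (iota_H (h1, h2) *m g) = B p p' g.
Proof.
move=> H1 e hg hp hp'; case: hz => _ _ inv.
have H : Hgrp (h1, h2) by rewrite /Hgrp /= H1 e eqxx GL2E e -GL2E H1.
have E := inv (h1, h2) _ _ H (tensor_indH hp hp') (PS_rtrans hl hg hv0).
rewrite -[RHS]E /pairing; congr z.
  apply/funext => x; rewrite /rtransH /restrH Hgrp_mul // /rtrans /=.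
by apply/funext => x; rewrite /rtrans mulmxA.
Qed.

Lemma pairing_Kg p p' g k : Kg k -> B p p' (g *m k) = B p p' g.
Proof.
move=> hk; congr (z _ _); apply/funext => x; rewrite /rtrans mulmxA.
by rewrite -[in RHS](v0K hk).
Qed.

Lemma pairing_hecke p p' (I : finType) (rep : I -> 'M[F]_4) (lam : R[i]) :
  ind1 p -> ind2 p' -> (forall i, GSp4 (rep i)) ->
  (forall g, \sum_i v0 (g *m rep i) = lam * v0 g) ->
  \sum_i B p p' (rep i) = lam * B p p' 1%:M.
Proof.
move=> hp hp' hrep e.
rewrite -pairing_sum //; last by move=> i; exact: PS_rtrans.
have E1 : rtrans 1%:M v0 = v0 by apply/funext => g; rewrite /rtrans mulmx1.
case: hz => _ lin _.
have := lin lam _ _ _ (tensor_indH hp hp') hv0 (PS0 nu1 nu2 rho).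
rewrite -/(pairing p p' _) -/(pairing p p' _) -/(pairing p p' _) (pairing0 hp hp') addr0 E1 => H.
rewrite -[RHS]H; congr (z _ _); apply/funext => g.
by rewrite addr0 -e; apply: eq_bigr.
Qed.

Lemma Kg_iota (h1 h2 : 'M[F]_2) : integral_mx h1 -> integral_mx h2 -> pabs (\det h1) = 1 ->
  \det h2 = \det h1 -> Kg (iota_H (h1, h2)).
Proof.
move=> i1 i2 hd e; split; last by exists (\det h1) => //; exact: iota_sp.
ij4; rewrite mxE /=; first
  [exact: i1|exact: i2|exact: rpred0].
Qed.

End Pairing.

Lemma sum_const (K : pzSemiRingType) (I : finType) (x : K) : \sum_(i : I) x = #|I|%:R * x.
Proof. by rewrite sumr_const mulr_natl. Qed.

Section HeckeEigenvalues.
Context {l : nat} {R : realType} {F : padicType l R}.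
Hypothesis hl : prime l.
Variables nu1 nu2 rho : F -> R[i].
Hypothesis hnu1 : is_char nu1.
Hypothesis hnu2 : is_char nu2.
Hypothesis hrho : is_char rho.
Notation PS := (principal_series nu1 nu2 rho).
Variable v0 : 'M[F]_4 -> R[i].
Hypothesis hv0 : PS v0.
Hypothesis v0K : forall k, Kg k -> rtrans k v0 = v0.
Notation n1 := (nu1 l%:R).
Notation n2 := (nu2 l%:R).
Notation r := (rho l%:R).
Notation s := (@sqrtl l R F).
Notation pc := (ps_char nu1 nu2 rho).

Lemma sp_GSp4 (g : 'M[F]_4) n : sp g (l%:R ^+ n) -> GSp4 g.
Proof. by move=> h; apply/GSp4P; exists (l%:R ^+ n) => //; exact: lX_neq0. Qed.

Lemma GSp4_1 : GSp4 (1%:M : 'M[F]_4).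
Proof. by apply/GSp4P; exists 1; [exact: oner_neq0|exact: sp1]. Qed.

Lemma v0_borel a b c p q x w t o : (a <= c)%N -> (b <= c)%N ->
  sp (borel_mx a b c p q x w t o) (l%:R ^+ c) ->
  v0 (borel_mx a b c p q x w t o) = pc a b c * v0 1%:M.
Proof. by move=> ac bc h; rewrite -[X in v0 X]mulmx1 (PS_borel hl hnu1 hnu2 hrho hv0 ac bc GSp4_1 h). Qed.

Lemma hecke_T g : \sum_i v0 (g *m @repT l R F i) =
  s ^+ 3 * r * (1 + n1) * (1 + n2) * v0 g.
Proof.
rewrite (hecke_eigen (c := fun i : @idxT l => match i with
  | inl (inl (inl _)) => pc 1 1 1
  | inl (inl (inr _)) => pc 1 0 1
  | inl (inr _) => pc 0 1 1
  | inr _ => pc 0 0 1 end) g hv0 v0K (@repT_S1 l R F) (@S1_Kl l R F) (S1_cover hl) (repT_inj hl)).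
- rewrite !big_sumType /= !sum_const !card_prod !card_ord card_unit.
  rewrite /ps_char !natrM.
  have l0 : l%:R != 0 :> R[i] by rewrite pnatr_eq0 eqn0Ngt prime_gt0.
  move: (nu1 _) (nu2 _) (rho _) (sqrtl) (v0 g) (l%:R : R[i]) l0 => N1 N2 P S V L L0.
  by rewrite muln0 muln1 expr0 expr1 add0n expr1 addn0; field.
- by move=> i; apply: sp_GSp4; exact: repT_sp.
- move=> i; have := @repT_sp l R F i.
  by case: i => [[[[[u v] w]|[x y]]|x]|?] h; exact: v0_borel h.
Qed.

Lemma hecke_T1 g : \sum_i v0 (g *m @repT1 l R F i) =
  r ^+ 2 * (l%:R ^+ 2 * (n1 ^+ 2 * n2 + n1 * n2 ^+ 2 + n1 + n2) +
            (l%:R ^+ 2 - 1) * n1 * n2) * v0 g.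
Proof.
rewrite (hecke_eigen (c := fun i : @idxT1 l => match i with
  | inl (inl (inl (inl (inl _)))) => pc 2 1 2
  | inl (inl (inl (inl (inr _)))) => pc 1 2 2
  | inl (inl (inl (inr _))) => pc 1 0 2
  | inl (inl (inr _)) => pc 0 1 2
  | inl (inr _) => pc 1 1 2
  | inr _ => pc 1 1 2 end) g hv0 v0K (repT1_S2 hl) (@S2_Kl l R F) (S2_cover hl) (repT1_inj hl)).
- rewrite !big_sumType /= !sum_const !card_prod !card_ord card_unit.
  have l0 : l%:R != 0 :> R[i] by rewrite pnatr_eq0 eqn0Ngt prime_gt0.
  have s2 : s ^+ 6 = l%:R ^+ 3 by rewrite -(sqrtl_sqr (F := F) hl) -exprM.
  have l1 : l.-1%:R = l%:R - 1 :> R[i] by rewrite -subn1 natrB // prime_gt0.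
  rewrite /ps_char -[(3 * 2)%N]/6%N s2 !natrM l1.
  move: (nu1 _) (nu2 _) (rho _) (v0 g) (l%:R : R[i]) l0 => N1 N2 P V L L0.
  by rewrite /= !(expr1, expr0, muln0, muln1, add0n, addn0) -?exprM /=; field.
- by move=> i; apply: sp_GSp4; exact: repT1_sp.
- move=> i; have := @repT1_sp l R F i.
  by case: i => [[[[[[[a b] c]|[a c]]|a]|?]|w]|[v u]] h; exact: v0_borel h.
Qed.

End HeckeEigenvalues.

Lemma U_algebra (K : fieldType) (L s c1 c2 n1 n2 r X a g10 g01 g11 E0 B10 B01 B11 B20 B02 B12 B21 B22
    bs S10 S01 S11 bo bi bm A11 A10 A01 A00 : K) :
  s ^+ 2 = L -> s != 0 -> L - 1 != 0 -> L + 1 != 0 ->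
  c1 != 0 -> n1 != 0 -> n2 != 0 -> r != 0 ->
  c1 * c2 * L ^+ 2 * n1 * n2 * r ^+ 2 = 1 ->
  B10 - X = c1 ^+ 0 * ((L * c1 - 1) / (L + 1)) * X ->
  B01 - X = c2 ^+ 0 * ((L * c2 - 1) / (L + 1)) * X ->
  B11 - B01 = c1 ^+ 0 * ((L * c1 - 1) / (L + 1)) * B01 ->
  B20 - B10 = c1 ^+ 1 * ((L * c1 - 1) / (L + 1)) * X ->
  B02 - B01 = c2 ^+ 1 * ((L * c2 - 1) / (L + 1)) * X ->
  B22 - B21 - (B12 - B11) =
    c1 ^+ 1 * ((L * c1 - 1) / (L + 1)) * (c2 ^+ 1 * ((L * c2 - 1) / (L + 1)) * X) ->
  bs = (c1 * L)^-1 * (c2 * L)^-1 * B11 ->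
  S10 = (c1 * L)^-1 * (c2 * L)^-1 * B21 ->
  S01 = (c1 * L)^-1 * (c2 * L)^-1 * B12 ->
  S11 = (c1 * L)^-1 * (c2 * L)^-1 * B22 ->
  bo = (c1 * L)^-1 ^+ 2 * (c2 * L)^-1 * B20 ->
  bi = (c1 * L)^-1 * (c2 * L)^-1 ^+ 2 * B02 ->
  bm = (c1 * L)^-1 * (c2 * L)^-1 * E0 ->
  (L + 1) ^+ 2 * bs + L * (L ^+ 2 - 1) * a = s ^+ 3 * r * (1 + n1) * (1 + n2) * X ->
  L * (L + 1) * (bo + bi) + L * (L + 1) ^+ 2 * (L - 1) * bm =
    r ^+ 2 * (L ^+ 2 * (n1 ^+ 2 * n2 + n1 * n2 ^+ 2 + n1 + n2) + (L ^+ 2 - 1) * n1 * n2) * X ->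
  (L + 1) * g10 = L * (1 + c1) * a ->
  (L + 1) * g01 = L * (1 + c2) * a ->
  L * g11 + E0 = L * (1 + c1) * g01 ->
  A11 = L ^+ 2 * (S11 + (L - 1) * g11) ->
  A10 = L ^+ 2 * (S10 + (L - 1) * g10) ->
  A01 = L ^+ 2 * (S01 + (L - 1) * g01) ->
  A00 = L ^+ 2 * (bs + (L - 1) * a) ->
  (L * c1) ^- 1 * (L * c2) ^- 1 * (A11 - A10 - (A01 - A00)) =
  L / (L + 1) ^+ 2 * ((1 - (L * c1)^-1) * (1 - (L * c2)^-1) -
    (1 - r * s) * (1 - r * n1 * s) * (1 - r * n2 * s) * (1 - r * n1 * n2 * s)) * X.
Proof.
move=> hs s0 Lm Lp c10 n10 n20 r0 hc.
move=> /(canRL (subrK _)) h10 /(canRL (subrK _)) h01 /(canRL (subrK _)) h11.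
move=> /(canRL (subrK _)) h20 /(canRL (subrK _)) h02 hD.
move=> -> -> -> -> -> -> -> hT hT1 hg10 hg01 hE -> -> -> ->.
have L0 : L != 0 by rewrite -hs expf_neq0.
have solve (x y k : K) : k != 0 -> k * x = y -> x = y / k.
  by move=> k0 <-; rewrite mulrC mulKf.
have c2E : c2 = (c1 * L ^+ 2 * n1 * n2 * r ^+ 2)^-1.
  rewrite -[RHS]mul1r -hc; field.
  by rewrite ?c10 ?n10 ?n20 ?r0 ?L0.
have c20 : c2 != 0 by rewrite c2E invr_eq0 !mulf_neq0 ?expf_neq0.
have -> : L ^+ 2 * ((c1 * L)^-1 * (c2 * L)^-1 * B22 + (L - 1) * g11) -
    L ^+ 2 * ((c1 * L)^-1 * (c2 * L)^-1 * B21 + (L - 1) * g10) -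
    (L ^+ 2 * ((c1 * L)^-1 * (c2 * L)^-1 * B12 + (L - 1) * g01) -
     L ^+ 2 * ((c1 * L)^-1 * (c2 * L)^-1 * B11 + (L - 1) * a)) =
  L ^+ 2 * ((c1 * L)^-1 * (c2 * L)^-1 * (B22 - B21 - (B12 - B11)) +
    (L - 1) * (g11 - g10 - (g01 - a))) by ring.
rewrite hD; move: hT1 hT; rewrite h20 h02 h10 h11 h01 => hT1 hT.
have L21 : L ^+ 2 - 1 != 0 by rewrite -[1](expr1n _ 2) subr_sqr mulf_neq0.
have k1 : L * (L ^+ 2 - 1) != 0 by rewrite mulf_neq0.
have aE : a = (s ^+ 3 * r * (1 + n1) * (1 + n2) * X -
   (1 + c1) * (1 + c2) * X / (c1 * c2)) / (L * (L ^+ 2 - 1)).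
  apply: (solve _ _ _ k1); rewrite -hT; field.
  by rewrite c20 c10 L0 Lp.
have k2 : (L + 1) ^+ 2 * (L - 1) / (c1 * c2 * L) != 0.
  by do ?(apply: mulf_neq0); rewrite ?invr_eq0 ?expf_neq0 //; do ?(apply: mulf_neq0).
have EE : E0 = (r ^+ 2 * (L ^+ 2 * (n1 ^+ 2 * n2 + n1 * n2 ^+ 2 + n1 + n2) +
      (L ^+ 2 - 1) * n1 * n2) * X
  - ((L * (1 + c1) + c1 * (L * c1 - 1)) * X / (c1 ^+ 2 * c2 * L ^+ 2) +
     (L * (1 + c2) + c2 * (L * c2 - 1)) * X / (c1 * c2 ^+ 2 * L ^+ 2)))
    / ((L + 1) ^+ 2 * (L - 1) / (c1 * c2 * L)).
  apply: (solve _ _ _ k2); rewrite -hT1; field.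
  by rewrite c20 c10 L0 Lp.
have gE : g11 = (L * (1 + c1) * g01 - E0) / L.
  by apply: (solve _ _ _ L0); rewrite -hE; ring.
rewrite gE EE (solve _ _ _ Lp hg10) (solve _ _ _ Lp hg01) aE c2E.
clear -hs s0 L0 Lm Lp L21 c10 n10 n20 r0.
rewrite -hs in L0 Lm Lp L21 *; rewrite !expr1.
field.
by rewrite oner_eq0 ?s0 ?c10 ?n10 ?n20 ?r0 ?Lm ?Lp L21.
Qed.

Lemma sub_sub_mulr (K : pzRingType) (b11 b10 b01 b00 k x y : K) :
  b11 - b01 = k * x -> b10 - b00 = k * y -> b11 - b10 - (b01 - b00) = k * (x - y).
Proof.
by move=> e1 e2; rewrite mulrBr -e1 -e2 !opprB !addrA [LHS]addrAC [RHS]addrAC (addrAC b11).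
Qed.

Lemma level_algebra (K : fieldType) (q c1 c2 S X : K) t :
  q != 0 -> q + 1 != 0 -> c1 != 0 -> c2 != 0 ->
  S = c1 ^+ t * ((q * c1 - 1) / (q + 1)) * (c2 ^+ t * ((q * c2 - 1) / (q + 1)) * X) ->
  (q * c1) ^- t.+1 * (q * c2) ^- t.+1 * S =
  (q ^+ (2 * t.+1 - 2) * (q + 1) ^+ 2)^-1 * ((1 - (q * c1)^-1) * (1 - (q * c2)^-1)) * X.
Proof.
move=> q0 q1 c10 c20 ->.
have -> : (2 * t.+1 - 2 = t * 2)%N by lia.
rewrite exprM !exprS !exprMn.
have ct1 : c1 ^+ t != 0 by rewrite expf_neq0.
have ct2 : c2 ^+ t != 0 by rewrite expf_neq0.
have qt : q ^+ t != 0 by rewrite expf_neq0.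
move: (c1 ^+ t) (c2 ^+ t) (q ^+ t) ct1 ct2 qt => C1 C2 T C10 C20 T0.
by field; rewrite q0 q1 c10 c20 C10 C20 T0.
Qed.

Section Relations.
Context {l : nat} {R : realType} {F : padicType l R}.
Hypothesis hl : prime l.
Variables nu1 nu2 rho chi1 chi2 psi1 psi2 : F -> R[i].
Hypothesis hnu1 : is_char nu1.
Hypothesis hnu2 : is_char nu2.
Hypothesis hrho : is_char rho.
Hypothesis hchi1 : is_char chi1.
Hypothesis hchi2 : is_char chi2.
Hypothesis hpsi1 : is_char psi1.
Hypothesis hpsi2 : is_char psi2.
Hypothesis uchi1 : unramified chi1.
Hypothesis uchi2 : unramified chi2.
Hypothesis upsi1 : unramified psi1.
Hypothesis upsi2 : unramified psi2.
Hypothesis psi1_l : psi1 l%:R = @sqrtl l R F.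
Hypothesis psi2_l : psi2 l%:R = @sqrtl l R F.
Notation PS := (principal_series nu1 nu2 rho).
Notation ind1 := (indGL2 chi1 psi1).
Notation ind2 := (indGL2 chi2 psi2).
Variable z : ('M[F]_2 * 'M[F]_2 -> R[i]) -> ('M[F]_4 -> R[i]) -> R[i].
Hypothesis hz : invariant_bilinear (indH chi1 chi2 psi1 psi2) PS z.
Variable v0 : 'M[F]_4 -> R[i].
Hypothesis hv0 : PS v0.
Hypothesis v0K : forall k, Kg k -> rtrans k v0 = v0.
Notation B p p' g := (pairing z p p' (rtrans g v0)).
Notation e := (sphn chi1 psi1).
Notation e' := (sphn chi2 psi2).
Notation c1 := (c0 chi1).
Notation c2 := (c0 chi2).
Notation DS := (@split_rep l R F).
Notation DO := (@outer_rep l R F).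
Notation DI := (@inner_rep l R F).
Notation DM := (@mixed_rep l R F).
Notation G := (@graph_rep l R F).
Notation om1 := (c0 chi1 * l%:R).
Notation om2 := (c0 chi2 * l%:R).

Let e_ind n : ind1 (e n).
Proof. exact: sphn_ind. Qed.

Let e'_ind n : ind2 (e' n).
Proof. exact: sphn_ind. Qed.

Lemma unit_GL2 (k : 'M[F]_2) : pabs (\det k) = 1 -> GL2 k.
Proof. by move=> h; rewrite GL2E pabs_unit_neq0. Qed.

Let PSr g : GSp4 g -> PS (rtrans g v0).
Proof. by move=> h; exact: PS_rtrans. Qed.

Lemma rtrans1 n (f : 'M[F]_n -> R[i]) : rtrans 1%:M f = f.
Proof. by apply/funext => x; rewrite /rtrans mulmx1. Qed.

Lemma integral1 : integral_mx (1%:M : 'M[F]_2).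
Proof. by move=> i j; rewrite mxE rpred_nat. Qed.

Lemma level1_left p' n : ind2 p' -> B (e n.+1) p' 1%:M - B (e n) p' 1%:M =
  c1 ^+ n * ((l%:R * c1 - 1) / (l%:R + 1)) * B (e 0) p' 1%:M.
Proof.
move=> hp'; have P1 := PSr GSp4_1.
apply: (Phi_diff hl hchi1 hpsi1 uchi1 upsi1 psi1_l (Phi := fun p => B p p' 1%:M)).
  by move=> a p1 p2 h1 h2; exact: (pairing_linl hz).
move=> k p ki dk hp; have d1 : pabs (\det k) = 1 by rewrite dk pabs1.
have E : \det (1%:M : 'M[F]_2) = \det k by rewrite det1 dk.
rewrite -[RHS](pairing_inv hl hz hv0 (unit_GL2 d1) E GSp4_1 hp hp') !rtrans1 mulmx1.
by rewrite -[iota_H _]mul1mx (pairing_Kg _ v0K _ _ _ (Kg_iota ki integral1 d1 E)) rtrans1.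
Qed.

Lemma level1_right p n : ind1 p -> B p (e' n.+1) 1%:M - B p (e' n) 1%:M =
  c2 ^+ n * ((l%:R * c2 - 1) / (l%:R + 1)) * B p (e' 0) 1%:M.
Proof.
move=> hp; have P1 := PSr GSp4_1.
apply: (Phi_diff hl hchi2 hpsi2 uchi2 upsi2 psi2_l (Phi := fun p' => B p p' 1%:M)).
  by move=> a p1 p2 h1 h2; exact: (pairing_linr hz).
move=> k p' ki dk hp'; have d1 : pabs (\det (1%:M : 'M[F]_2)) = 1 by rewrite det1 pabs1.
have E : \det k = \det (1%:M : 'M[F]_2) by rewrite det1 dk.
rewrite -[RHS](pairing_inv hl hz hv0 (unit_GL2 d1) E GSp4_1 hp hp') !rtrans1 mulmx1.
by rewrite -[iota_H _]mul1mx (pairing_Kg _ v0K _ _ _ (Kg_iota integral1 ki d1 E)) rtrans1.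
Qed.


Let gG : GSp4 G.
Proof. exact: (@sp_GSp4 l R F hl _ 1 graph_rep_sp). Qed.

Definition swapmx (k : 'M[F]_2) : 'M[F]_2 :=
  mx_of 2 [:: [:: k 1 1; k 1 0]; [:: k 0 1; k 0 0]].

Lemma swapmx_det k : \det (swapmx k) = \det k.
Proof. by rewrite !det2 !mxE /=; ring. Qed.

Lemma swapmxK k : swapmx (swapmx k) = k.
Proof.
apply/matrixP => -[[|[|?]] hi] [[|[|?]] hj] //; rewrite !mxE /=; congr (k _ _); exact: val_inj.
Qed.

Lemma swapmx_integral k : integral_mx k -> integral_mx (swapmx k).
Proof. by move=> h -[[|[|?]] ?] [[|[|?]] ?] //; rewrite mxE /=. Qed.

Lemma mx2_eta (k : 'M[F]_2) : k = mx_of 2 [:: [:: k 0 0; k 0 1]; [:: k 1 0; k 1 1]].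
Proof. by apply/matrixP => -[[|[|?]] hi] [[|[|?]] hj] //; rewrite !mxE /=; congr (k _ _); exact: val_inj. Qed.

(* The stabiliser of the coset of graph_rep contains the twisted diagonal. *)
Lemma graph_commute (k : 'M[F]_2) : integral_mx k -> pabs (\det k) = 1 ->
  exists2 k', Kg k' & iota_H (k, swapmx k) *m G = G *m k'.
Proof.
move=> ki dk; have d0 := pabs_unit_neq0 dk; have l0 := @lF_neq0 l R F hl.
pose k' : 'M[F]_4 := mx_of 4
  [:: [:: k 0 0; - k 0 1; 0; 0]; [:: - k 1 0; k 1 1; 0; 0];
      [:: 0; l%:R * k 0 1; k 0 0; k 0 1]; [:: l%:R * k 1 0; 0; k 1 0; k 1 1]].
have E : iota_H (k, swapmx k) *m G = G *m k'.
  rewrite [in LHS](mx2_eta k) /swapmx !mxE /= iota_mx_of /graph_rep /borel_mx /k' !mul_mx_of4 // /mul_rows /=.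
  congr (mx_of _ [:: [:: _; _; _; _]; [:: _; _; _; _]; [:: _; _; _; _]; [:: _; _; _; _]]);
    rewrite /= ?expr0 ?expr1; ring.
exists k' => //; have hG := @graph_rep_sp l R F.
split.
  have lZ := @l_Zl l R F.
  ij4; rewrite mxE /= ?rpredN;
    try exact: ki; try exact: rpred0; by rewrite rpredM.
exists ((l%:R ^+ 1)^-1 * (\det k * l%:R ^+ 1)).
  by rewrite expr1 mulrC mulfK.
have lX := @lX_neq0 l R F hl 1.
have -> : k' = sp_inv G (l%:R ^+ 1) *m (iota_H (k, swapmx k) *m G).
  by rewrite E mulmxA sp_invl // mul1mx.
apply: sp_mul; first exact: sp_invP.
by apply: sp_mul => //; apply: iota_sp => //=; rewrite swapmx_det.
Qed.

Lemma rtrans_sphn0 chi psi (k : 'M[F]_2) : is_char chi -> is_char psi ->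
  unramified chi -> unramified psi -> integral_mx k -> pabs (\det k) = 1 ->
  rtrans k (sphn chi psi 0) = sphn chi psi 0.
Proof. by move=> h1 h2 h3 h4 h5 h6; rewrite sphn0; exact: sph_unit. Qed.

Lemma graph_inv k p p' : integral_mx k -> pabs (\det k) = 1 -> ind1 p -> ind2 p' ->
  B (rtrans k p) (rtrans (swapmx k) p') G = B p p' G.
Proof.
move=> ki d1 hp hp'.
have H := pairing_inv hl hz hv0 (unit_GL2 d1) (swapmx_det k) gG hp hp'.
by have [k' hk' E] := graph_commute ki d1; rewrite -H E (pairing_Kg _ v0K _ _ _ hk').
Qed.

Lemma graph_left_inv k p : integral_mx k -> \det k = 1 -> ind1 p ->
  B (rtrans k p) (e' 0) G = B p (e' 0) G.
Proof.
move=> ki dk hp; have d1 : pabs (\det k) = 1 by rewrite dk pabs1.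
have d2 : pabs (\det (swapmx k)) = 1 by rewrite swapmx_det.
have E := rtrans_sphn0 hchi2 hpsi2 uchi2 upsi2 (swapmx_integral ki) d2.
by rewrite -[RHS](graph_inv ki d1 hp (e'_ind 0)) E.
Qed.

Lemma graph_right_inv k p' : integral_mx k -> \det k = 1 -> ind2 p' ->
  B (e 0) (rtrans k p') G = B (e 0) p' G.
Proof.
move=> ki dk hp; have d1 : pabs (\det (swapmx k)) = 1 by rewrite swapmx_det dk pabs1.
have ki' := swapmx_integral ki.
have E := rtrans_sphn0 hchi1 hpsi1 uchi1 upsi1 ki' d1.
by rewrite -[RHS](graph_inv ki' d1 (e_ind 0) hp) E swapmxK.
Qed.

Lemma graph_left : (l%:R + 1) * B (e 1) (e' 0) G = l%:R * (1 + c1) * B (e 0) (e' 0) G.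
Proof.
apply: (Phi_step0 hl hchi1 hpsi1 uchi1 upsi1 psi1_l (Phi := fun p => B p (e' 0) G)).
  by move=> a p1 p2 h1 h2; exact: (pairing_linl hz a (e'_ind 0) (PSr gG) h1 h2).
by move=> k p; exact: graph_left_inv.
Qed.

Lemma graph_right : (l%:R + 1) * B (e 0) (e' 1) G = l%:R * (1 + c2) * B (e 0) (e' 0) G.
Proof.
apply: (Phi_step0 hl hchi2 hpsi2 uchi2 upsi2 psi2_l (Phi := fun p' => B (e 0) p' G)).
  by move=> a p1 p2 h1 h2; exact: (pairing_linr hz a (e_ind 0) (PSr gG) h1 h2).
by move=> k p; exact: graph_right_inv.
Qed.

Lemma graph_low u : u \in Zl -> B (rtrans (low u) (e 1)) (e' 1) G = B (e 1) (e' 1) G.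
Proof.
move=> hu; have d1 : \det (low u) = 1 by rewrite det2 !mxE /= mul1r mul0r subr0.
have ki : integral_mx (low u).
  by ij2; rewrite mxE /=; zl.
have du : pabs (\det (low u)) = 1 by rewrite d1 pabs1.
have E : rtrans (swapmx (low u)) (e' 1) = e' 1.
  have -> : swapmx (low u) = upp 1 u by rewrite /swapmx !mxE.
  exact: (sphn_upp hl hchi2 hpsi2 uchi2 upsi2 1 (@pabs1 l R F) hu).
by rewrite -[RHS](graph_inv ki du (e_ind 1) (e'_ind 1)) E.
Qed.

Lemma graph_hecke : l%:R * B (e 1) (e' 1) G + B (rtrans wmx (e 1)) (e' 1) G =
  l%:R * (1 + c1) * B (e 0) (e' 1) G.
Proof.
have lin a p1 p2 : ind1 p1 -> ind1 p2 ->
    B (fun g => a * p1 g + p2 g) (e' 1) G = a * B p1 (e' 1) G + B p2 (e' 1) G.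
  by move=> h1 h2; exact: (pairing_linl hz a (e'_ind 1) (PSr gG) h1 h2).
have H := Phi_hecke0 hl hchi1 hpsi1 uchi1 upsi1 psi1_l lin.
rewrite -[RHS]H; congr (_ + _).
rewrite (eq_bigr (fun=> B (e 1) (e' 1) G)); first by rewrite sumr_const card_ord mulr_natl.
by move=> u _; exact: graph_low (rpred_nat _ _).
Qed.

Let lF0 := @lF_neq0 l R F hl.

Lemma pairing_translate (g g' : 'M[F]_4) h1 h2 p p' q q' (a a' : R[i]) :
  GL2 h1 -> \det h2 = \det h1 -> GSp4 g -> iota_H (h1, h2) *m g = g' -> ind1 p -> ind2 p' ->
  ind1 q -> ind2 q' -> rtrans h1 p = (fun x => a * q x) -> rtrans h2 p' = (fun x => a' * q' x) ->
  B p p' g = a * a' * B q q' g'.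
Proof.
move=> H1 hd hg <- hp hp' hq hq' e1 e2.
rewrite -(pairing_inv hl hz hv0 H1 hd hg hp hp') e1 e2.
apply: (pairing_scale hz) => //; apply: PSr; rewrite GSp4_mul //.
have d0 : \det h1 != 0 by rewrite -GL2E.
by apply/GSp4P; exists (\det h1) => //; apply: iota_sp.
Qed.

Ltac diagmx := rewrite /split_rep /graph_rep /outer_rep /inner_rep /mixed_rep /borel_mx
    iota_mx_of mul_mx_of4 // /mul_rows /=; apply/matrixP; ij4;
  rewrite !mxE /= ?expr0 ?expr1; field.

Lemma dg_det (x y : F) : \det (dg x y) = x * y.
Proof. by rewrite det2 !mxE /= mulr0 subr0. Qed.

Lemma split_pairing n m : B (e n) (e' m) DS =
  om1^-1 * om2^-1 * B (e n.+1) (e' m.+1) 1%:M.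
Proof.
have lV : l%:R^-1 != 0 :> F by rewrite invr_eq0.
apply: (pairing_translate (dg_GL2 lV (oner_neq0 F)) (erefl _)
  (sp_GSp4 hl split_rep_sp) _ (e_ind n) (e'_ind m) (e_ind _) (e'_ind _)
  (sphn_shift hl hchi1 hpsi1 uchi1 upsi1 psi1_l n)
  (sphn_shift hl hchi2 hpsi2 uchi2 upsi2 psi2_l m)).
by diagmx.
Qed.

Lemma sphn_shift2 (chi psi : F -> R[i]) n : is_char chi -> is_char psi -> unramified chi -> unramified psi ->
  psi l%:R = @sqrtl l R F ->
  rtrans (dg (l%:R ^- 2) 1) (sphn chi psi n) =
  fun g => (c0 chi * l%:R)^-1 ^+ 2 * sphn chi psi n.+2 g.
Proof.
move=> h1 h2 h3 h4 h5.
have E := sphn_shift hl h1 h2 h3 h4 h5.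
apply/funext => g.
have -> : dg (l%:R ^- 2) 1 = dg l%:R^-1 1 *m dg l%:R^-1 1 :> 'M[F]_2.
  by apply/matrixP; ij2; rewrite mulmx2E !mxE /=; field.
rewrite /rtrans mulmxA -[LHS]/(rtrans (dg l%:R^-1 1) (sphn chi psi n) (g *m dg l%:R^-1 1)) E.
by rewrite -[sphn _ _ _ _]/(rtrans (dg l%:R^-1 1) (sphn chi psi n.+1) g) E mulrA.
Qed.

Lemma sphn_central (chi psi : F -> R[i]) n : is_char chi -> is_char psi -> unramified chi -> unramified psi ->
  psi l%:R = @sqrtl l R F ->
  rtrans (dg l%:R^-1 l%:R^-1) (sphn chi psi n) = fun g => (c0 chi * l%:R)^-1 * sphn chi psi n g.
Proof.
move=> h1 h2 h3 h4 h5; apply/funext => g.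
have -> : (c0 chi * l%:R)^-1 = chi l%:R^-1 * psi l%:R^-1 by rewrite (chi_psi_lV hl).
have lV : l%:R^-1 != 0 :> F by rewrite invr_eq0.
rewrite /rtrans /sphn.
have -> : g *m dg l%:R^-1 l%:R^-1 *m dg 1 (l%:R ^+ n) = g *m dg 1 (l%:R ^+ n) *m dg l%:R^-1 l%:R^-1;
  last exact: (sph_scale hl h1 h2 h3 h4 _ lV).
rewrite -!mulmxA; congr (_ *m _).
by apply/matrixP; ij2; rewrite !mulmx2E !mxE /=; ring.
Qed.

Lemma outer_pairing : B (e 0) (e' 0) DO =
  om1^-1 ^+ 2 * om2^-1 * B (e 2) (e' 0) 1%:M.
Proof.
have lV : l%:R ^- 2 != 0 :> F by rewrite invr_eq0 expf_neq0.
apply: (pairing_translate (dg_GL2 lV (oner_neq0 F)) _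
  (sp_GSp4 hl outer_rep_sp) _ (e_ind 0) (e'_ind 0) (e_ind _) (e'_ind _)
  (sphn_shift2 0 hchi1 hpsi1 uchi1 upsi1 psi1_l)
  (sphn_central 0 hchi2 hpsi2 uchi2 upsi2 psi2_l)).
  by rewrite !dg_det; field.
by diagmx.
Qed.

Lemma inner_pairing : B (e 0) (e' 0) DI =
  om1^-1 * om2^-1 ^+ 2 * B (e 0) (e' 2) 1%:M.
Proof.
have lV : l%:R^-1 != 0 :> F by rewrite invr_eq0.
apply: (pairing_translate (dg_GL2 lV lV) _
  (sp_GSp4 hl inner_rep_sp) _ (e_ind 0) (e'_ind 0) (e_ind _) (e'_ind _)
  (sphn_central 0 hchi1 hpsi1 uchi1 upsi1 psi1_l)
  (sphn_shift2 0 hchi2 hpsi2 uchi2 upsi2 psi2_l)).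
  by rewrite !dg_det; field.
by diagmx.
Qed.

Lemma mixed_pairing : B (e 0) (e' 0) DM =
  om1^-1 * om2^-1 * B (rtrans wmx (e 1)) (e' 1) G.
Proof.
have lV : l%:R^-1 != 0 :> F by rewrite invr_eq0.
have w_ind : ind1 (rtrans wmx (e 1)) by exact: (ind_rtrans hl (@wmx_GL2 l R F) (e_ind 1)).
apply: (pairing_translate (dg_GL2 (oner_neq0 F) lV) _
  (sp_GSp4 hl mixed_rep_sp) _ (e_ind 0) (e'_ind 0) w_ind (e'_ind _) _
  (sphn_shift hl hchi2 hpsi2 uchi2 upsi2 psi2_l 0)).
- by rewrite !dg_det mulrC.
- by diagmx.
rewrite (sphn_swap hl hchi1 hpsi1 uchi1 upsi1) -(sphn0 chi1 psi1).
apply/funext => g.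
have -> : dg 1 l%:R^-1 = dg l%:R 1 *m dg l%:R^-1 l%:R^-1 :> 'M[F]_2.
  by apply/matrixP; ij2; rewrite mulmx2E !mxE /=; field.
have E := sphn_central 0 hchi1 hpsi1 uchi1 upsi1 psi1_l.
by rewrite /rtrans mulmxA -[LHS]/(rtrans (dg l%:R^-1 l%:R^-1) (e 0) (g *m dg l%:R 1)) E.
Qed.

Lemma pairing_orbit g g' : GSp4 g -> same_orbit g g' ->
  B (e 0) (e' 0) g' = B (e 0) (e' 0) g.
Proof.
move=> hg [h1 [h2 [k [[i1 i2 hd hd'] hk ->]]]].
rewrite (pairing_Kg _ v0K _ _ _ hk).
have hd2 : pabs (\det h2) = 1 by rewrite hd'.
rewrite -[RHS](pairing_inv hl hz hv0 (unit_GL2 hd) hd' hg (e_ind 0) (e'_ind 0)).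
by rewrite (rtrans_sphn0 hchi1 hpsi1 uchi1 upsi1 i1 hd) (rtrans_sphn0 hchi2 hpsi2 uchi2 upsi2 i2 hd2).
Qed.

Lemma T_relation :
  (l%:R + 1) ^+ 2 * B (e 0) (e' 0) DS +
  l%:R * (l%:R ^+ 2 - 1) * B (e 0) (e' 0) G =
  @sqrtl l R F ^+ 3 * rho l%:R * (1 + nu1 l%:R) * (1 + nu2 l%:R) * B (e 0) (e' 0) 1%:M.
Proof.
have gS : GSp4 DS := sp_GSp4 hl split_rep_sp.
have grep (i : @idxT l) : GSp4 (@repT l R F i) by apply: sp_GSp4 => //; exact: repT_sp.
have H := pairing_hecke hl hz hv0 (e_ind 0) (e'_ind 0) grep
  (hecke_T hl hnu1 hnu2 hrho hv0 v0K).
rewrite -[RHS]H.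
pose f (u : 'I_l) := if (u : nat) == 0%N then B (e 0) (e' 0) DS else B (e 0) (e' 0) G.
rewrite (eq_bigr (fun i : @idxT l => match i with
   | inl (inl (inl p)) => f p.1.1
   | inl (inl (inr p)) => f p.1
   | _ => B (e 0) (e' 0) DS end)); last first.
  move=> i _; have := @repT_orbit l R F hl i.
  case: i => [[[[[u v] w]|[x y]]|x]|[]]; rewrite /f /=; try case: eqP => _;
    move=> h; by [exact: (pairing_orbit gS h)|exact: (pairing_orbit gG h)].
have f_sum : \sum_u f u = B (e 0) (e' 0) DS + (l%:R - 1) * B (e 0) (e' 0) G.
  by rewrite /f sum_if0 ?prime_gt0.
rewrite !big_sumType /= (sum_fst _ (fun p => f p.1)) !sum_fst f_sum !sum_const !card_ord card_unit.
by move: (B _ _ _) (B _ _ _) (l%:R : R[i]) => X Y L; ring.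
Qed.

Lemma T1_relation :
  l%:R * (l%:R + 1) * (B (e 0) (e' 0) DO + B (e 0) (e' 0) DI) +
  l%:R * (l%:R + 1) ^+ 2 * (l%:R - 1) * B (e 0) (e' 0) DM =
  rho l%:R ^+ 2 * (l%:R ^+ 2 * (nu1 l%:R ^+ 2 * nu2 l%:R + nu1 l%:R * nu2 l%:R ^+ 2 +
    nu1 l%:R + nu2 l%:R) + (l%:R ^+ 2 - 1) * nu1 l%:R * nu2 l%:R) * B (e 0) (e' 0) 1%:M.
Proof.
have gO : GSp4 DO := sp_GSp4 hl outer_rep_sp.
have gI : GSp4 DI := sp_GSp4 hl inner_rep_sp.
have gM : GSp4 DM := sp_GSp4 hl mixed_rep_sp.
have grep (i : @idxT1 l) : GSp4 (@repT1 l R F i) by apply: sp_GSp4 => //; exact: repT1_sp.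
have H := pairing_hecke hl hz hv0 (e_ind 0) (e'_ind 0) grep
  (hecke_T1 hl hnu1 hnu2 hrho hv0 v0K).
rewrite -[RHS]H.
pose fM (x : R[i]) (u : 'I_l) := if (u : nat) == 0%N then x else B (e 0) (e' 0) DM.
pose bO := B (e 0) (e' 0) DO; pose bI := B (e 0) (e' 0) DI.
rewrite (eq_bigr (fun i : @idxT1 l => match i with
   | inl (inl (inl (inl (inl p)))) => fM (fM bO p.1.2) p.1.1
   | inl (inl (inl (inl (inr p)))) => fM bI p.1
   | inl (inl (inl (inr a))) => fM bI a
   | inl (inl (inr _)) => bO
   | inl (inr _) => bI
   | inr p => fM bO p.2 end)); last first.
  move=> i _; have := @repT1_orbit l R F hl i.
  case: i => [[[[[[[a b] c]|[a c]]|a]|[]]|w]|[v u]]; rewrite /fM /=;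
    try (case: eqP => _ /=); try (case: eqP => _ /=);
    move=> h; by [exact: (pairing_orbit gO h)|exact: (pairing_orbit gI h)|exact: (pairing_orbit gM h)].
have f_sum x : \sum_u fM x u = x + (l%:R - 1) * B (e 0) (e' 0) DM.
  by rewrite /fM sum_if0 ?prime_gt0.
have f_sum2 : \sum_(p : 'I_l * 'I_l) fM (fM bO p.2) p.1 =
    bO + (l%:R ^+ 2 - 1) * B (e 0) (e' 0) DM.
  rewrite sum_pairE /=.
  rewrite (eq_bigr (fun a : 'I_l => if (a : nat) == 0%N then \sum_b fM bO b
     else l%:R * B (e 0) (e' 0) DM)) => [|a _].
    rewrite f_sum sum_if0 ?prime_gt0 //.
    by move: (B _ _ _) (l%:R : R[i]) => X L; ring.
  by rewrite /fM; case: eqP => _ //; rewrite sum_const card_ord.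
rewrite !big_sumType /= (sum_fst _ (fun p => fM (fM bO p.2) p.1)) sum_fst sum_snd f_sum2 !f_sum.
rewrite !sum_const !card_ord card_unit natrX.
have -> : l.-1%:R = l%:R - 1 :> R[i] by rewrite -subn1 natrB // prime_gt0.
rewrite -/bO -/bI.
by move: (B _ _ _) (bO) (bI) (l%:R : R[i]) => X Y Z L; ring.
Qed.

Lemma pairing_upp n m u a b g : pabs u = 1 -> a \in Zl -> b \in Zl -> GSp4 g ->
  B (e n) (e' m) (iota_H (upp u a, upp u b) *m g) = B (e n) (e' m) g.
Proof.
move=> hu ha hb hg.
have dd x : \det (upp u x) = u by rewrite det2 !mxE /= mulr1 mulr0 subr0.
have H1 : GL2 (upp u a) by rewrite unit_GL2 ?dd.
have H2 : \det (upp u b) = \det (upp u a) by rewrite !dd.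
rewrite -[RHS](pairing_inv hl hz hv0 H1 H2 hg (e_ind n) (e'_ind m)).
have E1 := sphn_upp hl hchi1 hpsi1 uchi1 upsi1 n hu ha.
have E2 := sphn_upp hl hchi2 hpsi2 uchi2 upsi2 m hu hb.
by rewrite E1 E2.
Qed.

Lemma Umx_pairing n m (u v w : 'I_l) : B (e n) (e' m) (Umx u%:R v%:R w%:R) =
  if (u : nat) == 0%N then B (e n) (e' m) DS else B (e n) (e' m) G.
Proof.
have gS : GSp4 DS := sp_GSp4 hl split_rep_sp.
have natZ (x : nat) : x%:R \in (Zl : {pred F}) by rewrite rpred_nat.
case: eqP => [u0|/(ord_unit hl (F := F)) hu].
  rewrite -(pairing_upp n m (@pabs1 l R F) (natZ v) (natZ w) gS); congr (B _ _ _).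
  rewrite u0 /split_rep /borel_mx iota_mx_of mul_mx_of4 // /mul_rows /=.
  congr (mx_of _ [:: [:: _; _; _; _]; [:: _; _; _; _]; [:: _; _; _; _]; [:: _; _; _; _]]);
    rewrite /= ?expr0 ?expr1; ring.
have un := pabs_unit_neq0 hu.
pose k : 'M[F]_4 := mx_of 4 [:: [:: u%:R^-1; 0; 0; 0]; [:: 0; u%:R^-1; 0; 0];
  [:: 0; 0; 1; 0]; [:: 0; 0; 0; 1]].
have [_ uV] := unitZl hu.
have hk : Kg k.
  split; first by ij4; rewrite mxE /= ?uV ?rpred0 ?rpred1.
  exists (u%:R^-1); first by rewrite pabsV hu invr1.
  apply: spP; ij4; rewrite /pr !mxE /=; ring.
rewrite -(pairing_upp n m hu (natZ v) (natZ w) gG) -[RHS](pairing_Kg _ v0K _ _ _ hk).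
congr (B _ _ _); rewrite /graph_rep /borel_mx iota_mx_of !mul_mx_of4 // /mul_rows /=.
congr (mx_of _ [:: [:: _; _; _; _]; [:: _; _; _; _]; [:: _; _; _; _]; [:: _; _; _; _]]);
  rewrite /= ?expr0 ?expr1; by field.
Qed.

Lemma Umx_GSp4 (u v w : F) : GSp4 (Umx u v w).
Proof.
apply/GSp4P; exists l%:R; first exact: lF_neq0.
apply: spP; ij4; rewrite /pr !mxE /=; ring.
Qed.

Lemma PS_Uop : PS (Uop v0).
Proof.
apply: PS_sum => u; apply: PS_sum => v; apply: PS_sum => w.
by apply: PSr; exact: Umx_GSp4.
Qed.

Lemma Uop_pairing n m : pairing z (e n) (e' m) (Uop v0) =
  l%:R ^+ 2 * (B (e n) (e' m) DS + (l%:R - 1) * B (e n) (e' m) G).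
Proof.
have PU (u v w : F) : PS (rtrans (Umx u v w) v0) by apply: PSr; exact: Umx_GSp4.
rewrite (pairing_sum hz _ (e_ind n) (e'_ind m)
  (v := fun u : 'I_l => fun g => \sum_(v < l) \sum_(w < l) rtrans (Umx u%:R v%:R w%:R) v0 g));
  last by move=> u; apply: PS_sum => v; apply: PS_sum.
pose f (u : 'I_l) := if (u : nat) == 0%N then B (e n) (e' m) DS else B (e n) (e' m) G.
rewrite (eq_bigr (fun u => l%:R ^+ 2 * f u)) => [|u _].
  by rewrite -mulr_sumr /f sum_if0 ?prime_gt0.
rewrite (pairing_sum hz _ (e_ind n) (e'_ind m)
  (v := fun v : 'I_l => fun g => \sum_(w < l) rtrans (Umx u%:R v%:R w%:R) v0 g));
  last by move=> v; apply: PS_sum.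
rewrite (eq_bigr (fun=> l%:R * f u)) => [|v _].
  by rewrite sum_const card_ord mulrA -expr2.
rewrite (pairing_sum hz _ (e_ind n) (e'_ind m)
  (v := fun w : 'I_l => rtrans (Umx u%:R v%:R w%:R) v0)); last by move=> w.
rewrite (eq_bigr (fun=> f u)) => [|w _]; first by rewrite sum_const card_ord.
by rewrite Umx_pairing.
Qed.

Notation P t := (fun g => ((l%:R * c1) ^- t.+1 : R[i]) * (e t.+1 g - e t g)).
Notation P' t := (fun g => ((l%:R * c2) ^- t.+1 : R[i]) * (e' t.+1 g - e' t g)).
Notation Q := ((1 - (l%:R * c1)^-1) * (1 - (l%:R * c2)^-1)).

Let lC : l%:R != 0 :> R[i].
Proof. by rewrite pnatr_eq0 eqn0Ngt prime_gt0. Qed.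

Let l1C : l%:R + 1 != 0 :> R[i].
Proof. by rewrite -mulrSr pnatr_eq0. Qed.

Let c1_neq0 : c1 != 0.
Proof. exact: c0_neq0. Qed.

Let c2_neq0 : c2 != 0.
Proof. exact: c0_neq0. Qed.

Lemma second_difference n m :
  B (e n.+1) (e' m.+1) 1%:M - B (e n.+1) (e' m) 1%:M -
    (B (e n) (e' m.+1) 1%:M - B (e n) (e' m) 1%:M) =
  c1 ^+ n * ((l%:R * c1 - 1) / (l%:R + 1)) *
    (c2 ^+ m * ((l%:R * c2 - 1) / (l%:R + 1)) * B (e 0) (e' 0) 1%:M).
Proof.
rewrite -(level1_right m (e_ind 0)).
exact: sub_sub_mulr (level1_left n (e'_ind m.+1)) (level1_left n (e'_ind m)).
Qed.

Lemma level_pairing t : pairing z (P t) (P' t) v0 =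
  (l%:R ^+ (2 * t.+1 - 2) * (l%:R + 1) ^+ 2)^-1 * Q * pairing z (e 0) (e' 0) v0.
Proof.
have E := pairing_diff hz ((l%:R * c1) ^- t.+1) ((l%:R * c2) ^- t.+1)
  (e_ind t.+1) (e_ind t) (e'_ind t.+1) (e'_ind t) hv0.
refine (eq_trans E (level_algebra lC l1C c1_neq0 c2_neq0 _)).
by have H := second_difference t t; rewrite (rtrans1 v0) in H; exact: H.
Qed.

Lemma U_pairing : c1 * c2 * l%:R ^+ 2 * nu1 l%:R * nu2 l%:R * rho l%:R ^+ 2 = 1 ->
  pairing z (P 0) (P' 0) (Uop v0) =
  l%:R / (l%:R + 1) ^+ 2 * (Q - (1 - rho l%:R * @sqrtl l R F) * 
    (1 - rho l%:R * nu1 l%:R * @sqrtl l R F) * (1 - rho l%:R * nu2 l%:R * @sqrtl l R F) *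
    (1 - rho l%:R * nu1 l%:R * nu2 l%:R * @sqrtl l R F)) * pairing z (e 0) (e' 0) v0.
Proof.
move=> hc.
have E := pairing_diff hz ((l%:R * c1) ^- 1) ((l%:R * c2) ^- 1)
  (e_ind 1) (e_ind 0) (e'_ind 1) (e'_ind 0) PS_Uop.
have lm : l%:R - 1 != 0 :> R[i].
  by rewrite subr_eq0 -[1]/(1%:R) eqr_nat -[1%N]/(0.+1) gtn_eqF ?prime_gt1.
have E1 := rtrans1 v0; rewrite -[in RHS]E1.
refine (eq_trans E (U_algebra (@sqrtl_sqr l R F hl) (@sqrtl_neq0 l R F hl) lm l1C
  c1_neq0 _ _ _ hc (level1_left 0 (e'_ind 0)) (level1_right 0 (e_ind 0))
  (level1_left 0 (e'_ind 1)) (level1_left 1 (e'_ind 0)) (level1_right 1 (e_ind 0))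
  (second_difference 1 1) (split_pairing 0 0)
  (split_pairing 1 0) (split_pairing 0 1) (split_pairing 1 1) outer_pairing inner_pairing mixed_pairing
  T_relation T1_relation graph_left graph_right graph_hecke
  (Uop_pairing 1 1) (Uop_pairing 1 0) (Uop_pairing 0 1) (Uop_pairing 0 0))); exact: char_neq0.
Qed.

End Relations.

Section LFactors.
Context {l : nat} {R : realType} {F : padicType l R}.
Hypothesis hl : prime l.

Lemma abschar_half_nat (k : nat) : abschar (2^-1 + k%:R) (l%:R : F) = (@sqrtl l R F)^-1 * l%:R ^- k.
Proof.
rewrite abschar_add ?lF_neq0 // abschar_half_l abschar_natl pabs_prime.
by rewrite -exprVn rmorphXn fmorphV rmorph_nat exprVn.
Qed.

Lemma twist_is_char (s : R) (tau : F -> R[i]) : is_char tau -> unramified tau ->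
  is_char (fun x => abschar s x * tau x) /\ unramified (fun x => abschar s x * tau x).
Proof.
move=> [t1 tM _] ut.
have u : unramified (fun x => abschar s x * tau x).
  by move=> x hx; rewrite (abschar_unramified _ hx) ut // mulr1.
split=> //; apply: unram_is_char => // [|x y x0 y0].
  by rewrite abschar1 t1 mulr1.
by rewrite abscharM tM //; ring.
Qed.

Lemma l_c0 (k : nat) (tau : F -> R[i]) : is_char tau ->
  (l%:R * c0 (fun x : F => abschar (2^-1 + k%:R) x * tau x))^-1 = l%:R ^+ k / tau l%:R.
Proof.
move=> ht; rewrite /c0 abschar_half_nat -(@sqrtl_sqr l R F hl).
have := @sqrtl_neq0 l R F hl; have := char_neq0 ht (lF_neq0 hl).
move: (sqrtl) (tau _) => S T T0 S0.
have : S ^+ 2 ^+ k != 0 by rewrite !expf_neq0.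
by move: (_ ^+ k) => K K0; field; rewrite T0 S0 K0.
Qed.

Lemma Lchar_mhalf (chi : F -> R[i]) : unramified chi ->
  Lchar chi (- 2^-1) = (1 - chi l%:R * @sqrtl l R F)^-1.
Proof.
move=> u; rewrite /Lchar asboolT // opprK.
have -> : 2^-1 = (2^-1)%:C :> R[i] by rewrite fmorphV rmorph_nat.
by rewrite cpow_real ?lgt0 // /sqrtl abschar_l opprK.
Qed.

Lemma Lspin_mhalf (nu1 nu2 rho : F -> R[i]) :
  unramified nu1 -> unramified nu2 -> unramified rho ->
  (Lspin nu1 nu2 rho (- 2^-1))^-1 = 
    (1 - rho l%:R * @sqrtl l R F) * 
    (1 - rho l%:R * nu1 l%:R * @sqrtl l R F) * (1 - rho l%:R * nu2 l%:R * @sqrtl l R F) *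
    (1 - rho l%:R * nu1 l%:R * nu2 l%:R * @sqrtl l R F).
Proof.
move=> u1 u2 u3; rewrite /Lspin !Lchar_mhalf //; first by rewrite !invfM !invrK.
- by move=> x hx; rewrite u1 // u2 // u3 // !mulr1.
- by move=> x hx; rewrite u2 // u3 // !mulr1.
- by move=> x hx; rewrite u1 // u3 // !mulr1.
Qed.

End LFactors.

Theorem theorem3p7p1 (l : nat) (hl : prime l) (R : realType)
    (F : padicType l R)
    (mu nu : {measure set (padic_borel F) -> \bar R})
    (hmu : is_haar_add mu) (hnu : is_haar_mul nu)
    (e : F -> R[i]) (he : is_std_addchar e)
    (nu1 nu2 rho : F -> R[i])
    (hsigma : principal_series_cond nu1 nu2 rho)
    (hunr : [/\ unramified nu1, unramified nu2 & unramified rho])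
    (hirr : irreducible_rep (principal_series nu1 nu2 rho) (@rtrans l R F 4))
    (v0 : 'M[F]_4 -> R[i])
    (hv0 : principal_series nu1 nu2 rho v0) (hv0_neq0 : v0 <> (fun=> 0))
    (hv0_inv : forall k : 'M[F]_4, GSp4Z k -> rtrans k v0 = v0)
    (k1 k2 : nat) (tau1 tau2 : F -> R[i])
    (htau1 : [/\ is_char tau1, unramified tau1 & finite_order tau1])
    (htau2 : [/\ is_char tau2, unramified tau2 & finite_order tau2])
    (chi1 chi2 psi1 psi2 : F -> R[i])
    (hpsi1 : psi1 = abschar (- 2^-1)) (hpsi2 : psi2 = abschar (- 2^-1))
    (hchi1 : chi1 = (fun x => abschar (2^-1 + k1%:R) x * tau1 x))
    (hchi2 : chi2 = (fun x => abschar (2^-1 + k2%:R) x * tau2 x))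
    (hcentral : forall x : F, x != 0 ->
       chi1 x * chi2 x * psi1 x * psi2 x * (nu1 x * nu2 x * rho x ^+ 2) = 1)
    (htemp : k1 = 0%N \/ k2 = 0%N ->
       essentially_tempered (principal_series nu1 nu2 rho) (@rtrans l R F 4))
    (z : ('M[F]_2 * 'M[F]_2 -> R[i]) -> ('M[F]_4 -> R[i]) -> R[i])
    (hz : invariant_bilinear (indH chi1 chi2 psi1 psi2)
            (principal_series nu1 nu2 rho) z) :
  let Fs := Fsec mu nu e chi1 chi2 psi1 psi2 in
  let Q : R[i] := (1 - l%:R ^+ k1 / tau1 l%:R) * (1 - l%:R ^+ k2 / tau2 l%:R) in
  (forall t : nat, (1 <= t)%N ->
     z (Fs (phit t) (phit t)) v0 =
       (l%:R ^+ (2 * t - 2) * (l%:R + 1) ^+ 2)^-1 * Q * z (Fs phi0 phi0) v0)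
  /\
  z (Fs (phit 1) (phit 1)) (Uop v0) =
    l%:R / (l%:R + 1) ^+ 2 * (Q - (Lspin nu1 nu2 rho (- 2^-1))^-1) *
    z (Fs phi0 phi0) v0.
Proof.
move=> Fs Q.
have [hn1 hn2 hrho _] := hsigma; have [un1 un2 urho] := hunr.
have [ct1 ut1 _] := htau1; have [ct2 ut2 _] := htau2.
have [cc1 uc1] := twist_is_char hl (2^-1 + k1%:R) ct1 ut1.
have [cc2 uc2] := twist_is_char hl (2^-1 + k2%:R) ct2 ut2.
rewrite -hchi1 in cc1 uc1; rewrite -hchi2 in cc2 uc2.
have cp1 : is_char psi1 by rewrite hpsi1; exact: abschar_is_char.
have cp2 : is_char psi2 by rewrite hpsi2; exact: abschar_is_char.
have up1 : unramified psi1 by rewrite hpsi1; exact: abschar_unramified.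
have up2 : unramified psi2 by rewrite hpsi2; exact: abschar_unramified.
have pl1 : psi1 l%:R = @sqrtl l R F by rewrite hpsi1.
have pl2 : psi2 l%:R = @sqrtl l R F by rewrite hpsi2.
have v0K k : Kg k -> rtrans k v0 = v0 by move=> hk; apply: hv0_inv; exact: KgZ.
have QE : Q = (1 - (l%:R * c0 chi1)^-1) * (1 - (l%:R * c0 chi2)^-1).
  by rewrite hchi1 hchi2 !(l_c0 hl).
have hc : c0 chi1 * c0 chi2 * l%:R ^+ 2 * nu1 l%:R * nu2 l%:R * rho l%:R ^+ 2 = 1.
  rewrite -[RHS](hcentral l%:R (lF_neq0 hl)).
  have E1 := chi_psi_l hl chi1 pl1.
  have E2 := chi_psi_l hl chi2 pl2.
  have -> : chi1 l%:R * chi2 l%:R * psi1 l%:R * psi2 l%:R =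
    chi1 l%:R * psi1 l%:R * (chi2 l%:R * psi2 l%:R) by ring.
  by rewrite E1 E2; move: (c0 chi1) (c0 chi2) => *; ring.
have F0 : z (Fs phi0 phi0) v0 = pairing z (sphn chi1 psi1 0) (sphn chi2 psi2 0) v0.
  rewrite /Fs /Fsec (siegel_phi0 hl cc1 cp1 uc1 up1 hmu hnu he).
  by rewrite (siegel_phi0 hl cc2 cp2 uc2 up2 hmu hnu he) /pairing !sphn0.
have s1 t := siegel_phit hl cc1 cp1 uc1 up1 pl1 hmu hnu he (ltn0Sn t).
have s2 t := siegel_phit hl cc2 cp2 uc2 up2 pl2 hmu hnu he (ltn0Sn t).
split=> [[//|t] _|].
  rewrite [X in _ = _ * X]F0 QE.
  rewrite /Fs /Fsec (s1 t) (s2 t).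
  exact: (level_pairing hl cc1 cc2 cp1 cp2 uc1 uc2 up1 up2 pl1 pl2 hz hv0 v0K t).
rewrite [X in _ = _ * X]F0 QE (Lspin_mhalf hl un1 un2 urho).
rewrite /Fs /Fsec (s1 0%N) (s2 0%N).
exact: (U_pairing hl hn1 hn2 hrho cc1 cc2 cp1 cp2 uc1 uc2 up1 up2 pl1 pl2 hz hv0 v0K hc).
Qed.
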